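(* Let $(M,\mathsf c)$ be an oriented conformal $4$-manifold and let $D^+,D^-$ be compatible Einstein-Weyl structures on $M$ whose Faraday curvatures $F^{D^+}$, $F^{D^-}$ are selfdual. Let $\theta=\frac12(D^+-D^-)$, and, on the open set where $\theta$ is nonvanishing, let $\xi=\theta/|\theta|$ (a conformal submersion with minimal Weyl derivative $D^0=D-|\theta|^{-1}D|\theta|$, where $D=\frac12(D^++D^-)$). Then $\xi$ is a selfdual conformal submersion, and also the skew part $\mathrm{alt}\,(D^0\otimes D^{\pm})\xi$ is selfdual (for both choices of sign).
   Context: Everything is smooth and local. On an $n$-manifold $M$, $L^w$ denotes the oriented real line bundle of densities of weight $w$, associated to the frame bundle by $A\mapsto|\det A|^{w/n}$; $L=L^1$. A conformal structure $\mathsf c$ is an $L^2$-valued (unit determinant) inner product $\langle\cdot,\cdot\rangle$ on $TM$; it identifies vectors with $1$-forms of the same weight, so a nonvanishing $1$-form $\theta$ has $|\theta|\in C^\infty(M,L^{-1})$ and $\theta/|\theta|$ is regarded as a section of $L^{-1}TM$. A Weyl derivative $D$ is a covariant derivative on $L$ (hence on every $L^w$), with curvature $2$-form $F^D$ (Faraday curvature); Weyl derivatives form an affine space modelled on $1$-forms. On a conformal manifold $D$ determines a unique torsion-free connection $D$ on $TM$ with $D\mathsf c=0$. $D$ is (a compatible) Einstein-Weyl (structure) if the symmetric tracefree part of its Ricci tensor vanishes. A weightless unit vector field $\xi\in C^\infty(M,L^{-1}TM)$ is a conformal submersion if (locally) it is tangent to the fibres of a submersion $\pi\colon M\to B$ onto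 a conformal manifold with $d\pi_x|_{\xi^\perp}$ conformal. Its minimal Weyl derivative $D^0$ is the unique Weyl derivative with $D^0_\xi\xi=0$ and $\mathrm{tr}\,D^0\xi=0$. On an oriented $4$-manifold $\xi$ is selfdual if the Faraday curvature of $D^0$ is a selfdual $2$-form. $(D^0\otimes D)\xi$ is the covariant derivative of $\xi\in L^{-1}\otimes TM$ using $D^0$ on $L^{-1}$ and $D$ on $TM$, an $L^{-1}$-valued endomorphism; $\mathrm{alt}$ denotes its skew part, identified with a $2$-form of weight $-1$ via $\mathsf c$. *)

(* Defs.v *)
From mathcomp Require Import all_boot all_order all_algebra.
From mathcomp Require Import all_classical all_reals all_analysis.
Import Order.TTheory GRing.Theory Num.Theory numFieldNormedType.Exports.

Set Implicit Arguments.
Unset Strict Implicit.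
Unset Printing Implicit Defensive.

Local Open Scope classical_set_scope.
Local Open Scope ring_scope.

(* Built on MathComp-Analysis. Points, vectors and 1-forms in coordinates are
   row vectors; the tangent map of f sends v to v *m jac f x. *)

Section Calculus.
Variables (R : realType) (n : nat).
Implicit Types (U : set 'rV[R]_n) (x : 'rV[R]_n).

Definition pderiv (i : 'I_n) (f : 'rV[R]_n -> R) : 'rV[R]_n -> R :=
  fun x => 'D_(delta_mx 0 i) f x.

Fixpoint Ck (k : nat) U (f : 'rV[R]_n -> R) : Prop :=
  (forall x, U x -> {for x, continuous f}) /\
  match k with
  | 0%N => True
  | k'.+1 => forall i : 'I_n,
      (forall x, U x -> derivable f x (delta_mx 0 i)) /\ Ck k' U (pderiv i f)
  end.

(* U is always an open set below. *)
Definition smooth U (f : 'rV[R]_n -> R) : Prop := forall k, Ck k U f.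

Definition smooth_mx p q U (F : 'rV[R]_n -> 'M[R]_(p, q)) : Prop :=
  forall i j, smooth U (fun x => F x i j).

Definition pderiv_mx p q (i : 'I_n) (F : 'rV[R]_n -> 'M[R]_(p, q)) x :
    'M[R]_(p, q) :=
  \matrix_(j, k) pderiv i (fun y => F y j k) x.

Definition grad (f : 'rV[R]_n -> R) x : 'rV[R]_n := \row_i pderiv i f x.

Definition jac m (f : 'rV[R]_n -> 'rV[R]_m) x : 'M[R]_(n, m) :=
  \matrix_(i, j) pderiv i (fun y => f y 0 j) x.

End Calculus.

(* The coordinate frame of a chart trivializes every density bundle L^w, so all
   the (weighted) objects below are given by component functions.  The metric c
   has unit determinant since it is L^2-valued. *)
Section ChartGeometry.
Variables (R : realType) (n : nat).
Implicit Types (U : set 'rV[R]_n) (x : 'rV[R]_n).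
Implicit Types (c : 'rV[R]_n -> 'M[R]_n) (al th v : 'rV[R]_n -> 'rV[R]_n).
Implicit Types (Gam : 'I_n -> 'rV[R]_n -> 'M[R]_n).

Definition bil (A : 'M[R]_n) (v w : 'rV[R]_n) : R := (v *m A *m w^T) 0 0.

Definition conformal_metric U c : Prop :=
  smooth_mx U c /\
  forall x, U x ->
    [/\ (c x)^T = c x,
        forall v : 'rV[R]_n, v != 0 -> 0 < bil (c x) v v
      & \det (c x) = 1].

(* A Weyl derivative is given by its connection form al on L:
   D u = d u + w al u for a section u of L^w. *)
Definition density_deriv (w : R) al (u : 'rV[R]_n -> R) x : 'rV[R]_n :=
  grad u x + (w * u x) *: al x.

Definition faraday al x : 'M[R]_n :=
  \matrix_(i, j) (pderiv i (fun y => al y 0 j) x - pderiv j (fun y => al y 0 i) x).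

(* (Gam i x) j k is the Christoffel symbol Gamma^k_{ij}.  The last clause is
   D c = 0 for c regarded as a section of L^2 (x) S^2 T^*M. *)
Definition weyl_connection U c al Gam : Prop :=
  [/\ forall i, smooth_mx U (Gam i),
      forall x, U x -> forall i j k, Gam i x j k = Gam j x i k
    & forall x, U x -> forall i,
        pderiv_mx i c x + (2 * al x 0 i) *: c x
          - Gam i x *m c x - c x *m (Gam i x)^T = 0].

(* Row-vector convention: D_i v = d_i v + v *m Gam i, whence the order of the
   factors in the quadratic terms. *)
Definition curvature Gam (i j : 'I_n) x : 'M[R]_n :=
  pderiv_mx i (Gam j) x - pderiv_mx j (Gam i) x
    + Gam j x *m Gam i x - Gam i x *m Gam j x.

(* Ric (Y, Z) = tr (X |-> R_{X,Y} Z) *)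
Definition ricci Gam x : 'M[R]_n :=
  \matrix_(j, l) \sum_k curvature Gam k j x l k.

Definition sym_tracefree (g A : 'M[R]_n) : 'M[R]_n :=
  let S := 2^-1 *: (A + A^T) in S - (n%:R^-1 * \tr (invmx g *m S)) *: g.

(* Covariant derivative of a section v of L^w (x) TM, using al on L^w and Gam on
   TM; row i is the derivative along the i-th coordinate vector. *)
Definition weighted_vector_deriv (w : R) al Gam v x : 'M[R]_n :=
  \matrix_(i, k) (pderiv i (fun y => v y 0 k) x + w * al x 0 i * v x 0 k
                    + (v x *m Gam i x) 0 k).

(* Skew part of the endomorphism E, as a 2-form by lowering an index with g. *)
Definition alt (g E : 'M[R]_n) : 'M[R]_n :=
  2^-1 *: (E *m g - (E *m g)^T).

Definition form_norm c th x : R := Num.sqrt (bil (invmx (c x)) (th x) (th x)).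

(* th / |th| as a section of L^-1 TM *)
Definition direction c th x : 'rV[R]_n :=
  (form_norm c th x)^-1 *: (th x *m invmx (c x)).

End ChartGeometry.

Section Selfduality.
Variable R : realType.

Definition levi_civita (i j k l : 'I_4) : R :=
  \det (\matrix_(p < 4, q < 4) (tnth [tuple i; j; k; l] p == q)%:R).

(* For the conformal metric g in an oriented chart the volume form has component
   sqrt (\det g) = 1. *)
Definition hodge (g F : 'M[R]_4) : 'M[R]_4 :=
  \matrix_(i, j) (2^-1 * \sum_k \sum_l
    levi_civita i j k l * (invmx g *m F *m (invmx g)^T) k l).

Definition is_selfdual (g F : 'M[R]_4) : Prop := hodge g F = F.

End Selfduality.

Record oriented_manifold (R : realType) (n : nat) := OrientedManifold {
  space :> topologicalType;
  chart : Type;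
  chart_dom : chart -> set space;
  chart_map : chart -> space -> 'rV[R]_n;
  chart_inv : chart -> 'rV[R]_n -> space;
  space_hausdorff : hausdorff_space space;
  space_second_countable : @second_countable space;
  chart_cover : forall p, exists a, chart_dom a p;
  chart_dom_open : forall a, open (chart_dom a);
  chart_img_open : forall a, open (chart_map a @` chart_dom a);
  chart_mapK : forall a p, chart_dom a p -> chart_inv a (chart_map a p) = p;
  chart_map_continuous : forall a p, chart_dom a p -> {for p, continuous (chart_map a)};
  chart_inv_continuous : forall a p, chart_dom a p ->
    {for chart_map a p, continuous (chart_inv a)};
  transition_smooth : forall a b,
    smooth_mx (chart_map a @` (chart_dom a `&` chart_dom b)) (fun x => chart_map b (chart_inv a x));
  transition_oriented : forall a b p, chart_dom a p -> chart_dom b p ->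
    0 < \det (jac (fun x => chart_map b (chart_inv a x)) (chart_map a p))
}.

(* A field on an open subset Om of M is a family of component functions, one for
   each chart a, which only matter on the image of Om and which obey the usual
   transformation law; a section of L^w picks up the factor |det|^(w/n). *)
Section ManifoldGeometry.
Variables (R : realType) (n : nat) (M : oriented_manifold R n).
Implicit Types (Om : set M) (a b : chart M).
Implicit Types (c : chart M -> 'rV[R]_n -> 'M[R]_n).
Implicit Types (al th xi : chart M -> 'rV[R]_n -> 'rV[R]_n).
Implicit Types (Gam : chart M -> 'I_n -> 'rV[R]_n -> 'M[R]_n).

Definition chart_img Om a : set 'rV[R]_n := chart_map a @` (chart_dom a `&` Om).

Definition transition a b : 'rV[R]_n -> 'rV[R]_n := fun x => chart_map b (chart_inv a x).

Definition jac_weight (w : R) a b x : R :=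
  `|\det (jac (transition a b) x)| `^ (w / n%:R).

Definition conformal_structure Om c : Prop :=
  (forall a, conformal_metric (chart_img Om a) (c a)) /\
  forall a b x, chart_img (chart_dom b `&` Om) a x ->
    jac (transition a b) x *m c b (transition a b x) *m (jac (transition a b) x)^T
      = jac_weight 2 a b x *: c a x.

Definition weyl_derivative Om al : Prop :=
  (forall a, smooth_mx (chart_img Om a) (al a)) /\
  forall a b x, chart_img (chart_dom b `&` Om) a x ->
    al a x = al b (transition a b x) *m (jac (transition a b) x)^T
               + grad (fun y => ln (jac_weight 1 a b y)) x.

(* al together with the torsion-free connection on TM it determines; the latter
   being unique in each chart, its transformation law is automatic. *)
Definition weyl_structure Om c al Gam : Prop :=
  weyl_derivative Om al /\
  forall a, weyl_connection (chart_img Om a) (c a) (al a) (Gam a).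

Definition einstein_weyl Om c al Gam : Prop :=
  weyl_structure Om c al Gam /\
  forall a x, chart_img Om a x -> sym_tracefree (c a x) (ricci (Gam a) x) = 0.

Definition nonvanishing th : set M :=
  [set p | forall a, chart_dom a p -> th a (chart_map a p) != 0].

(* unit sections of L^-1 TM *)
Definition weightless_unit_field Om c xi : Prop :=
  [/\ forall a, smooth_mx (chart_img Om a) (xi a),
      forall a x, chart_img Om a x -> bil (c a x) (xi a x) (xi a x) = 1
    & forall a b x, chart_img (chart_dom b `&` Om) a x ->
        xi b (transition a b x)
          = jac_weight (-1) a b x *: (xi a x *m jac (transition a b) x)].

Definition minimal_weyl_derivative Om c xi al0 : Prop :=
  exists2 Gam0, weyl_structure Om c al0 Gam0
  & forall a x, chart_img Om a x ->
      let Dxi := weighted_vector_deriv (-1) (al0 a) (Gam0 a) (xi a) x in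
      xi a x *m Dxi = 0 /\ \tr Dxi = 0.

End ManifoldGeometry.

(* As the condition is local, the base B is taken to be an open subset of R^n. *)
Definition conformal_submersion (R : realType) (n : nat)
    (M : oriented_manifold R n.+1) (Om : set M)
    (c : chart M -> 'rV[R]_n.+1 -> 'M[R]_n.+1)
    (xi : chart M -> 'rV[R]_n.+1 -> 'rV[R]_n.+1) : Prop :=
  weightless_unit_field Om c xi /\
  forall a x, chart_img Om a x ->
    exists (V : set 'rV[R]_n.+1) (B : set 'rV[R]_n)
           (pi : 'rV[R]_n.+1 -> 'rV[R]_n) (h : 'rV[R]_n -> 'M[R]_n),
    [/\ [/\ open V, V x & V `<=` chart_img Om a],
        [/\ open B, pi @` V = B & conformal_metric B h],
        smooth_mx V pi
      & forall y, V y ->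
        [/\ \rank (jac pi y) = n,
            xi a y *m jac pi y = 0
          & exists2 lam : R, 0 < lam & forall v w : 'rV[R]_n.+1,
              bil (c a y) (xi a y) v = 0 -> bil (c a y) (xi a y) w = 0 ->
              bil (h (pi y)) (v *m jac pi y) (w *m jac pi y)
                = lam * bil (c a y) v w]].

(* The minimal Weyl derivative is unique on Om, whence the plain existential. *)
Definition selfdual_conformal_submersion (R : realType)
    (M : oriented_manifold R 4) (Om : set M)
    (c : chart M -> 'rV[R]_4 -> 'M[R]_4)
    (xi : chart M -> 'rV[R]_4 -> 'rV[R]_4) : Prop :=
  conformal_submersion Om c xi /\
  exists2 al0, minimal_weyl_derivative Om c xi al0
  & forall a x, chart_img Om a x -> is_selfdual (c a x) (faraday (al0 a) x).

(* Main.v *)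
From HB Require Import structures.
Require Import Defs.
From mathcomp Require Import all_boot all_order all_algebra.
From mathcomp Require Import ring lra zify.
From mathcomp Require Import all_classical all_reals all_analysis.
Import Order.TTheory GRing.Theory Num.Theory numFieldNormedType.Exports.

(** Let al be the connection form of the mean Weyl derivative D, so that those of
    D+ and D- are al + th and al - th, and let G be the Christoffel symbols of D.

    Adding b to a connection form adds the algebraic expression [weyl_shift c b] to
    the Christoffel symbols.  In the difference of the Ricci tensors of D+ and D- the
    terms quadratic in th cancel, and what remains is linear in D th ([ricci_diff]).
    Hence the two Einstein-Weyl equations, subtracted, say that the symmetric part of
    D th is a multiple of the metric ([einstein_weyl_conformal_form]).  Everything
    else follows from this equation and the selfduality of both Faraday curvatures.

    The vector field dual to th is then conformal modulo its own direction: its flow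
    rescales the cometric on the covectors that annihilate it
    ([sharp_transversely_conformal]).  Projecting along the flow onto a hyperplane
    transverse to it gives a submersion pi with Jacobian J; the ratios of the entries
    of the pushed cometric J^T c^-1 J are constant along the fibres, so they define a
    conformal structure on the base for which pi is a conformal submersion
    ([flow_projection], [conformal_projection]).  The smooth flow is constructed as the
    limit of the Euler polygons with 2^m steps.  The derivative of the polygon of a
    field Y is the polygon of its tangent field (x, v) |-> (Y(x), dY_x v), so that each
    derivative of a flow is again a flow, and smoothness follows by induction on the
    order of differentiability ([Ck_flow]).

    The Weyl derivative D0 has connection form 2 al - d ln |th|
    ([adapted_weyl_formE]).  As d d = 0, its curvature is F(D0) = 2 F(D) = F(D+) + F(D-),
    which is selfdual ([faraday_adapted]).  Its minimality is the conformal equation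
    for D th again, read off from an explicit formula for (D0 (x) D') xi, where D' is
    any Weyl connection ([direction_deriv], [adapted_weyl_form_minimal]).  For
    D' = D+ or D- that formula is, after lowering the index, |th|^-1 D th plus a
    multiple of the metric.  Its skew part is
    |th|^-1 d th / 2 = |th|^-1 (F(D+) - F(D-)) / 4,
    which is selfdual for both signs ([adapted_deriv_alt]). *)

Set Implicit Arguments.
Unset Strict Implicit.
Unset Printing Implicit Defensive.

Local Open Scope classical_set_scope.
Local Open Scope ring_scope.

(** * Mean value theorems and differentiability in coordinates *)

Section Lines.
Variables (R : realType) (n : nat).
Implicit Types (x y z v : 'rV[R]_n) (f : 'rV[R]_n -> R).

Lemma is_derive_line (V : normedModType R) (f : V -> R) (x v : V) (t : R) :
  derivable f (x + t *: v) v ->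
  is_derive t 1 (fun s : R => f (x + s *: v)) ('D_v f (x + t *: v)).
Proof.
move=> df.
have E : (fun h : R => h^-1 *: (((fun s : R => f (x + s *: v)) \o shift t) (h *: 1) - f (x + t *: v)))
   = (fun h : R => h^-1 *: ((f \o shift (x + t *: v)) (h *: v) - f (x + t *: v))).
  apply/funext => h /=; congr (_ *: (f _ - _)).
  by rewrite scalerDl [_%:A]mulr1 addrCA.
by split; [rewrite /derivable E | rewrite /derive E].
Qed.

Lemma derivable_scale (V : normedModType R) (f : V -> R) (x v : V) (c : R) :
  derivable f x v -> derivable f x (c *: v) /\ 'D_(c *: v) f x = c * 'D_v f x.
Proof.
move=> df.
have h0 : is_derive (0 : R) (1 : R) (fun s : R => f (x + s *: v)) ('D_v f x).
  by have := @is_derive_line V f x v 0; rewrite scale0r addr0; apply.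
have h1 : is_derive (0 : R) (1 : R) (fun s : R => s * c) c.
  by apply: is_derive_eq; rewrite !(scaler0, add0r, addr0) [_%:A]mulr1.
have h0' : is_derive ((0 : R) * c) (1 : R) (fun s : R => f (x + s *: v)) ('D_v f x).
  by rewrite mul0r.
have h2 := @is_derive1_comp R (fun s : R => f (x + s *: v)) (fun s => s * c) 0 _ _ h0' h1.
have E : (fun h : R => h^-1 *: ((f \o shift x) (h *: (c *: v)) - f x))
   = (fun h : R => h^-1 *: (((((fun s : R => f (x + s *: v)) \o (fun s : R => s * c)) : R -> R) \o shift 0) (h *: 1) - (((fun s : R => f (x + s *: v)) \o (fun s : R => s * c)) : R -> R) 0)).
  apply/funext => h /=; congr (_ *: (f _ - f _)).
    by rewrite [_%:A]mulr1 addr0 scalerA addrC.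
  by rewrite mul0r scale0r addr0.
case: h2 => d2 e2; split; first by rewrite /derivable E.
by rewrite /derive E mulrC; exact: e2.
Qed.

Lemma mvt_line f x v (h : R) : 0 <= h ->
  (forall t, 0 <= t <= h -> derivable f (x + t *: v) v) ->
  exists2 t, 0 <= t <= h & f (x + h *: v) - f x = h * 'D_v f (x + t *: v).
Proof.
move=> h0 df.
have D t : 0 <= t <= h -> is_derive t 1 (fun s : R => f (x + s *: v)) ('D_v f (x + t *: v)).
  by move=> th; apply: is_derive_line; exact: df.
have [||c ch e] := @MVT_segment R (fun s => f (x + s *: v))
    (fun t => 'D_v f (x + t *: v)) 0 h h0.
- by move=> t; rewrite in_itv /= => /andP[t0 th]; apply: D; rewrite !ltW.
- apply: derivable_within_continuous => t; rewrite in_itv /= => th.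
  by have [] := D t th.
exists c; first by move: ch; rewrite in_itv.
by move: e; rewrite subr0 scale0r addr0 mulrC.
Qed.

(** The box spanned by x and y.  It contains the points visited when the coordinates are
    moved from those of x to those of y one at a time. *)
Definition between x y z : Prop :=
  forall i, Num.min (x 0 i) (y 0 i) <= z 0 i <= Num.max (x 0 i) (y 0 i).

Let hybrid x y (k : nat) : 'rV[R]_n := \row_j if (j < k)%N then y 0 j else x 0 j.

Let between_hybrid x y k (i : 'I_n) (t : R) : i = k :> nat -> 0 <= t <= 1 ->
  between x y (hybrid x y k + t *: ((y 0 i - x 0 i) *: delta_mx 0 i)).
Proof.
move=> ik /andP[t0 t1] j; rewrite !mxE eqxx /=.
have [->|ji] := eqVneq j i.
  rewrite ik ltnn mulr1.
  have [le|lt] := leP (x 0 i) (y 0 i); nra.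
rewrite !mulr0 addr0; case: ifP => _; rewrite ?ge_min ?le_max ?lexx ?orbT //.
Qed.

(** Moving one coordinate at a time reduces this to the mean value theorem on lines, at
    the price of one intermediate point per coordinate. *)
Lemma mvt_between f x y :
  (forall z, between x y z -> forall i, derivable f z (delta_mx 0 i)) ->
  exists2 zeta : 'I_n -> 'rV[R]_n, (forall i, between x y (zeta i)) &
    f y - f x = \sum_i (y 0 i - x 0 i) * pderiv i f (zeta i).
Proof.
move=> df.
have step (i : 'I_n) : exists2 z, between x y z &
    f (hybrid x y i.+1) - f (hybrid x y i) = (y 0 i - x 0 i) * pderiv i f z.
  set v := (y 0 i - x 0 i) *: (delta_mx 0 i : 'rV[R]_n).
  have bz (t : R) (t01 : 0 <= t <= 1) : between x y (hybrid x y i + t *: v).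
    exact: (@between_hybrid x y i i t erefl t01).
  have dv (t : R) : 0 <= t <= 1 -> derivable f (hybrid x y i + t *: v) (delta_mx 0 i).
    by move=> t01; exact: df (bz t t01) i.
  have [|t t01 e] := @mvt_line f (hybrid x y i) v 1 ler01.
    by move=> t t01; have [] := derivable_scale (y 0 i - x 0 i) (dv t t01).
  have [_ dE] := derivable_scale (y 0 i - x 0 i) (dv t t01).
  exists (hybrid x y i + t *: v); first exact: bz.
  move: e; rewrite mul1r scale1r dE /pderiv => <-; congr (f _ - _); apply/rowP => j; rewrite !mxE eqxx /= ltnS leq_eqVlt.
  have [->|ji] := eqVneq j i; first by rewrite eqxx ltnn /= mulr1 addrC subrK.
  by rewrite (negPf (_ : (j : nat) != i)) //= mulr0 addr0.
have /boolp.choice [zeta hz] : forall i : 'I_n, exists z, between x y z /\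
    f (hybrid x y i.+1) - f (hybrid x y i) = (y 0 i - x 0 i) * pderiv i f z.
  by move=> i; have [z ? ?] := step i; exists z.
exists zeta; first by move=> i; have [] := hz i.
under eq_bigr do rewrite -(hz _).2.
rewrite -(big_mkord xpredT (fun k => f (hybrid x y k.+1) - f (hybrid x y k))) telescope_sumr //.
congr (f _ - f _); apply/rowP => j; rewrite mxE ?ltn_ord //.
Qed.

Lemma norm_coord_le p q (v : 'M[R]_(p, q)) i j : `|v i j| <= `|v|.
Proof.
by rewrite [leRHS]/Num.Def.normr/= mx_normrE; exact: (le_bigmax _ _ (i, j)).
Qed.

Lemma norm_le_coord p q (v : 'M[R]_(p, q)) (e : R) : 0 <= e ->
  (forall i j, `|v i j| <= e) -> `|v| <= e.
Proof.
move=> e0 h; rewrite [leLHS]/Num.Def.normr/= mx_normrE.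
by apply: bigmax_le => // -[i j] _; exact: h.
Qed.

Lemma between_close x y z w e : between x y z ->
  `|w - x| <= e -> `|w - y| <= e -> `|w - z| <= e.
Proof.
move=> b hx hy; apply: norm_le_coord; first exact: le_trans (normr_ge0 _) hx.
move=> i j; rewrite (ord1 i).
have := b j; have := le_trans (norm_coord_le (w - x) 0 j) hx.
have := le_trans (norm_coord_le (w - y) 0 j) hy.
rewrite !mxE !ler_distl.
by have [] := leP (x 0 j) (y 0 j); lra.
Qed.

End Lines.

Section Differentials.
Variable R : realType.

Lemma is_derive_chain (V W W' : normedModType R) (g : V -> W) (f : W -> W')
    (x v : V) : derivable g x v -> differentiable f (g x) ->
  is_derive x v (f \o g) ('d f (g x) ('D_v g x)).
Proof.
move=> dg df.
have line (Z : normedModType R) (h : V -> Z) :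
    'D_v h x = 'D_1 (fun t : R => h (t *: v + x)) 0.
  pose l := fun t : R => h (t *: v + x).
  rewrite -/l /derive.
  have -> : (fun t : R => t^-1 *: ((h \o shift x) (t *: v) - h x)) =
      (fun t : R => t^-1 *: ((l \o shift 0) (t *: 1) - l 0)).
    by apply/funext => t; rewrite /l /= addr0 [_%:A]mulr1 scale0r add0r.
  by [].
have dl : differentiable (fun t : R => g (t *: v + x)) 0.
  by apply/derivable1_diffP; apply/(derivable1P g x v).
have df' : differentiable f (g ((0 : R) *: v + x)) by rewrite scale0r add0r.
have dc := @differentiable_comp _ _ _ _ (fun t : R => g (t *: v + x)) f 0 dl df'.
split; first by apply/(derivable1P (f \o g) x v)/derivable1_diffP.
rewrite !line deriveE // deriveE //.
rewrite (@diff_comp _ _ _ _ (fun t : R => g (t *: v + x)) f 0) //=.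
by rewrite scale0r add0r.
Qed.

Lemma differentiable_approx (V W : normedModType R) (f : V -> W) (x : V)
    (L : {linear V -> W}) : continuous L ->
  (forall e : R, 0 < e ->
     \forall h \near (0 : V), `|f (h + x) - f x - L h| <= e * `|h|) ->
  differentiable f x /\ 'd f x = L :> (V -> W).
Proof.
move=> cL aL.
have E : f \o shift x = cst (f x) + L +o_ 0 id.
  apply/eqaddoP => e e0; near=> h.
  rewrite -![(_ + _ : _ -> _) _]/(_ + _) -![(- _ : _ -> _) _]/(- _) /=.
  by rewrite opprD addrA; near: h; exact: aL.
have dE : 'd f x = L :> (V -> W) by exact: diff_unique E.
by split=> //; apply/diff_locallyP; rewrite dE.
Unshelve. all: by end_near. Qed.

Variable n : nat.
Implicit Types (x v : 'rV[R]_n) (f : 'rV[R]_n -> R).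

Lemma continuous_coord x i : {for x, continuous (fun y : 'rV[R]_n => y 0 i)}.
Proof. exact/differentiable_continuous/differentiable_coord. Qed.

Let lin (p : 'I_n -> R) (v : 'rV[R]_n) : R := \sum_i v 0 i * p i.

Let lin_linear p : linear (lin p).
Proof.
move=> a u v; rewrite /lin scaler_sumr -big_split /=; apply: eq_bigr => i _.
by rewrite !mxE mulrDl [in RHS]/GRing.scale /= mulrA.
Qed.

Let lin_continuous p : continuous (lin p).
Proof.
apply: continuous_big => [|i _ v]; first exact: add_continuous.
apply: continuousM; last exact: cst_continuous.
exact: continuous_coord.
Qed.

(** Continuous partial derivatives suffice: by the mean value theorem the remainder is a
    sum of terms v_i times the oscillation of the i-th partial derivative near x. *)
Lemma diff_of_partials U f x : open U -> U x ->
  (forall z, U z -> forall i, derivable f z (delta_mx 0 i)) ->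
  (forall i, {for x, continuous (pderiv i f)}) ->
  differentiable f x /\ forall v, 'd f x v = \sum_i v 0 i * pderiv i f x.
Proof.
move=> oU Ux df cf.
pose L := lin (fun i => pderiv i f x).
pose Lm := GRing.isLinear.Build _ _ _ _ _ (@lin_linear (fun i => pderiv i f x)).
pose L' : {linear 'rV[R]_n -> R} := HB.pack L Lm.
suff aL : forall e : R, 0 < e ->
    \forall h \near (0 : 'rV[R]_n), `|f (h + x) - f x - L' h| <= e * `|h|.
  have [|dx dE] := differentiable_approx _ aL; first exact: lin_continuous.
  by split=> // v; rewrite dE.
move=> e e0.
have e1 : 0 < e / n.+1%:R by rewrite divr_gt0.
have : \forall z \near x, forall i, `|pderiv i f x - pderiv i f z| <= e / n.+1%:R.
  apply: (@filter_forall _ _ (fun i z => `|pderiv i f x - pderiv i f z| <= e / n.+1%:R) (nbhs x)) => i.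
  by have /cvgrPdist_le/(_ _ e1) := cf i.
move=> /nbhs_ballP[d1 /= d1p h1].
have /nbhs_ballP[d2 /= d2p h2] : nbhs x U by apply: open_nbhs_nbhs.
pose d := Num.min d1 d2 / 2.
have dp : 0 < d by rewrite divr_gt0 // lt_min d1p.
apply/nbhs_ballP; exists d => //= h.
rewrite -ball_normE /= sub0r normrN => hd.
have cl z : between x (h + x) z -> `|x - z| <= d.
  move=> b; apply: between_close b _ _.
    by rewrite subrr normr0 ltW.
  by rewrite opprD addrCA subrr addr0 normrN ltW.
have clb z : between x (h + x) z -> ball x d1 z /\ ball x d2 z.
  move=> /cl le; rewrite -!ball_normE /=.
  have : d < Num.min d1 d2 by rewrite ltr_pdivrMr // ltr_pMr ?ltr1n // lt_min d1p.
  by rewrite lt_min => /andP[? ?]; split; apply: le_lt_trans le _.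
have [|zeta hz] := @mvt_between R n f x (h + x).
  by move=> z /clb[_ /h2]; exact: df.
rewrite /L' /= /L /lin => ->.
rewrite -sumrB; apply: le_trans (ler_norm_sum _ _ _) _.
have -> : e * `|h| = \sum_(i < n.+1) `|h| * (e / n.+1%:R).
  by rewrite sumr_const card_ord -[RHS]mulr_natr -[RHS]mulrA divfK ?pnatr_eq0 // mulrC.
rewrite big_ord_recl; apply: le_trans (_ : _ <= \sum_(i < n) `|h| * (e / n.+1%:R)) _; last first.
  by rewrite lerDr mulr_ge0 // ltW.
apply: ler_sum => i _.
rewrite !mxE addrK -mulrBr normrM.
apply: ler_pM => //; first exact: norm_coord_le.
by rewrite distrC; apply: h1; have [] := clb _ (hz i).
Qed.

End Differentials.

(** * Calculus of functions of class C^k *)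

Lemma near_eq_continuous (T S : topologicalType) (f g : T -> S) (x : T) :
  (\near x, f x = g x) -> {for x, continuous f} -> {for x, continuous g}.
Proof.
move=> fg cf; rewrite /prop_for /continuous_at -(nbhs_singleton fg).
by apply: cvg_trans cf; exact: near_eq_cvg.
Qed.

Lemma continuous_for_comp (T S Z : topologicalType) (f : T -> S) (g : S -> Z) (x : T) :
  {for x, continuous f} -> {for f x, continuous g} ->
  {for x, continuous (fun y => g (f y))}.
Proof. exact: continuous_comp. Qed.

Lemma continuous_for_dist (R : realType) (T : topologicalType) (V : normedModType R)
    (g : T -> V) (x : T) :
  (forall e, 0 < e -> \forall y \near x, `|g x - g y| <= e) -> {for x, continuous g}.
Proof. by move=> h; apply/cvgrPdist_le. Qed.

Section CkCalculus.
Variables (R : realType) (n : nat).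
Implicit Types (U V : set 'rV[R]_n) (x v : 'rV[R]_n) (f g : 'rV[R]_n -> R).

Local Notation "'e_ i" := (delta_mx 0 i : 'rV[R]_n) (at level 8, format "''e_' i").

Lemma Ck_continuous k U f x : Ck k U f -> U x -> {for x, continuous f}.
Proof. by case: k => [|k] [cf _]; exact: cf. Qed.

Lemma Ck_derivable k U f x i : Ck k.+1 U f -> U x -> derivable f x 'e_i.
Proof. by case=> _ h; have [df _] := h i; exact: df. Qed.

Lemma Ck_pderiv k U f i : Ck k.+1 U f -> Ck k U (pderiv i f).
Proof. by case=> _ h; have [] := h i. Qed.

Lemma Ck_pred k U f : Ck k.+1 U f -> Ck k U f.
Proof.
elim: k f => [|k IH] f; first by case.
move=> [cf h]; split=> // i; have [df hf] := h i; split=> //; exact: IH.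
Qed.

Lemma Ck_sub k U V f : V `<=` U -> Ck k U f -> Ck k V f.
Proof.
move=> sVU; elim: k f => [|k IH] f; first by move=> [cf _]; split=> // x /sVU; exact: cf.
move=> [cf h]; split; first by move=> x /sVU; exact: cf.
by move=> i; have [df hf] := h i; split; [move=> x /sVU; exact: df | exact: IH].
Qed.

Lemma open_near U x : open U -> U x -> \forall z \near x, U z.
Proof. by move=> oU Ux; apply: open_nbhs_nbhs; split. Qed.

Lemma near_eq_on (T : Type) U (f g : 'rV[R]_n -> T) x : open U -> U x -> (forall z, U z -> f z = g z) ->
  \forall z \near x, f z = g z.
Proof. by move=> oU Ux fg; apply: filterS (open_near oU Ux) => z; exact: fg. Qed.

Lemma pderiv_eq_on U f g x i : open U -> U x -> (forall z, U z -> f z = g z) ->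
  pderiv i f x = pderiv i g x.
Proof. by move=> oU Ux fg; apply: near_eq_derive; exact: (near_eq_on oU Ux fg). Qed.

Lemma Ck_eq k U f g : open U -> (forall x, U x -> f x = g x) -> Ck k U f -> Ck k U g.
Proof.
move=> oU; elim: k f g => [|k IH] f g fg [cf h]; split=> //;
  try by move=> x Ux; apply: near_eq_continuous (cf x Ux); exact: (near_eq_on oU Ux fg).
move=> i; have [df hf] := h i; split.
    move=> x Ux; apply: near_eq_derivable (df x Ux); exact: (near_eq_on oU Ux fg).
  by apply: IH hf => x Ux; exact: pderiv_eq_on fg.
Qed.

Lemma Ck_differentiable k U f x : open U -> Ck k.+1 U f -> U x ->
  differentiable f x.
Proof.
move=> oU hf Ux; apply: (proj1 (diff_of_partials oU Ux _ _)).
  by move=> z Uz i; exact: Ck_derivable i hf Uz.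
by move=> i; exact: Ck_continuous (Ck_pderiv i hf) Ux.
Qed.

Lemma Ck_diffE k U f x v : open U -> Ck k.+1 U f -> U x ->
  'd f x v = \sum_i v 0 i * pderiv i f x.
Proof.
move=> oU hf Ux; apply: (proj2 (diff_of_partials oU Ux _ _)).
  by move=> z Uz i; exact: Ck_derivable i hf Uz.
by move=> i; exact: Ck_continuous (Ck_pderiv i hf) Ux.
Qed.

Lemma Ck_cst k U (a : R) : Ck k U (fun=> a).
Proof.
elim: k a => [|k IH] a; (split=> //); try by move=> x _; exact: cst_continuous.
move=> i; split; first by move=> x _; exact: derivable_cst.
suff -> : pderiv i (fun=> a) = fun=> 0 by [].
by apply/funext => x; rewrite /pderiv derive_cst.
Qed.

Lemma is_derive_coord x v i : is_derive x v (fun y : 'rV[R]_n => y 0 i) (v 0 i).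
Proof.
have d : derivable (id : 'rV[R]_n -> 'rV[R]_n) x v by exact: derivable_id.
split; first by have /derivable_mxP := d; apply.
by have := derive_mx d; rewrite derive_id => /matrixP/(_ 0 i); rewrite mxE => <-.
Qed.

Lemma Ck_coord k U i : Ck k U (fun y : 'rV[R]_n => y 0 i).
Proof.
case: k => [|k]; (split=> //); try by move=> x _; exact: continuous_coord.
move=> j; split; first by move=> x _; have [] := is_derive_coord x 'e_j i.
suff -> : pderiv j (fun y : 'rV[R]_n => y 0 i) = fun=> ('e_j : 'rV[R]_n) 0 i.
  exact: Ck_cst.
by apply/funext => x; have [_] := is_derive_coord x 'e_j i.
Qed.

Lemma pderivD f g x i : derivable f x 'e_i -> derivable g x 'e_i ->
  pderiv i (fun y => f y + g y) x = pderiv i f x + pderiv i g x.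
Proof. exact: deriveD. Qed.

Lemma pderivM f g x i : derivable f x 'e_i -> derivable g x 'e_i ->
  pderiv i (fun y => f y * g y) x = pderiv i f x * g x + f x * pderiv i g x.
Proof.
move=> df dg; rewrite /pderiv [LHS](deriveM df dg) addrC /GRing.scale /=.
by congr (_ + _); rewrite mulrC.
Qed.

Lemma CkD k U f g : open U -> Ck k U f -> Ck k U g -> Ck k U (fun x => f x + g x).
Proof.
move=> oU; elim: k f g => [|k IH] f g hf hg; split=> //;
  try by move=> x Ux; apply: continuousD; [exact: Ck_continuous hf Ux|exact: Ck_continuous hg Ux].
move=> i; have df x Ux := @Ck_derivable k U f x i hf Ux.
  have dg x Ux := @Ck_derivable k U g x i hg Ux; split.
    by move=> x Ux; apply: derivableD; [exact: df|exact: dg].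
  apply: Ck_eq (IH _ _ (Ck_pderiv i hf) (Ck_pderiv i hg)) => // x Ux.
  by rewrite pderivD //; [exact: df|exact: dg].
Qed.

Lemma CkM k U f g : open U -> Ck k U f -> Ck k U g -> Ck k U (fun x => f x * g x).
Proof.
move=> oU; elim: k f g => [|k IH] f g hf hg; split=> //;
  try by move=> x Ux; apply: continuousM; [exact: Ck_continuous hf Ux|exact: Ck_continuous hg Ux].
move=> i; have df x Ux := @Ck_derivable k U f x i hf Ux.
  have dg x Ux := @Ck_derivable k U g x i hg Ux; split.
    by move=> x Ux; apply: derivableM; [exact: df|exact: dg].
  have h1 := IH _ _ (Ck_pderiv i hf) (Ck_pred hg).
  have h2 := IH _ _ (Ck_pred hf) (Ck_pderiv i hg).
  apply: Ck_eq (CkD oU h1 h2) => // x Ux.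
  by rewrite pderivM //; [exact: df|exact: dg].
Qed.

Lemma Ck_big k U (op : R -> R -> R) (idx : R) (I : Type) (r : seq I) (P : pred I)
    (F : I -> 'rV[R]_n -> R) : open U ->
  (forall f g, Ck k U f -> Ck k U g -> Ck k U (fun x => op (f x) (g x))) ->
  (forall i, P i -> Ck k U (F i)) -> Ck k U (fun x => \big[op/idx]_(i <- r | P i) F i x).
Proof.
move=> oU hop hF; elim: r => [|a r IH].
  by apply: Ck_eq (Ck_cst k U idx) => // x _; rewrite big_nil.
have [Pa|nPa] := boolP (P a).
  by apply: Ck_eq (hop _ _ (hF a Pa) IH) => // x _; rewrite big_cons Pa.
by apply: Ck_eq IH => // x _; rewrite big_cons (negPf nPa).
Qed.

Lemma Ck_sum k U (I : Type) (r : seq I) (P : pred I) (F : I -> 'rV[R]_n -> R) :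
  open U -> (forall i, P i -> Ck k U (F i)) ->
  Ck k U (fun x => \sum_(i <- r | P i) F i x).
Proof. by move=> oU; apply: Ck_big => // f g; exact: CkD. Qed.

Lemma Ck_prod k U (I : Type) (r : seq I) (P : pred I) (F : I -> 'rV[R]_n -> R) :
  open U -> (forall i, P i -> Ck k U (F i)) ->
  Ck k U (fun x => \prod_(i <- r | P i) F i x).
Proof. by move=> oU; apply: Ck_big => // f g; exact: CkM. Qed.

Lemma is_derive_real_comp (phi : R -> R) (dphi : R) f x v :
  derivable f x v -> is_derive (f x) 1 phi dphi ->
  is_derive x v (fun y => phi (f y)) (dphi * 'D_v f x).
Proof.
move=> df hphi.
have dp : differentiable phi (f x) by apply/derivable1_diffP; case: hphi.
have [d e] := is_derive_chain df dp; split => //; rewrite e.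
rewrite deriv1E; last by case: hphi.
by rewrite derive1E (@derive_val _ _ _ _ _ _ _ hphi) mulrC.
Qed.

(** Powers with real exponent are closed under differentiation, so the induction on k runs
    over all exponents at once; inverses and square roots are special cases. *)
Lemma Ck_powR k U f (a : R) : open U -> (forall x, U x -> 0 < f x) ->
  Ck k U f -> Ck k U (fun x => f x `^ a).
Proof.
move=> oU f0; have C b x : U x -> {for f x, continuous (fun y : R => y `^ b)}.
  move=> Ux; apply/differentiable_continuous/derivable1_diffP.
  by have [] := is_derive1_powR b (f0 x Ux).
elim: k a => [|k IH] a hf.
  by split=> // x Ux; exact: continuous_for_comp (Ck_continuous hf Ux) (C a x Ux).
have D x i : U x -> is_derive x 'e_i (fun y => f y `^ a) (a * f x `^ (a - 1) * pderiv i f x).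
  move=> Ux; apply: (@is_derive_real_comp (fun y => y `^ a)).
    exact: Ck_derivable _ hf Ux.
  exact: is_derive1_powR (f0 x Ux).
split.
  by move=> x Ux; exact: continuous_for_comp (Ck_continuous hf Ux) (C a x Ux).
move=> i; split; first by move=> x Ux; have [] := D x i Ux.
have h := CkM oU (CkM oU (Ck_cst k U a) (IH (a - 1) (Ck_pred hf))) (Ck_pderiv i hf).
by apply: Ck_eq h => // x Ux; have [_] := D x i Ux.
Qed.

(** As f may be negative, the real power is applied to its square. *)
Lemma Ck_inv k U f : open U -> (forall x, U x -> f x != 0) ->
  Ck k U f -> Ck k U (fun x => (f x)^-1).
Proof.
move=> oU f0 hf; have hf2 := CkM oU hf hf.
have h : Ck k U (fun x => f x * (f x * f x) `^ (-1)).
  by apply: CkM => //; apply: Ck_powR => // x /f0; rewrite -expr2 exprn_even_gt0.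
apply: Ck_eq h => // x /f0 fx; rewrite powR_inv1 -?expr2 ?sqr_ge0 //.
by rewrite expr2 invfM mulrA divff // mul1r.
Qed.

Lemma pderiv_ln U f x i : (forall x, U x -> 0 < f x) -> Ck 1 U f -> U x ->
  is_derive x 'e_i (fun y => ln (f y)) ((f x)^-1 * pderiv i f x).
Proof.
move=> f0 hf Ux; apply: (@is_derive_real_comp (@ln R)).
  exact: Ck_derivable _ hf Ux.
exact: is_derive1_ln (f0 x Ux).
Qed.

Lemma Ck_ln k U f : open U -> (forall x, U x -> 0 < f x) ->
  Ck k U f -> Ck k U (fun x => ln (f x)).
Proof.
move=> oU f0 hf.
have C : forall x, U x -> {for x, continuous (fun x => ln (f x))}.
  move=> x Ux; apply: continuous_for_comp (Ck_continuous hf Ux) _.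
  apply/differentiable_continuous/derivable1_diffP.
  by have [] := is_derive1_ln (f0 x Ux).
case: k hf => [|k] hf; split=> // i.
have hf1 : Ck 1 U f by elim: k hf => // k IH hf; apply: IH; exact: Ck_pred.
split; first by move=> x Ux; have [] := pderiv_ln i f0 hf1 Ux.
have h := CkM oU (Ck_inv oU (fun x Ux => lt0r_neq0 (f0 x Ux)) (Ck_pred hf)) (Ck_pderiv i hf).
by apply: Ck_eq h => // x Ux; have [_] := pderiv_ln i f0 hf1 Ux.
Qed.

End CkCalculus.

Section CkComposition.
Variables (R : realType) (n m : nat).
Implicit Types (U : set 'rV[R]_n) (V : set 'rV[R]_m).
Implicit Types (f : 'rV[R]_m -> R) (g : 'rV[R]_n -> 'rV[R]_m).

Lemma continuous_rowP g x : (forall j, {for x, continuous (fun y => g y 0 j)}) ->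
  {for x, continuous g}.
Proof.
move=> h; apply: continuous_for_dist => e e0.
have H : \forall y \near x, forall j, `|g x 0 j - g y 0 j| <= e.
  apply: (@filter_forall _ _ (fun j y => `|g x 0 j - g y 0 j| <= e) (nbhs x)) => j.
  by have /cvgrPdist_le := h j; exact.
apply: filterS H => y hy; apply: norm_le_coord; first exact: ltW.
by move=> i j; rewrite !mxE (ord1 i).
Qed.

Lemma is_derive_comp k V f g x v : open V -> Ck k.+1 V f -> V (g x) ->
  (forall j, derivable (fun y => g y 0 j) x v) ->
  is_derive x v (f \o g) (\sum_j 'D_v (fun y => g y 0 j) x * pderiv j f (g x)).
Proof.
move=> oV hf Vg dg.
have dg' : derivable g x v by apply/derivable_mxP => i j; rewrite (ord1 i).
have := is_derive_chain dg' (Ck_differentiable oV hf Vg).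
rewrite (Ck_diffE _ oV hf Vg) derive_mx //.
by under eq_bigr do rewrite mxE.
Qed.

Lemma Ck_comp k U V f g : open U -> open V -> (forall x, U x -> V (g x)) ->
  Ck k V f -> (forall j, Ck k U (fun x => g x 0 j)) -> Ck k U (f \o g).
Proof.
move=> oU oV UV; elim: k f => [|k IH] f hf hg.
  split=> // x Ux; apply: continuous_for_comp; last exact: Ck_continuous hf (UV x Ux).
  by apply: continuous_rowP => j; exact: Ck_continuous (hg j) Ux.
have D x i (Ux : U x) := is_derive_comp oV hf (UV x Ux) (fun j => @Ck_derivable R n k U _ x i (hg j) Ux).
split.
  move=> x Ux; apply: continuous_for_comp; last exact: Ck_continuous hf (UV x Ux).
  by apply: continuous_rowP => j; exact: Ck_continuous (hg j) Ux.
move=> i; split; first by move=> x Ux; have [] := D x i Ux.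
have h : Ck k U (fun x => \sum_j pderiv i (fun y => g y 0 j) x * pderiv j f (g x)).
  apply: Ck_sum => // j _; apply: CkM => //; first exact: Ck_pderiv.
  apply: (IH (pderiv j f)); first exact: Ck_pderiv.
  by move=> l; exact: Ck_pred.
by apply: Ck_eq h => // x Ux; have [_] := D x i Ux.
Qed.

End CkComposition.

(** * Symmetry of second derivatives *)

Section Schwarz.
Variables (R : realType) (n : nat).
Implicit Types (U : set 'rV[R]_n) (x v : 'rV[R]_n) (f : 'rV[R]_n -> R).

Local Notation "'e_ i" := (delta_mx 0 i : 'rV[R]_n) (at level 8, format "''e_' i").

Lemma norm_delta_le (i : 'I_n) : `|'e_i| <= 1.
Proof.
apply: norm_le_coord => // a b; rewrite mxE.
by case: (_ && _); rewrite ?normr1 ?normr0.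
Qed.

Let second_difference U f x i j (h : R) : 0 <= h -> Ck 2 U f ->
  (forall z, `|z - x| <= 2 * h -> U z) ->
  exists2 z, `|z - x| <= 2 * h &
   f (x + h *: 'e_i + h *: 'e_j) - f (x + h *: 'e_i) - f (x + h *: 'e_j) + f x
   = h * (h * pderiv j (pderiv i f) z).
Proof.
move=> h0 hf hU.
have close (s t : R) : 0 <= s <= h -> 0 <= t <= h -> `|(x + s *: 'e_i + t *: 'e_j) - x| <= 2 * h.
  move=> /andP[s0 sh] /andP[t0 th]; rewrite addrAC [x + _]addrC addrK.
  apply: le_trans (ler_normD _ _) _; rewrite !normrZ (ger0_norm s0) (ger0_norm t0).
  have := norm_delta_le i; have := norm_delta_le j.
  have := normr_ge0 'e_i; have := normr_ge0 'e_j; nra.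
have hh : 0 <= h <= h by rewrite h0 lexx.
have h00 : (0 : R) <= 0 <= h by rewrite lexx h0.
pose g y := f (y + h *: 'e_j) - f y.
have inU s t : 0 <= s <= h -> 0 <= t <= h -> U (x + s *: 'e_i + t *: 'e_j).
  by move=> sh th; apply: hU; exact: close.
have inU0 s : 0 <= s <= h -> U (x + s *: 'e_i).
  by move=> sh; have := inU s 0 sh h00; rewrite scale0r addr0.
have shift_d y : U (y + h *: 'e_j) ->
    is_derive y 'e_i (fun z => f (z + h *: 'e_j)) (pderiv i f (y + h *: 'e_j)).
  move=> Uy; have d := @Ck_derivable _ _ 1 U f _ i hf Uy.
  have E : (fun t : R => t^-1 *: (((fun z => f (z + h *: 'e_j)) \o shift y) (t *: 'e_i) - f (y + h *: 'e_j)))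
     = (fun t : R => t^-1 *: ((f \o shift (y + h *: 'e_j)) (t *: 'e_i) - f (y + h *: 'e_j))).
    by apply/funext => t /=; rewrite addrA.
  by split; [rewrite /derivable E | rewrite /pderiv /derive E].
have dg s : 0 <= s <= h -> is_derive (x + s *: 'e_i) 'e_i g
    (pderiv i f (x + s *: 'e_i + h *: 'e_j) - pderiv i f (x + s *: 'e_i)).
  move=> sh; have d1 := shift_d _ (inU s h sh hh).
  have d2 : is_derive (x + s *: 'e_i) 'e_i f (pderiv i f (x + s *: 'e_i)).
    by apply: derivableP; exact: (@Ck_derivable _ _ 1 U f _ i hf (inU0 s sh)).
  exact: is_deriveB d1 d2.
have [|s sh e1] := @mvt_line _ _ g x 'e_i h h0.
  by move=> s sh; have [] := dg s sh.
have [_ gE] := dg s sh; rewrite gE in e1.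
have [|t th e2] := @mvt_line _ _ (pderiv i f) (x + s *: 'e_i) 'e_j h h0.
  move=> t th; exact: (@Ck_derivable _ _ 0 U _ _ j (Ck_pderiv i hf) (inU s t sh th)).
exists (x + s *: 'e_i + t *: 'e_j); first exact: close.
rewrite -[pderiv j _ _]/('D_('e_j) (pderiv i f) _) -e2 -e1 /g.
move: (f (x + _ + _)) (f (x + h *: 'e_j)) (f (x + h *: 'e_i)) (f x).
by clear => p q r t'; ring.
Qed.

(** Both mixed derivatives are limits of the same second difference quotient. *)
Lemma schwarz U f x i j : open U -> Ck 2 U f -> U x ->
  pderiv i (pderiv j f) x = pderiv j (pderiv i f) x.
Proof.
move=> oU hf Ux; apply/eqP/negPn/negP => neq.
pose e := `|pderiv i (pderiv j f) x - pderiv j (pderiv i f) x| / 3.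
have e0 : 0 < e by rewrite divr_gt0 // normr_gt0 subr_eq0.
have ci a b : \forall z \near x, `|pderiv a (pderiv b f) x - pderiv a (pderiv b f) z| <= e.
  have c := @Ck_continuous _ _ 0 U _ _ (Ck_pderiv a (Ck_pderiv b hf)) Ux.
  by have /cvgrPdist_le/(_ _ e0) := c.
have /nbhs_ballP[d1 /= d1p h1] := ci i j.
have /nbhs_ballP[d2 /= d2p h2] := ci j i.
have /nbhs_ballP[d3 /= d3p h3] := open_near oU Ux.
have [d dp [dd1 dd2 dd3]] : exists2 d, 0 < d & [/\ d <= d1, d <= d2 & d <= d3].
  exists (Num.min d1 (Num.min d2 d3)); first by rewrite !lt_min d1p d2p.
  by rewrite !ge_min !lexx !orbT.
have b z : `|z - x| <= 2 * (d / 4) -> [/\ ball x d1 z, ball x d2 z & U z].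
  move=> zx; have lt : `|x - z| < d.
    by rewrite distrC; apply: le_lt_trans zx _; clear -dp; lra.
  by split; [| |apply: h3]; rewrite -ball_normE /=; apply: lt_le_trans lt _.
have h0 : 0 <= d / 4 by clear -dp; lra.
have [|z bz ez] := @second_difference U f x i j (d / 4) h0 hf; first by move=> z /b[].
have [|y bY ey] := @second_difference U f x j i (d / 4) h0 hf; first by move=> y /b[].
have E : pderiv i (pderiv j f) y = pderiv j (pderiv i f) z.
  apply: (@mulfI _ (d / 4)); first by rewrite gt_eqF //; clear -dp; lra.
  apply: (@mulfI _ (d / 4)); first by rewrite gt_eqF //; clear -dp; lra.
  apply: etrans (esym ey) _; apply: etrans _ ez.
  have -> : x + d / 4 *: 'e_j + d / 4 *: 'e_i = x + d / 4 *: 'e_i + d / 4 *: 'e_j.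
    by rewrite addrAC.
  move: (f (x + _ + _)) (f (x + d / 4 *: 'e_j)) (f (x + d / 4 *: 'e_i)) (f x).
  by clear => p q r s; ring.
have [/h1 /= H1 _ _] := b y bY; have [_ /h2 /= H2 _] := b z bz.
have gen (p q r s : R) : r = s -> p - q = (p - r) - (q - s) by move=> ->; ring.
have : `|pderiv i (pderiv j f) x - pderiv j (pderiv i f) x| <= e + e.
  rewrite [X in `|X|](gen _ _ _ _ E).
  exact: le_trans (ler_normB _ _) (lerD H1 H2).
by rewrite /e; move: e0; rewrite /e; clear; lra.
Qed.

End Schwarz.

(** * Smooth matrix-valued functions *)

Lemma entryB (V : zmodType) m n (A B : 'M[V]_(m, n)) i j : (A - B) i j = A i j - B i j.
Proof. by rewrite !mxE. Qed.

Lemma entryD (V : nmodType) m n (A B : 'M[V]_(m, n)) i j : (A + B) i j = A i j + B i j.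
Proof. by rewrite mxE. Qed.

Lemma entryN (V : zmodType) m n (A : 'M[V]_(m, n)) i j : (- A) i j = - A i j.
Proof. by rewrite mxE. Qed.

Lemma entryZ (V : pzRingType) m n a (A : 'M[V]_(m, n)) i j : (a *: A) i j = a * A i j.
Proof. by rewrite mxE. Qed.

Section SmoothMatrices.
Variables (R : realType) (n : nat).
Variable U : set 'rV[R]_n.
Hypothesis oU : open U.

Lemma smooth_eq f g : (forall x, U x -> f x = g x) -> smooth U f -> smooth U g.
Proof. by move=> fg hf k; exact: Ck_eq fg (hf k). Qed.

Lemma smooth_pderiv f i : smooth U f -> smooth U (pderiv i f).
Proof. by move=> hf k; apply: Ck_pderiv; exact: hf. Qed.

Lemma smooth_derivable f x i : smooth U f -> U x -> derivable f x (delta_mx 0 i).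
Proof. by move=> hf Ux; exact: (@Ck_derivable _ _ 0 U f x i (hf 1%N) Ux). Qed.

Lemma smooth_continuous f x : smooth U f -> U x -> {for x, continuous f}.
Proof. by move=> hf Ux; exact: Ck_continuous (hf 0%N) Ux. Qed.

Lemma smooth_sub V f : V `<=` U -> smooth U f -> smooth V f.
Proof. by move=> VU hf k; exact: Ck_sub VU (hf k). Qed.

Lemma smooth_mx_eq p q (F G : 'rV[R]_n -> 'M[R]_(p, q)) :
  (forall x, U x -> F x = G x) -> smooth_mx U F -> smooth_mx U G.
Proof. by move=> fg hf i j; apply: smooth_eq (hf i j) => x Ux; rewrite fg. Qed.

Lemma smooth_mx_sub V p q (F : 'rV[R]_n -> 'M[R]_(p, q)) :
  V `<=` U -> smooth_mx U F -> smooth_mx V F.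
Proof. by move=> VU hf i j k; exact: Ck_sub VU (hf i j k). Qed.

Lemma smooth_mx_cst p q (A : 'M[R]_(p, q)) : smooth_mx U (fun=> A).
Proof. by move=> i j k; exact: Ck_cst. Qed.

Lemma smooth_mx_id : smooth_mx U id.
Proof. by move=> i j k; rewrite (ord1 i); exact: Ck_coord. Qed.

Lemma smooth_mxD p q (F G : 'rV[R]_n -> 'M[R]_(p, q)) :
  smooth_mx U F -> smooth_mx U G -> smooth_mx U (fun x => F x + G x).
Proof.
move=> hF hG i j k; apply: Ck_eq (CkD oU (hF i j k) (hG i j k)) => // x _.
by rewrite mxE.
Qed.

Lemma smooth_mxZ p q (a : 'rV[R]_n -> R) (F : 'rV[R]_n -> 'M[R]_(p, q)) :
  smooth U a -> smooth_mx U F -> smooth_mx U (fun x => a x *: F x).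
Proof.
move=> ha hF i j k; apply: Ck_eq (CkM oU (ha k) (hF i j k)) => // x _.
by rewrite mxE.
Qed.

Lemma smooth_cst (a : R) : smooth U (fun=> a).
Proof. by move=> k; exact: Ck_cst. Qed.

Lemma smooth_mxB p q (F G : 'rV[R]_n -> 'M[R]_(p, q)) :
  smooth_mx U F -> smooth_mx U G -> smooth_mx U (fun x => F x - G x).
Proof.
move=> hF hG; have h := smooth_mxD hF (smooth_mxZ (smooth_cst (-1)) hG).
by apply: smooth_mx_eq h => x _; rewrite scaleN1r.
Qed.

Lemma smooth_mxM p q r (F : 'rV[R]_n -> 'M[R]_(p, q)) (G : 'rV[R]_n -> 'M[R]_(q, r)) :
  smooth_mx U F -> smooth_mx U G -> smooth_mx U (fun x => F x *m G x).
Proof.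
move=> hF hG i j k.
have h : Ck k U (fun x => \sum_l F x i l * G x l j).
  by apply: Ck_sum => // l _; apply: CkM => //; [exact: hF|exact: hG].
by apply: Ck_eq h => // x _; rewrite mxE.
Qed.

Lemma smooth_mx_tr p q (F : 'rV[R]_n -> 'M[R]_(p, q)) :
  smooth_mx U F -> smooth_mx U (fun x => (F x)^T).
Proof. by move=> hF i j k; apply: Ck_eq (hF j i k) => // x _; rewrite mxE. Qed.

Lemma smooth_sum (I : Type) (r : seq I) (P : pred I) (F : I -> 'rV[R]_n -> R) :
  (forall i, P i -> smooth U (F i)) -> smooth U (fun x => \sum_(i <- r | P i) F i x).
Proof. by move=> hF k; apply: Ck_sum => // i Pi; exact: hF. Qed.

Lemma smoothM f g : smooth U f -> smooth U g -> smooth U (fun x => f x * g x).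
Proof. by move=> hf hg k; apply: CkM. Qed.

Lemma smoothD f g : smooth U f -> smooth U g -> smooth U (fun x => f x + g x).
Proof. by move=> hf hg k; apply: CkD. Qed.

Lemma smooth_inv f : (forall x, U x -> f x != 0) -> smooth U f ->
  smooth U (fun x => (f x)^-1).
Proof. by move=> f0 hf k; apply: Ck_inv => //; exact: hf. Qed.

Lemma smooth_powR f (a : R) : (forall x, U x -> 0 < f x) -> smooth U f ->
  smooth U (fun x => f x `^ a).
Proof. by move=> f0 hf k; apply: Ck_powR => //; exact: hf. Qed.

Lemma smooth_ln f : (forall x, U x -> 0 < f x) -> smooth U f ->
  smooth U (fun x => ln (f x)).
Proof. by move=> f0 hf k; apply: Ck_ln => //; exact: hf. Qed.

Lemma smooth_det p (F : 'rV[R]_n -> 'M[R]_p) :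
  smooth_mx U F -> smooth U (fun x => \det (F x)).
Proof.
move=> hF k; apply: Ck_sum => // s _; apply: CkM => //; first exact: Ck_cst.
by apply: Ck_prod => // i _; exact: hF.
Qed.

(** Cramer rule: the entries are polynomials divided by the determinant. *)
Lemma smooth_mx_inv p (F : 'rV[R]_n -> 'M[R]_p) :
  (forall x, U x -> F x \in unitmx) -> smooth_mx U F ->
  smooth_mx U (fun x => invmx (F x)).
Proof.
move=> uF hF.
have hd : smooth U (fun x => (\det (F x))^-1).
  by apply: smooth_inv (smooth_det hF) => x /uF; rewrite unitmxE unitfE.
suff ha : smooth_mx U (fun x => \adj (F x)).
  by apply: smooth_mx_eq (smooth_mxZ hd ha) => x /uF ux; rewrite /invmx ux.
move=> i j k.
have hc : smooth U (fun x => \det (row' j (col' i (F x)))).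
  by apply: smooth_det => a b k'; apply: Ck_eq (hF _ _ k') => // x _; rewrite !mxE.
by apply: Ck_eq (CkM oU (Ck_cst k U ((-1) ^+ (j + i))) (hc k)) => // x _; rewrite mxE.
Qed.

Lemma smooth_mx_comp m p q (V : set 'rV[R]_m) (F : 'rV[R]_m -> 'M[R]_(p, q))
    (g : 'rV[R]_n -> 'rV[R]_m) : open V -> (forall x, U x -> V (g x)) ->
  smooth_mx V F -> smooth_mx U g -> smooth_mx U (fun x => F (g x)).
Proof.
move=> oV UV hF hg i j k; apply: (@Ck_comp _ _ _ k U V (fun y => F y i j)) => //.
  exact: hF.
by move=> l; exact: hg.
Qed.

End SmoothMatrices.

(** * Bounds on boxes *)

Section Boxes.
Variables (R : realType) (n : nat).
Implicit Types (U : set 'rV[R]_n) (a b x y z : 'rV[R]_n).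

Definition box a b : set 'rV[R]_n := [set z | forall i, a 0 i <= z 0 i <= b 0 i].

Lemma box_between a b x y z : box a b x -> box a b y -> between x y z -> box a b z.
Proof.
move=> hx hy hz i; have := hx i; have := hy i; have := hz i.
by have [] := leP (x 0 i) (y 0 i); lra.
Qed.

Lemma box_compact a b : compact (box a b).
Proof.
have := @rV_compact R n (fun i => `[a 0 i, b 0 i]%classic) (fun i => @segment_compact _ _ _).
congr compact; apply/seteqP; split=> z h i; have := h i; rewrite /= in_itv //=.
Qed.

Lemma box_bounded a b (f : 'rV[R]_n -> R) :
  (forall z, box a b z -> {for z, continuous f}) ->
  exists2 C, 0 <= C & forall z, box a b z -> `|f z| <= C.
Proof.
move=> cf; have [[z0 bz0]|ne] := pselect (box a b !=set0); last first.
  by exists 0 => // z bz; case: ne; exists z.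
have ca : {within box a b, continuous (fun z => `|f z|)}.
  apply: continuous_in_subspaceT => z; rewrite inE => bz.
  apply: (@continuous_for_comp _ _ _ f (fun t : R => `|t|)); first exact: cf.
  exact: norm_continuous.
have [|c _ hc] := @EVT_max_rV R n _ (box a b) _ (@box_compact a b) ca; first by exists z0.
exists `|f c| => // z bz; apply: hc; exact: mem_set.
Qed.

Lemma box_bounded_mx a b p q (F : 'rV[R]_n -> 'M[R]_(p, q)) :
  (forall z, box a b z -> forall i j, {for z, continuous (fun y => F y i j)}) ->
  exists2 C, 0 <= C & forall z, box a b z -> forall i j, `|F z i j| <= C.
Proof.
move=> cF.
have /boolp.choice [C hC] : forall ij : 'I_p * 'I_q, exists C, 0 <= C /\
    forall z, box a b z -> `|F z ij.1 ij.2| <= C.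
  move=> ij; have [|C C0 hC] := @box_bounded a b (fun y => F y ij.1 ij.2).
    by move=> z bz; exact: cF.
  by exists C.
exists (\sum_ij C ij); first by apply: sumr_ge0 => ij _; have [] := hC ij.
move=> z bz i j; rewrite (bigD1 (i, j)) //=.
apply: le_trans ((hC (i, j)).2 z bz) _.
by rewrite lerDl; apply: sumr_ge0 => ij _; have [] := hC ij.
Qed.

Lemma box_lipschitz U a b p q (F : 'rV[R]_n -> 'M[R]_(p, q)) :
  box a b `<=` U -> smooth_mx U F ->
  exists2 L, 0 <= L & forall y z, box a b y -> box a b z -> `|F y - F z| <= L * `|y - z|.
Proof.
move=> sU hF.
have [|C C0 hC] := @box_bounded_mx a b (p * q) n (fun x =>
    \matrix_(k, i) pderiv i (fun y => mxvec (F y) 0 k) x).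
  move=> z bz k i.
  have [u v] := mxvec_indexP k.
  have -> : (fun y => (\matrix_(k, i) pderiv i (fun y => mxvec (F y) 0 k) y) (mxvec_index u v) i)
      = pderiv i (fun y => F y u v).
    apply/funext => y; rewrite mxE; congr (pderiv i _ y).
    by apply/funext => w; rewrite mxvecE.
  exact: (@Ck_continuous _ _ 0 U _ _ (Ck_pderiv i (hF u v 1%N)) (sU _ bz)).
exists (n%:R * C); first by rewrite mulr_ge0.
move=> y z by_ bz; apply: norm_le_coord; first by rewrite !mulr_ge0.
move=> u v; rewrite !mxE.
have [|zeta hz ->] := @mvt_between R n (fun y => F y u v) z y.
  move=> w hw i; have bw := box_between bz by_ hw.
  exact: (@Ck_derivable _ _ 0 U _ _ i (hF u v 1%N) (sU _ bw)).
apply: le_trans (ler_norm_sum _ _ _) _.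
have -> : n%:R * C * `|y - z| = \sum_(i < n) C * `|y - z|.
  by rewrite sumr_const card_ord -[RHS]mulr_natl mulrA.
apply: ler_sum => i _; rewrite normrM mulrC; apply: ler_pM => //.
  have bw := box_between bz by_ (hz i).
  have := hC _ bw (mxvec_index u v) i; rewrite mxE.
  suff -> : (fun y => mxvec (F y) 0 (mxvec_index u v)) = (fun y => F y u v) by [].
  by apply/funext => w; rewrite mxvecE.
by have := norm_coord_le (y - z) 0 i; rewrite !mxE.
Qed.

End Boxes.

(** * Euler polygons and their limit *)

Section EulerOrbits.
Variables (R : realType) (n : nat).
Implicit Types (U V K : set 'rV[R]_n) (x z : 'rV[R]_n) (Y : 'rV[R]_n -> 'rV[R]_n).

Definition estep Y (h : R) z : 'rV[R]_n := z + h *: Y z.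

(** The polygons have 2^m steps of equal size on the time interval from 0 to 1, so that
    passing from m to m + 1 bisects every step. *)
Definition mesh (m : nat) : R := 2^-1 ^+ m.

Definition orbit Y m j z : 'rV[R]_n := iter j (estep Y (mesh m)) z.

Definition euler Y m z : 'rV[R]_n := orbit Y m (2 ^ m) z.

(** The position at time 1 of the integral curve of Y that starts at z. *)
Definition flow Y z : 'rV[R]_n :=
  \row_i lim (euler Y m z 0 i @[m --> \oo]).

(** Locally uniform confinement of all polygons to a compact box inside U.  It replaces
    completeness of Y: it bounds Y and its derivatives along the polygons, and it is
    inherited by the tangent field. *)
Definition tame Y U V : Prop := forall x, V x ->
  exists a b : 'rV[R]_n, box a b `<=` U /\
   \forall z \near x, forall m j, (j <= 2 ^ m)%N -> box a b (orbit Y m j z).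

Lemma mesh_gt0 m : 0 < mesh m. Proof. by rewrite exprn_gt0. Qed.

Lemma mesh_le m j : (j <= 2 ^ m)%N -> j%:R * mesh m <= 1.
Proof.
move=> jm; rewrite /mesh exprVn ler_pdivrMr ?exprn_gt0 // mul1r.
by rewrite -natrX ler_nat.
Qed.

Lemma mesh_small (e : R) : 0 < e -> exists m, mesh m < e.
Proof.
move=> e0; have h : (mesh m @[m --> \oo] --> (0 : R)).
  by apply: cvg_expr; rewrite ger0_norm // invf_lt1 // ltr1n.
have /cvgrPdist_lt/(_ e e0) [N _ hN] := h; exists N.
by have := hN N (leqnn N); rewrite /= sub0r normrN gtr0_norm // mesh_gt0.
Qed.

Lemma growth_le (L : R) m j : 0 <= L -> (j <= 2 ^ m)%N ->
  (1 + mesh m * L) ^+ j <= expR L.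
Proof.
move=> L0 jm; have h0 := mesh_gt0 m.
have hL : 0 <= mesh m * L by rewrite mulr_ge0 // ltW.
apply: le_trans (_ : _ <= expR (mesh m * L) ^+ j) _.
  apply: lerXn2r; rewrite ?nnegrE ?expR_ge0 //; first by rewrite addr_ge0.
  exact: expR_ge1Dx.
rewrite -expRM_natl ler_expR mulrA.
by rewrite -[leRHS]mul1r ler_wpM2r // mesh_le.
Qed.

(** Discrete Gronwall inequality: errors of size C h^2 in each of the 1/h steps, each
    amplified at most by (1 + h L)^(1/h) <= exp L, add up to an error of size h. *)
Lemma euler_perturb Y (L C : R) m (y z : nat -> 'rV[R]_n) :
  0 <= L -> 0 <= C -> y 0%N = z 0%N ->
  (forall j, (j < 2 ^ m)%N -> `|Y (y j) - Y (z j)| <= L * `|y j - z j|) ->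
  (forall j, (j < 2 ^ m)%N -> y j.+1 = estep Y (mesh m) (y j)) ->
  (forall j, (j < 2 ^ m)%N -> `|z j.+1 - estep Y (mesh m) (z j)| <= C * mesh m ^+ 2) ->
  `|y (2 ^ m)%N - z (2 ^ m)%N| <= expR L * C * mesh m.
Proof.
move=> L0 C0 yz0 lip.
move: (mesh_gt0 m) (growth_le L0 (leqnn (2 ^ m))) (mesh_le (leqnn (2 ^ m))).
move: (mesh m) => h h0 g s sy sz.
have main j : (j <= 2 ^ m)%N ->
    `|y j - z j| <= j%:R * (C * h ^+ 2) * (1 + h * L) ^+ j.
  elim: j => [|j IH] jm; first by rewrite yz0 subrr normr0 !mul0r.
  have {}IH := IH (ltnW jm).
  have -> : y j.+1 - z j.+1 = (y j - z j) + h *: (Y (y j) - Y (z j))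
     - (z j.+1 - estep Y h (z j)).
    rewrite (sy _ jm) /estep; apply/rowP => i; rewrite !mxE.
    move: (y j 0 i) (z j 0 i) (z j.+1 0 i) (Y (y j) 0 i) (Y (z j) 0 i) => p q r u v. ring.
  apply: le_trans (ler_normB _ _) _; apply: le_trans (lerD (ler_normD _ _) (sz _ jm)) _.
  rewrite normrZ (gtr0_norm h0).
  have e1 := lip _ jm.
  have hL : 0 <= h * L by rewrite mulr_ge0 // ltW.
  apply: le_trans (_ : _ <= (1 + h * L) * `|y j - z j| + C * h ^+ 2) _.
    by rewrite lerD2r mulrDl mul1r lerD2l -mulrA ler_wpM2l // ltW.
  have g1 : 1 <= (1 + h * L) ^+ j.+1 by rewrite exprn_ege1 // lerDl.
  have CC : 0 <= C * h ^+ 2 by rewrite mulr_ge0 // exprn_ge0 // ltW.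
  apply: le_trans (_ : _ <= (1 + h * L) * (j%:R * (C * h ^+ 2) * (1 + h * L) ^+ j) + C * h ^+ 2 * (1 + h * L) ^+ j.+1) _.
    apply: lerD; first by apply: ler_wpM2l => //; rewrite addr_ge0.
    by rewrite ler_peMr.
  by rewrite -natr1 [_ ^+ j.+1]exprS le_eqVlt; apply/orP; left; apply/eqP; ring.
apply: le_trans (main _ (leqnn _)) _.
have -> : (2 ^ m)%:R * (C * h ^+ 2) * (1 + h * L) ^+ (2 ^ m) =
   ((2 ^ m)%:R * h) * ((1 + h * L) ^+ (2 ^ m) * C * h) by ring.
apply: le_trans (_ : _ <= 1 * (expR L * C * h)) _; last by rewrite mul1r.
have hL : 0 <= h * L by rewrite mulr_ge0 // ltW.
apply: ler_pM => //.
- by rewrite mulr_ge0 // ltW.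
- by rewrite !mulr_ge0 // ?exprn_ge0 ?addr_ge0 // ltW.
by rewrite -!mulrA ler_wpM2r // mulr_ge0 // ltW.
Qed.

Lemma geometric_cvg (u : nat -> R) (C : R) : 0 <= C ->
  (forall m, `|u m.+1 - u m| <= C * mesh m) ->
  forall m, `|lim (u k @[k --> \oo]) - u m| <= 2 * C * mesh m.
Proof.
move=> C0 hu m0.
have tel m p : `|u (m + p)%N - u m| <= 2 * C * mesh m * (1 - mesh p).
  elim: p => [|p IH]; first by rewrite addn0 subrr normr0 /mesh expr0 subrr mulr0.
  have -> : u (m + p.+1)%N - u m = (u (m + p).+1 - u (m + p)%N) + (u (m + p)%N - u m).
    by rewrite addnS; ring.
  apply: le_trans (ler_normD _ _) _; apply: le_trans (lerD (hu _) IH) _.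
  by rewrite /mesh exprD exprS le_eqVlt; apply/orP; left; apply/eqP; field.
have tel' m p : `|u (m + p)%N - u m| <= 2 * C * mesh m.
  apply: le_trans (tel m p) _; have hm := mesh_gt0 m; have hp := mesh_gt0 p.
  by apply: ler_piMr; [rewrite !mulr_ge0 // ltW | rewrite lerBlDr lerDl ltW].
have cu : cvg (u k @[k --> \oo]).
  apply/cauchy_cvgP/cauchy_exP => e e0.
  have [|p hm] := @mesh_small (e / (2 * C + 1)).
    by rewrite divr_gt0 // ltr_wpDl // mulr_ge0.
  exists (u p); exists p => // k /= mk.
  rewrite -ball_normE /= distrC -(subnKC mk); apply: le_lt_trans (tel' _ _) _.
  rewrite ltr_pdivlMr in hm; last by rewrite ltr_wpDl // mulr_ge0.
  by have := mesh_gt0 p; lra.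
have : (`|u k - u m0| @[k --> \oo]) --> `|lim (u k @[k --> \oo]) - u m0|.
  by apply: cvg_norm; apply: cvgB => //; exact: cvg_cst.
move/cvgr_to_le; apply; exists m0 => // k /= mk.
by rewrite -(subnKC mk); exact: tel'.
Qed.

(** Two half steps differ from one full step by h/2 times the variation of Y over half
    a step, hence by O(h^2); the perturbation lemma turns this into O(h). *)
Lemma tame_euler_cauchy Y U V x : smooth_mx U Y -> tame Y U V -> V x ->
  exists2 C, 0 <= C & \forall z \near x, forall m,
    `|euler Y m.+1 z - euler Y m z| <= C * mesh m.
Proof.
move=> sY tY /tY[a [b [sU hb]]].
have [L L0 hL] := box_lipschitz sU sY.
have [|M M0 hM] := @box_bounded_mx R n a b _ _ Y.
  by move=> z bz i j; exact: (@Ck_continuous _ _ 0 U _ _ (sY i j 0%N) (sU _ bz)).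
exists (expR L * (L * M)); first by rewrite !mulr_ge0 // expR_ge0.
apply: filterS hb => z hz m.
have hE : mesh m.+1 = mesh m / 2 by rewrite /mesh exprS mulrC.
rewrite distrC.
have lt2 (j : nat) : (j < 2 ^ m)%N -> ((j.*2).+1 < 2 ^ m.+1)%N.
  by move=> jm; rewrite expnS mul2n; lia.
have -> : euler Y m.+1 z = orbit Y m.+1 (2 ^ m).*2 z by rewrite /euler expnS mul2n.
apply: (@euler_perturb Y L (L * M) m (fun j => orbit Y m j z)
   (fun j => orbit Y m.+1 j.*2 z)) => //.
- by rewrite mulr_ge0.
- move=> j jm; apply: hL; apply: hz; first exact: ltnW.
  by rewrite expnS mul2n leq_double ltnW.
- move=> j jm; rewrite doubleS.
  set w := orbit Y m.+1 j.*2 z.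
  have bw : box a b w by apply: hz; have := lt2 j jm; lia.
  have bw' : box a b (estep Y (mesh m.+1) w) by apply: (hz m.+1 (j.*2).+1); exact: ltnW (lt2 j jm).
  rewrite /orbit 2!iterS -/(orbit Y m.+1 j.*2 z) -/w.
  set w' := estep Y _ w in bw' *.
  have -> : estep Y (mesh m.+1) w' - estep Y (mesh m) w = (mesh m / 2) *: (Y w' - Y w).
    by rewrite {1}/estep {1}/w' /estep hE; apply/rowP => i; rewrite !mxE; field.
  have h0 := mesh_gt0 m.
  have h2 : 0 <= mesh m / 2 by rewrite divr_ge0 // ltW.
  rewrite normrZ (ger0_norm h2).
  have e1 := hL _ _ bw' bw.
  have e2 : `|w' - w| <= mesh m / 2 * M.
    rewrite /w' /estep hE [w + _]addrC addrK normrZ (ger0_norm h2).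
    rewrite ler_wpM2l //; apply: norm_le_coord => // i j'.
    exact: hM.
  have e3 : L * `|w' - w| <= L * (mesh m / 2 * M) by rewrite ler_wpM2l.
  have e4 : mesh m / 2 * `|Y w' - Y w| <= mesh m / 2 * (L * (mesh m / 2 * M)).
    by rewrite ler_wpM2l //; exact: le_trans e1 e3.
  apply: le_trans e4 _.
  have LM : 0 <= L * M * mesh m ^+ 2 by rewrite !mulr_ge0 // exprn_ge0 // ltW.
  have -> : mesh m / 2 * (L * (mesh m / 2 * M)) = L * M * mesh m ^+ 2 / 4 by field.
  by lra.
Qed.

Lemma tame_flow_rate Y U V x : smooth_mx U Y -> tame Y U V -> V x ->
  exists2 C, 0 <= C & \forall z \near x, forall m, `|flow Y z - euler Y m z| <= C * mesh m.
Proof.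
move=> sY tY Vx; have [C C0 hC] := tame_euler_cauchy sY tY Vx.
exists (2 * C); first by rewrite mulr_ge0.
apply: filterS hC => z hz m; apply: norm_le_coord.
  by rewrite !mulr_ge0 // ltW // mesh_gt0.
move=> i j; rewrite !mxE (ord1 i).
apply: (@geometric_cvg (fun k => euler Y k z 0 j)) => // k.
by have := le_trans (norm_coord_le _ 0 j) (hz k); rewrite !mxE.
Qed.

End EulerOrbits.

(** * The tangent field and its Euler polygons *)

Section SubBlocks.
Variables (R : realType) (n m : nat).
Implicit Types (U : set 'rV[R]_n).

Definition over U : set 'rV[R]_(n + m) := [set z | U (lsubmx z)].

Lemma smooth_lsubmx (W : set 'rV[R]_(n + m)) : smooth_mx W (@lsubmx R 1 n m).
Proof.
move=> i j k; rewrite (ord1 i).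
have -> : (fun z : 'rV[R]_(n + m) => lsubmx z 0 j) = (fun z => z 0 (lshift m j)).
  by apply/funext => z; rewrite mxE.
exact: Ck_coord.
Qed.

Lemma smooth_rsubmx (W : set 'rV[R]_(n + m)) : smooth_mx W (@rsubmx R 1 n m).
Proof.
move=> i j k; rewrite (ord1 i).
have -> : (fun z : 'rV[R]_(n + m) => rsubmx z 0 j) = (fun z => z 0 (rshift n j)).
  by apply/funext => z; rewrite mxE.
exact: Ck_coord.
Qed.

Lemma smooth_mx_continuous p (W : set 'rV[R]_p) q (F : 'rV[R]_p -> 'rV[R]_q) x :
  smooth_mx W F -> W x -> {for x, continuous F}.
Proof.
move=> sF Wx; apply: continuous_rowP => j.
exact: Ck_continuous (sF 0 j 0%N) Wx.
Qed.

Lemma open_preimage p q (F : 'rV[R]_p -> 'rV[R]_q) (W : set 'rV[R]_p) (U : set 'rV[R]_q) :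
  open W -> open U -> smooth_mx W F -> open [set z | W z /\ U (F z)].
Proof.
move=> oW oU sF; rewrite openE => z [Wz Uz].
have c := smooth_mx_continuous sF Wz.
have h : \forall y \near z, U (F y) by apply: c; exact: open_near.
by apply: filterS2 (open_near oW Wz) h => y Wy Uy.
Qed.

Lemma open_over U : open U -> open (over U).
Proof.
move=> oU.
have := @open_preimage _ _ (@lsubmx R 1 n m) setT U openT oU (@smooth_lsubmx setT).
by congr open; apply/seteqP; split=> z /=; [case|split].
Qed.

Lemma smooth_row_mx p (W : set 'rV[R]_p) q (F : 'rV[R]_p -> 'M[R]_(q, n))
    (G : 'rV[R]_p -> 'M[R]_(q, m)) : open W ->
  smooth_mx W F -> smooth_mx W G -> smooth_mx W (fun x => row_mx (F x) (G x)).
Proof.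
move=> oW hF hG i j; have [k ->|k ->] := split_ordP j.
  by apply: (smooth_eq oW) (hF i k) => x _; rewrite row_mxEl.
by apply: (smooth_eq oW) (hG i k) => x _; rewrite row_mxEr.
Qed.

Lemma norm_lsubmx (z : 'rV[R]_(n + m)) : `|lsubmx z| <= `|z|.
Proof. by apply: norm_le_coord => // i j; rewrite mxE; exact: norm_coord_le. Qed.

Lemma norm_rsubmx (z : 'rV[R]_(n + m)) : `|rsubmx z| <= `|z|.
Proof. by apply: norm_le_coord => // i j; rewrite mxE; exact: norm_coord_le. Qed.

Lemma norm_row_mx (x : 'rV[R]_n) (y : 'rV[R]_m) (e : R) :
  `|x| <= e -> `|y| <= e -> `|row_mx x y| <= e.
Proof.
move=> hx hy; apply: norm_le_coord; first exact: le_trans (normr_ge0 x) hx.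
move=> i j; have [k ->|k ->] := split_ordP j; rewrite ?row_mxEl ?row_mxEr.
  exact: le_trans (norm_coord_le x i k) hx.
exact: le_trans (norm_coord_le y i k) hy.
Qed.

Lemma lsub_near (P : 'rV[R]_n -> Prop) (z : 'rV[R]_(n + m)) :
  (\forall x \near lsubmx z, P x) -> \forall y \near z, P (lsubmx y).
Proof.
exact: (@smooth_mx_continuous _ setT _ (@lsubmx R 1 n m) z (@smooth_lsubmx setT) I).
Qed.

Lemma box_row_mx (a b : 'rV[R]_n) (c d : 'rV[R]_m) z :
  box (row_mx a c) (row_mx b d) z <-> box a b (lsubmx z) /\ box c d (rsubmx z).
Proof.
split=> [h|[h1 h2] j].
  split=> i; first by have := h (lshift m i); rewrite !row_mxEl mxE.
  by have := h (rshift n i); rewrite !row_mxEr mxE.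
have [k ->|k ->] := split_ordP j; rewrite ?row_mxEl ?row_mxEr.
  by have := h1 k; rewrite mxE.
by have := h2 k; rewrite mxE.
Qed.

Lemma box_const (e : R) (v : 'rV[R]_m) : `|v| <= e -> box (const_mx (- e)) (const_mx e) v.
Proof.
move=> h i; rewrite !mxE -ler_norml.
exact: le_trans (norm_coord_le v 0 i) h.
Qed.

End SubBlocks.

Section TangentField.
Variables (R : realType) (n : nat).
Implicit Types (U V : set 'rV[R]_n) (Y : 'rV[R]_n -> 'rV[R]_n).

(** The field of the variational equation: the second component is the first-order
    variation of the first. *)
Definition tangent Y (z : 'rV[R]_(n + n)) : 'rV[R]_(n + n) :=
  row_mx (Y (lsubmx z)) (rsubmx z *m jac Y (lsubmx z)).

Lemma smooth_jac m U (F : 'rV[R]_n -> 'rV[R]_m) : smooth_mx U F -> smooth_mx U (jac F).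
Proof.
move=> sF i j k; have -> : (fun x => jac F x i j) = pderiv i (fun y => F y 0 j).
  by apply/funext => x; rewrite mxE.
by apply: Ck_pderiv; exact: sF.
Qed.

Lemma smooth_tangent U Y : open U -> smooth_mx U Y ->
  smooth_mx (@over R n n U) (tangent Y).
Proof.
move=> oU sY; have oW := @open_over R n n U oU.
apply: smooth_row_mx => //.
  by apply: (smooth_mx_comp oW oU) => //; exact: smooth_lsubmx.
apply: smooth_mxM => //; first exact: smooth_rsubmx.
apply: (smooth_mx_comp oW oU) => //; first exact: smooth_jac.
exact: smooth_lsubmx.
Qed.

Lemma orbit_lsub Y m j z : lsubmx (orbit (tangent Y) m j z) = orbit Y m j (lsubmx z).
Proof.
elim: j => // j IH; rewrite /orbit !iterS -/(orbit _ m j z) -/(orbit _ m j (lsubmx z)).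
by rewrite -IH /estep /tangent linearD linearZ /= row_mxKl.
Qed.

Lemma orbit_rsubS Y m j z : rsubmx (orbit (tangent Y) m j.+1 z) =
  rsubmx (orbit (tangent Y) m j z)
   + mesh R m *: (rsubmx (orbit (tangent Y) m j z) *m jac Y (orbit Y m j (lsubmx z))).
Proof.
rewrite -orbit_lsub {1}/orbit iterS -/(orbit _ m j z) {1}/estep {2}/tangent.
by rewrite linearD linearZ /= row_mxKr.
Qed.

(** Differentiating one Euler step of Y gives one Euler step of the tangent field. *)
Lemma orbit_derive U Y m j x v : open U -> smooth_mx U Y ->
  (forall i, (i < j)%N -> U (orbit Y m i x)) ->
  forall k, is_derive x v (fun y => orbit Y m j y 0 k)
    (rsubmx (orbit (tangent Y) m j (row_mx x v)) 0 k).
Proof.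
move=> oU sY; elim: j => [|j IH] hU k.
  by rewrite /orbit /= row_mxKr; exact: is_derive_coord.
have {}IH := IH (fun i ij => hU i (ltnW ij)).
rewrite orbit_rsubS row_mxKl.
have Uj := hU j (ltnSn j).
have d1 : is_derive x v (fun y => Y (orbit Y m j y) 0 k)
    ((rsubmx (orbit (tangent Y) m j (row_mx x v)) *m jac Y (orbit Y m j x)) 0 k).
  have dj i : derivable (fun y => orbit Y m j y 0 i) x v by have [] := IH i.
  have D := @is_derive_comp R n n 0 U (fun y => Y y 0 k) (orbit Y m j) x v oU (sY 0 k 1%N) Uj dj.
  apply: (@is_derive_eq _ _ _ (fun y => Y (orbit Y m j y) 0 k) x v _ _ D).
  rewrite mxE; apply: eq_bigr => i _.
  by rewrite (@derive_val _ _ _ _ _ _ _ (IH i)) [jac _ _ _ _]mxE.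
have d2 := is_deriveD (IH k) (is_deriveZ (mesh R m) d1).
have E : (fun y => orbit Y m j.+1 y 0 k) =
    (fun y => orbit Y m j y 0 k) + (mesh R m \*: (fun y => Y (orbit Y m j y) 0 k)).
  by apply/funext => y; rewrite /orbit iterS /estep !mxE.
rewrite E; apply: (is_derive_eq d2).
by rewrite [RHS]mxE [X in _ = _ + X]mxE.
Qed.

Lemma orbit_continuous U Y m j x : smooth_mx U Y ->
  (forall i, (i < j)%N -> U (orbit Y m i x)) -> {for x, continuous (orbit Y m j)}.
Proof.
move=> sY; elim: j => [|j IH] hU; first by move=> y.
have {}IH := IH (fun i ij => hU i (ltnW ij)).
have c1 : {for x, continuous (fun y => Y (orbit Y m j y))}.
  apply: continuous_for_comp IH _.
  exact: smooth_mx_continuous sY (hU j (ltnSn j)).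
have c2 : {for x, continuous (fun y => mesh R m *: Y (orbit Y m j y))}.
  exact: (continuous_for_comp (g := fun w : 'rV[R]_n => mesh R m *: w) c1 (@scaler_continuous _ _ _ _)).
exact: continuousD IH c2.
Qed.

(** The first component is confined by hypothesis, and the second grows at most by the
    factor exp L because it satisfies a linear equation. *)
Lemma tame_tangent U V Y : open U -> smooth_mx U Y -> tame Y U V ->
  tame (tangent Y) (@over R n n U) (@over R n n V).
Proof.
move=> oU sY tY z /tY[a [b [sU hb]]].
have [|M M0 hM] := @box_bounded_mx R n a b _ _ (jac Y).
  by move=> y by_ i j; exact: (@Ck_continuous _ _ 0 U _ _ (smooth_jac sY i j 0%N) (sU _ by_)).
pose L := n%:R * M; have L0 : 0 <= L by rewrite mulr_ge0.
have mulL (w : 'rV[R]_n) y : box a b y -> `|w *m jac Y y| <= L * `|w|.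
  move=> by_; apply: norm_le_coord; first by rewrite mulr_ge0.
  move=> i k; rewrite mxE; apply: le_trans (ler_norm_sum _ _ _) _.
  have -> : L * `|w| = \sum_(j < n) M * `|w|.
    by rewrite sumr_const card_ord -[RHS]mulr_natl mulrA.
  apply: ler_sum => j _; rewrite normrM mulrC; apply: ler_pM => //; first exact: hM.
  exact: norm_coord_le.
pose rho := expR L * (`|z| + 1).
exists (row_mx a (const_mx (- rho))), (row_mx b (const_mx rho)); split.
  by move=> y /box_row_mx[/sU].
have nz : \forall y \near z, `|z - y| < 1.
  by apply/nbhs_ballP; exists 1 => //= y; rewrite -ball_normE.
have nb := lsub_near hb.
apply: filterS2 nz nb => y zy hy m j jm.
apply/box_row_mx; rewrite orbit_lsub; split; first exact: hy.
apply: box_const.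
have ry : `|rsubmx y| <= `|z| + 1.
  apply: le_trans (norm_rsubmx y) _.
  have -> : y = z - (z - y) by rewrite opprB addrC subrK.
  by apply: le_trans (ler_normB _ _) _; rewrite lerD2l ltW.
have h0 := mesh_gt0 R m.
have main i : (i <= 2 ^ m)%N ->
    `|rsubmx (orbit (tangent Y) m i y)| <= (1 + mesh R m * L) ^+ i * `|rsubmx y|.
  elim: i => [|i IH] im; first by rewrite expr0 mul1r.
  have {}IH := IH (ltnW im).
  rewrite orbit_rsubS; apply: le_trans (ler_normD _ _) _.
  rewrite normrZ (gtr0_norm h0).
  have e1 := mulL (rsubmx (orbit (tangent Y) m i y)) _ (hy m i (ltnW im)).
  have e2 : mesh R m * `|rsubmx (orbit (tangent Y) m i y) *m jac Y (orbit Y m i (lsubmx y))|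
      <= mesh R m * (L * `|rsubmx (orbit (tangent Y) m i y)|).
    by rewrite ler_wpM2l // ltW.
  apply: le_trans (lerD (lexx _) e2) _.
  rewrite exprS -mulrA; apply: le_trans (_ : _ <= (1 + mesh R m * L) * `|rsubmx (orbit (tangent Y) m i y)|) _.
    by rewrite mulrDl mul1r mulrA.
  by apply: ler_wpM2l => //; rewrite addr_ge0 // mulr_ge0 // ltW.
apply: le_trans (main j jm) _; rewrite /rho; apply: ler_pM => //.
  by rewrite exprn_ge0 // addr_ge0 // mulr_ge0 // ltW.
exact: growth_le.
Qed.

End TangentField.

(** * Smooth dependence of the flow on the initial point *)

Section FlowSmoothness.
Variable R : realType.

(** Differentiation of a uniform limit whose derivatives converge uniformly, with the
    rate of convergence C h of the Euler polygons. *)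
Lemma limit_derivative n (f df : nat -> 'rV[R]_n -> R) (u w : 'rV[R]_n -> R)
    (x v : 'rV[R]_n) (C : R) : 0 <= C ->
  (\forall z \near x, forall m, is_derive z v (f m) (df m z)) ->
  (\forall z \near x, forall m, `|u z - f m z| <= C * mesh R m) ->
  (\forall z \near x, forall m, `|w z - df m z| <= C * mesh R m) ->
  {for x, continuous w} -> is_derive x v u (w x).
Proof.
move=> C0 /nbhs_ballP[d1 /= d1p h1] /nbhs_ballP[d2 /= d2p h2] /nbhs_ballP[d3 /= d3p h3] cw.
suff H : h^-1 *: ((u \o shift x) (h *: v) - u x) @[h --> 0^'] --> w x.
  split; first by apply/cvg_ex; exists (w x).
  by apply: cvg_lim => //; exact: norm_hausdorff.
apply/cvgrPdist_le => e e0.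
have e2 : 0 < e / 2 by rewrite divr_gt0.
have /nbhs_ballP[d4 /= d4p h4] : \forall z \near x, `|w x - w z| <= e / 2.
  by have /cvgrPdist_le/(_ _ e2) := cw.
have [d dp [e1 e2' e3 e4]] : exists2 d, 0 < d & [/\ d <= d1, d <= d2, d <= d3 & d <= d4].
  exists (Num.min (Num.min d1 d2) (Num.min d3 d4)); first by rewrite !lt_min d1p d2p d3p.
  by rewrite !ge_min !lexx !orbT.
have hd : 0 < d / (`|v| + 1) by rewrite divr_gt0 // ltr_wpDl.
apply/nbhs_ballP; exists (d / (`|v| + 1)) => //= h.
rewrite -ball_normE /= sub0r normrN => hh hn0.
have inb t : 0 <= t <= 1 -> `|x - (x + t *: (h *: v))| < d.
  move=> /andP[t0 t1]; rewrite opprD addrA subrr sub0r normrN !normrZ (ger0_norm t0).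
  rewrite ltr_pdivlMr in hh; last by rewrite ltr_wpDl.
  apply: le_lt_trans hh; apply: le_trans (_ : _ <= `|h| * `|v|) _.
    by rewrite ler_piMl ?mulr_ge0.
  by rewrite ler_wpM2l // lerDl.
have bnd m : `|u (h *: v + x) - u x - h * w x| <= `|h| * (e / 2) + (2 + `|h|) * C * mesh R m.
  have D t : 0 <= t <= 1 -> is_derive (x + t *: (h *: v)) v (f m) (df m (x + t *: (h *: v))).
    by move=> t01; apply: h1; rewrite -ball_normE /=; exact: lt_le_trans (inb t t01) e1.
  have [|t t01] := @mvt_line R n (f m) x (h *: v) 1 ler01.
    move=> t t01; have [dt _] := D t t01.
    by have [] := derivable_scale h dt.
  have [dt dE] := D t t01; have [_ ->] := derivable_scale h dt.
  rewrite dE scale1r mul1r => eq.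
  have b1 : `|u (x + h *: v) - f m (x + h *: v)| <= C * mesh R m.
    apply: h2; rewrite -ball_normE /= -[h *: v]scale1r.
    by apply: lt_le_trans e2'; apply: inb; rewrite ler01 lexx.
  have b0 : `|u x - f m x| <= C * mesh R m by apply: h2; exact: ballxx.
  have bt := inb t t01.
  have b3 : `|w (x + t *: (h *: v)) - df m (x + t *: (h *: v))| <= C * mesh R m.
    by apply: h3; rewrite -ball_normE /=; exact: lt_le_trans bt e3.
  have b4 : `|w x - w (x + t *: (h *: v))| <= e / 2.
    by apply: h4; rewrite -ball_normE /=; exact: lt_le_trans bt e4.
  rewrite [h *: v + x]addrC.
  move: (u (x + h *: v)) (f m (x + h *: v)) (u x) (f m x) (w x)
    (w (x + t *: (h *: v))) (df m (x + t *: (h *: v))) eq b1 b0 b3 b4.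
  move: (mesh R m); clear => h' a b c p q r s eq b1 b0 b3 b4.
  have -> : a - c - h * q = (a - b) - (c - p) + h * ((s - r) - (q - r)).
    have -> : b = h * s + p by rewrite -eq subrK.
    by ring.
  apply: le_trans (ler_normD _ _) _; apply: le_trans (lerD (ler_normB _ _) (lexx _)) _.
  have b5 : `|h * (s - r - (q - r))| <= `|h| * (C * h' + e / 2).
    rewrite normrM ler_wpM2l //; apply: le_trans (ler_normB _ _) _.
    by apply: lerD => //; rewrite distrC.
  apply: le_trans (lerD (lerD b1 b0) b5) _.
  by rewrite le_eqVlt; apply/orP; left; apply/eqP; ring.
have [m hm] : exists m, mesh R m < `|h| * (e / 2) / ((2 + `|h|) * C + 1).
  apply: mesh_small; rewrite divr_gt0 ?mulr_gt0 ?normr_gt0 //.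
  by rewrite ltr_wpDl // mulr_ge0 // addr_ge0.
have {bnd} := bnd m.
have A0 : 0 <= (2 + `|h|) * C by rewrite mulr_ge0 // addr_ge0.
rewrite ltr_pdivlMr in hm; last by rewrite ltr_wpDl.
have {}hm : (2 + `|h|) * C * mesh R m <= `|h| * (e / 2).
  apply: le_trans (ltW hm); rewrite mulrC ler_wpM2l ?ltW ?mesh_gt0 //.
  by rewrite ltrDl.
move=> bnd.
have {}bnd : `|u (h *: v + x) - u x - h * w x| <= `|h| * e.
  by apply: le_trans bnd _; rewrite [e in leRHS]splitr mulrDr lerD2l.
have -> : w x - h^-1 *: ((u \o shift x) (h *: v) - u x)
    = - (h^-1 * (u (h *: v + x) - u x - h * w x)).
  by rewrite mulrBr mulrA mulVf // mul1r opprB.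
rewrite normrN normrM normfV ler_pdivrMl ?normr_gt0 //.
Qed.

Lemma flow_continuous n (U V : set 'rV[R]_n) Y x :
  smooth_mx U Y -> tame Y U V -> V x -> {for x, continuous (flow Y)}.
Proof.
move=> sY tY Vx; have [C C0 hC] := tame_flow_rate sY tY Vx.
have [a [b [sU hb]]] := tY x Vx.
apply: continuous_for_dist => e e0.
have [m hm] : exists m, mesh R m < e / 3 / (C + 1).
  by apply: mesh_small; rewrite !divr_gt0 // ltr_wpDl.
have {}hm : C * mesh R m <= e / 3.
  rewrite ltr_pdivlMr in hm; last by rewrite ltr_wpDl.
  by apply: le_trans (ltW hm); rewrite mulrC ler_wpM2l ?lerDl // ltW // mesh_gt0.
have cE : {for x, continuous (euler Y m)}.
  apply: orbit_continuous sY _ => i im; apply: sU.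
  by apply: (nbhs_singleton hb); exact: ltnW.
have e3 : 0 < e / 3 by rewrite divr_gt0.
have nE : \forall y \near x, `|euler Y m x - euler Y m y| <= e / 3.
  by have /cvgrPdist_le/(_ _ e3) := cE.
have hx := nbhs_singleton hC m.
apply: filterS2 hC nE => y hy nEy.
have -> : flow Y x - flow Y y = (flow Y x - euler Y m x) +
    ((euler Y m x - euler Y m y) - (flow Y y - euler Y m y)).
  by apply/rowP => i; rewrite !mxE; move: (lim _) (lim _) (euler _ _ _ _ _) (euler _ _ _ _ _) => p q r s; ring.
apply: le_trans (ler_normD _ _) _; apply: le_trans (lerD (lexx _) (ler_normB _ _)) _.
have := hy m; lra.
Qed.

Lemma flow_derive n (U V : set 'rV[R]_n) Y x v i : open U -> open V ->
  smooth_mx U Y -> tame Y U V -> V x ->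
  is_derive x v (fun y => flow Y y 0 i) (flow (tangent Y) (row_mx x v) 0 (rshift n i)).
Proof.
move=> oU oV sY tY Vx.
have sT := smooth_tangent oU sY; have tT := tame_tangent oU sY tY.
have [C C0 hC] := tame_flow_rate sY tY Vx.
have VT : @over R n n V (row_mx x v) by rewrite /over /= row_mxKl.
have [C' C0' hC'] := tame_flow_rate sT tT VT.
have crow : {for x, continuous (fun y => row_mx y v : 'rV[R]_(n + n))}.
  apply: (@smooth_mx_continuous R n V (n + n) (fun y => row_mx y v) x) Vx.
  exact: (smooth_row_mx oV (@smooth_mx_id R n V) (smooth_mx_cst V v)).
have {}hC' : \forall y \near x, forall m, `|flow (tangent Y) (row_mx y v) - euler (tangent Y) m (row_mx y v)| <= C' * mesh R m.
  exact: crow hC'.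
have [a [b [sU hb]]] := tY x Vx.
have mg0 m := ltW (mesh_gt0 R m).
apply: (@limit_derivative n (fun m y => euler Y m y 0 i)
   (fun m y => rsubmx (euler (tangent Y) m (row_mx y v)) 0 i) _ (fun y => flow (tangent Y) (row_mx y v) 0 (rshift n i)) x v (C + C')).
- by rewrite addr_ge0.
- apply: filterS hb => y hy m; apply: (orbit_derive v oU sY) => j jm.
  by apply: sU; apply: hy; exact: ltnW.
- apply: filterS hC => y hy m; apply: le_trans (_ : _ <= C * mesh R m) _.
    by have := le_trans (norm_coord_le _ 0 i) (hy m); rewrite !mxE.
  by rewrite mulrDl lerDl mulr_ge0.
- apply: filterS hC' => y hy m; apply: le_trans (_ : _ <= C' * mesh R m) _.
    by have := le_trans (norm_coord_le _ 0 (rshift n i)) (hy m); rewrite !mxE.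
  by rewrite mulrDl lerDr mulr_ge0.
apply: (@continuous_for_comp _ _ _ (fun y => flow (tangent Y) (row_mx y v)) (fun z : 'rV[R]_(n + n) => z 0 (rshift n i))).
  apply: (@continuous_for_comp _ _ _ (fun y => row_mx y v) (flow (tangent Y))) crow _.
  exact: flow_continuous sT tT VT.
exact: continuous_coord.
Qed.

(** The derivative of the flow in a fixed direction is a component of the flow of the
    tangent field ([flow_derive]), which is tame and smooth as well.  The induction hypothesis is used
    in dimension 2n, whence the quantification over n. *)
Theorem Ck_flow k : forall n (U V : set 'rV[R]_n) Y, open U -> open V ->
  smooth_mx U Y -> tame Y U V -> forall i, Ck k V (fun x => flow Y x 0 i).
Proof.
elim: k => [|k IH] n U V Y oU oV sY tY i;
  have cF x : V x -> {for x, continuous (fun x => flow Y x 0 i)} by move=> Vx;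
    exact: continuous_for_comp (flow_continuous sY tY Vx) (@continuous_coord _ _ _ i).
  by [].
have sT := smooth_tangent oU sY.
have tT := tame_tangent oU sY tY.
have oU' := @open_over R n n U oU; have oV' := @open_over R n n V oV.
have {}IH := IH _ _ _ _ oU' oV' sT tT.
pose w v x := flow (tangent Y) (row_mx x v) 0 (rshift n i).
have sw v : Ck k V (w v).
  apply: (@Ck_comp R n (n + n) k V (@over R n n V) (fun z => flow (tangent Y) z 0 (rshift n i))
    (fun x => row_mx x v)) => //.
    by move=> x Vx; rewrite /over /= row_mxKl.
  by move=> j; apply: (smooth_row_mx oV (@smooth_mx_id R n V) (smooth_mx_cst V v)).
have main x v (Vx : V x) := flow_derive v i oU oV sY tY Vx.
split=> // l; split; first by move=> x Vx; have [] := main x (delta_mx 0 l) Vx.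
apply: Ck_eq (sw (delta_mx 0 l)) => // x Vx.
by have [_ e] := main x (delta_mx 0 l) Vx; rewrite /pderiv e.
Qed.

End FlowSmoothness.

(** * The local flow of a vector field *)

Section LocalFlow.
Variables (R : realType) (n : nat).
Implicit Types (U : set 'rV[R]_n) (X : 'rV[R]_n -> 'rV[R]_n) (z : 'rV[R]_(n + 1)).

Lemma le_mesh (x y C : R) : 0 <= C -> (forall m, x <= y + C * mesh R m) -> x <= y.
Proof.
move=> C0 h; apply/ler_addgt0Pr => e e0.
have [m hm] : exists m, mesh R m < e / (C + 1).
  by apply: mesh_small; rewrite divr_gt0 // ltr_wpDl.
apply: le_trans (h m) _; rewrite lerD2l.
rewrite ltr_pdivlMr in hm; last by rewrite ltr_wpDl.
by apply: le_trans (ltW hm); rewrite mulrC ler_wpM2l ?lerDl // ltW // mesh_gt0.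
Qed.

Lemma flow_box (V U' : set 'rV[R]_n) Y x a b : smooth_mx U' Y -> tame Y U' V -> V x ->
  (forall m, box a b (euler Y m x)) -> box a b (flow Y x).
Proof.
move=> sY tY Vx hb i; have [C C0 hC] := tame_flow_rate sY tY Vx.
have r m : `|flow Y x 0 i - euler Y m x 0 i| <= C * mesh R m.
  by have := le_trans (norm_coord_le _ 0 i) (nbhs_singleton hC m); rewrite !mxE.
apply/andP; split; apply: (le_mesh C0) => m; have := r m; have /andP[] := hb m i;
  by rewrite ler_norml; lra.
Qed.

Lemma box_taylor U a b X : box a b `<=` U -> smooth_mx U X ->
  exists2 C, 0 <= C & forall x y, box a b x -> box a b y ->
    `|X y - X x - (y - x) *m jac X x| <= C * `|y - x| ^+ 2.
Proof.
move=> sU sX; have [L L0 hL] := box_lipschitz sU (smooth_jac sX).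
exists (n%:R * L); first by rewrite mulr_ge0.
move=> x y bx by_; apply: norm_le_coord; first by rewrite !mulr_ge0.
move=> i0 k; rewrite (ord1 i0).
have [|zeta hz eq] := @mvt_between R n (fun y => X y 0 k) x y.
  move=> w hw i; have bw := box_between bx by_ hw.
  exact: (@Ck_derivable _ _ 0 U _ _ i (sX 0 k 1%N) (sU _ bw)).
have -> : (X y - X x - (y - x) *m jac X x) 0 k =
    \sum_i (y - x) 0 i * (jac X (zeta i) i k - jac X x i k).
  rewrite !mxE eq -sumrB; by apply: eq_bigr => i _; rewrite !mxE mulrBr.
apply: le_trans (ler_norm_sum _ _ _) _.
have -> : n%:R * L * `|y - x| ^+ 2 = \sum_(i < n) (`|y - x| * (L * `|y - x|)).
  by rewrite sumr_const card_ord -[RHS]mulr_natl; ring.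
apply: ler_sum => i _; rewrite normrM; apply: ler_pM => //; first exact: norm_coord_le.
have bw := box_between bx by_ (hz i).
have h1 := le_trans (norm_coord_le _ i k) (hL _ _ bw bx); rewrite !mxE in h1.
rewrite ![jac _ _ _ _]mxE; apply: le_trans h1 _; apply: ler_wpM2l => //.
rewrite distrC; apply: between_close (hz i) _ _; first by rewrite subrr normr0.
by rewrite distrC.
Qed.

(** The field (x, s) |-> (s X(x), 0), whose flow at time 1 is the flow of X at time s. *)
Definition timed X z : 'rV[R]_(n + 1) := row_mx (rsubmx z 0 0 *: X (lsubmx z)) 0.

Definition local_flow X z : 'rV[R]_n := lsubmx (flow (timed X) z).

Lemma smooth_timed U X : open U -> smooth_mx U X -> smooth_mx (@over R n 1 U) (timed X).
Proof.
move=> oU sX; have oW := @open_over R n 1 U oU.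
apply: smooth_row_mx => //; last exact: smooth_mx_cst.
apply: smooth_mxZ => //; first exact: smooth_rsubmx.
by apply: (smooth_mx_comp oW oU) => //; exact: smooth_lsubmx.
Qed.

Lemma jac_timed U X z u (c : R) : open U -> smooth_mx U X -> U (lsubmx z) ->
  row_mx u (const_mx c) *m jac (timed X) z =
  row_mx (c *: X (lsubmx z) + rsubmx z 0 0 *: (u *m jac X (lsubmx z))) 0.
Proof.
move=> oU sX Uz; set v := row_mx u _.
have oW := @open_over R n 1 U oU.
have E k : (v *m jac (timed X) z) 0 k = 'D_v (fun y => timed X y 0 k) z.
  have sk := smooth_timed oU sX 0 k 1%N.
  rewrite mxE deriveE; last exact: Ck_differentiable oW sk Uz.
  rewrite (Ck_diffE v oW sk Uz).
  by apply: eq_bigr => i _; rewrite [jac _ _ _ _]mxE.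
apply/rowP => k; rewrite E; have [i ->|i ->] := split_ordP k; last first.
  rewrite row_mxEr mxE.
  have -> : (fun y => timed X y 0 (rshift n i)) = fun=> 0.
    by apply/funext => y; rewrite row_mxEr mxE.
  by rewrite derive_cst.
have -> : (fun y => timed X y 0 (lshift 1 i)) = fun y => rsubmx y 0 0 * X (lsubmx y) 0 i.
  by apply/funext => y; rewrite row_mxEl mxE.
have d1 : is_derive z v (fun y : 'rV[R]_(n + 1) => rsubmx y 0 0) c.
  have -> : (fun y : 'rV[R]_(n + 1) => rsubmx y 0 0) = (fun y => y 0 (rshift n 0)).
    by apply/funext => y; rewrite mxE.
  by apply: is_derive_eq (is_derive_coord _ _ _) _; rewrite row_mxEr mxE.
have dl j : is_derive z v (fun y : 'rV[R]_(n + 1) => lsubmx y 0 j) (u 0 j).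
  have -> : (fun y : 'rV[R]_(n + 1) => lsubmx y 0 j) = (fun y => y 0 (lshift 1 j)).
    by apply/funext => y; rewrite mxE.
  by apply: is_derive_eq (is_derive_coord _ _ _) _; rewrite row_mxEl.
have dl' j : derivable (fun y : 'rV[R]_(n + 1) => lsubmx y 0 j) z v by have [] := dl j.
have d2 := @is_derive_comp R (n + 1) n 0 U (fun x => X x 0 i) (@lsubmx R 1 n 1) z v oU
  (sX 0 i 1%N) Uz dl'.
have [_ ->] := is_deriveM d1 d2.
rewrite row_mxEl !mxE /GRing.scale /=.
rewrite (eq_bigr (fun j => u 0 j * jac X (lsubmx z) j i)); last first.
  by move=> j _; rewrite (@derive_val _ _ _ _ _ _ _ (dl j)) [jac _ _ _ _]mxE.
by rewrite [c * _]mulrC addrC.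
Qed.

Lemma orbit_timed_rsub X m j z : rsubmx (orbit (timed X) m j z) = rsubmx z.
Proof.
elim: j => // j IH; rewrite /orbit iterS -/(orbit _ m j z) /estep /timed.
by rewrite linearD linearZ /= row_mxKr scaler0 addr0.
Qed.

Lemma orbit_timed_lsubS X m j z : lsubmx (orbit (timed X) m j.+1 z) =
  lsubmx (orbit (timed X) m j z)
  + (mesh R m * rsubmx z 0 0) *: X (lsubmx (orbit (timed X) m j z)).
Proof.
rewrite {1}/orbit iterS -/(orbit _ m j z) {1}/estep {2}/timed.
by rewrite linearD linearZ /= row_mxKl orbit_timed_rsub scalerA.
Qed.

End LocalFlow.

Section LocalFlowTheorem.
Variables (R : realType) (n : nat).
Implicit Types (U : set 'rV[R]_n) (X : 'rV[R]_n -> 'rV[R]_n) (z : 'rV[R]_(n + 1)).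

Lemma box_dist (x0 y : 'rV[R]_n) (r : R) : 0 <= r ->
  box (x0 - const_mx r) (x0 + const_mx r) y <-> `|y - x0| <= r.
Proof.
move=> r0; split=> [h|h i].
  apply: norm_le_coord => // i j; rewrite (ord1 i); have := h j.
  by rewrite !mxE ler_distl.
have := le_trans (norm_coord_le _ 0 i) h; by rewrite !mxE ler_distl.
Qed.

Variables (U : set 'rV[R]_n) (X : 'rV[R]_n -> 'rV[R]_n) (x0 : 'rV[R]_n) (r M : R).
Hypothesis oU : open U.
Hypothesis sX : smooth_mx U X.
Hypothesis r0 : 0 < r.
Hypothesis M0 : 0 <= M.

Let a := x0 - const_mx r.
Let b := x0 + const_mx r.
Hypothesis sU : box a b `<=` U.
Hypothesis hM : forall y, box a b y -> `|X y| <= M.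

(** Within this time and from this distance of x0, a curve of speed at most M stays in
    the box of radius r. *)
Definition flow_radius : R := r / (M + 1).
Let rho := flow_radius.

Definition flow_domain : set 'rV[R]_(n + 1) := ball (row_mx x0 0) rho.
Let W := flow_domain.

Lemma flow_radius_gt0 : 0 < rho.
Proof. by rewrite divr_gt0 // ltr_wpDl. Qed.

Let rhoE : rho + rho * M = r.
Proof. by rewrite /rho /flow_radius; field; rewrite gt_eqF // ltr_wpDl. Qed.

Lemma flow_domainP z : W z <-> `|lsubmx z - x0| < rho /\ `|rsubmx z| < rho.
Proof.
rewrite /W /flow_domain -ball_normE /= distrC; split=> [h|[h1 h2]].
  split.
    apply: le_lt_trans h; have -> : lsubmx z - x0 = lsubmx (z - row_mx x0 0).
      by rewrite linearB /= row_mxKl.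
    exact: norm_lsubmx.
  apply: le_lt_trans h; have -> : rsubmx z = rsubmx (z - row_mx x0 0).
    by rewrite linearB /= row_mxKr subr0.
  exact: norm_rsubmx.
apply: le_lt_trans (_ : _ <= Num.max `|lsubmx z - x0| `|rsubmx z|) _; last by rewrite gt_max h1.
have -> : z - row_mx x0 0 = row_mx (lsubmx z - x0) (rsubmx z).
  by rewrite -{1}(hsubmxK z) opp_row_mx add_row_mx oppr0 addr0.
by apply: norm_row_mx; rewrite le_max lexx ?orbT.
Qed.

Lemma flow_domain_open : open W.
Proof. exact: ball_open. Qed.

Let s z : R := rsubmx z 0 0.

Let s_lt z : W z -> `|s z| < rho.
Proof. by move=> /flow_domainP[_ h]; apply: le_lt_trans h; exact: norm_coord_le. Qed.

Let box_of_bound z m j : W z -> (j <= 2 ^ m)%N ->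
  `|lsubmx (orbit (timed X) m j z) - lsubmx z| <= j%:R * mesh R m * (`|s z| * M) ->
  box a b (lsubmx (orbit (timed X) m j z)).
Proof.
move=> Wz jm e0; have sz := s_lt Wz; have /flow_domainP[lz _] := Wz.
apply/box_dist; first exact: ltW.
have e1 : j%:R * mesh R m * (`|s z| * M) <= `|s z| * M.
  by rewrite ler_piMl ?mulr_ge0 // mesh_le.
have e2 : `|s z| * M <= rho * M by rewrite ler_wpM2r // ltW.
have -> : lsubmx (orbit (timed X) m j z) - x0 =
   (lsubmx (orbit (timed X) m j z) - lsubmx z) + (lsubmx z - x0) by rewrite addrA subrK.
apply: le_trans (ler_normD _ _) _; rewrite -rhoE.
by move: e0 e1 e2 lz; lra.
Qed.

Let orbit_bound z m j : W z -> (j <= 2 ^ m)%N ->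
  `|lsubmx (orbit (timed X) m j z) - lsubmx z| <= j%:R * mesh R m * (`|s z| * M).
Proof.
move=> Wz; elim: j => [|j IH] jm; first by rewrite subrr normr0 !mul0r.
have {}IH := IH (ltnW jm); have bj := box_of_bound Wz (ltnW jm) IH.
rewrite orbit_timed_lsubS addrAC; apply: le_trans (ler_normD _ _) _.
apply: le_trans (lerD IH (lexx _)) _.
have h0 := mesh_gt0 R m.
rewrite normrZ normrM (gtr0_norm h0) -natr1 mulrDl mul1r mulrDl lerD2l -mulrA.
by rewrite ler_wpM2l ?ler_wpM2l ?hM // ltW.
Qed.

Let orbit_box z m j : W z -> (j <= 2 ^ m)%N -> box a b (lsubmx (orbit (timed X) m j z)).
Proof. by move=> Wz jm; exact: box_of_bound (orbit_bound Wz jm). Qed.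

Let sT := smooth_timed oU sX.

Let Q : set 'rV[R]_(n + 1) := box (row_mx a (const_mx (- rho))) (row_mx b (const_mx rho)).

Let Q_over : Q `<=` @over R n 1 U.
Proof. by move=> y /box_row_mx[/sU]. Qed.

Let orbit_full_box z m j : W z -> (j <= 2 ^ m)%N -> Q (orbit (timed X) m j z).
Proof.
move=> Wz jm; apply/box_row_mx; split; first exact: orbit_box.
rewrite orbit_timed_rsub; apply: box_const; have /flow_domainP[_] := Wz; exact: ltW.
Qed.

Lemma timed_tame : tame (timed X) (@over R n 1 U) W.
Proof.
move=> z Wz; exists (row_mx a (const_mx (- rho))), (row_mx b (const_mx rho)).
split; first exact: Q_over.
apply: filterS (open_near flow_domain_open Wz) => y Wy m j; exact: orbit_full_box.
Qed.

Lemma local_flow_smooth : smooth_mx W (local_flow X).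
Proof.
move=> i j k; rewrite (ord1 i).
have -> : (fun z => local_flow X z 0 j) = (fun z => flow (timed X) z 0 (lshift 1 j)).
  by apply/funext => z; rewrite mxE.
apply: (Ck_flow k _ flow_domain_open sT timed_tame); exact: open_over.
Qed.

Let flow_rate z : W z -> exists2 C, 0 <= C &
  forall m, `|local_flow X z - lsubmx (euler (timed X) m z)| <= C * mesh R m.
Proof.
move=> Wz; have [C C0 hC] := tame_flow_rate sT timed_tame Wz.
exists C => // m; apply: le_trans (nbhs_singleton hC m).
by rewrite /local_flow -linearB; exact: norm_lsubmx.
Qed.

Lemma local_flow_dist z : W z -> `|local_flow X z - lsubmx z| <= M * `|rsubmx z 0 0|.
Proof.
move=> Wz; have [C C0 hC] := flow_rate Wz.
apply: (le_mesh C0) => m.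
have -> : local_flow X z - lsubmx z = (lsubmx (euler (timed X) m z) - lsubmx z)
    + (local_flow X z - lsubmx (euler (timed X) m z)) by rewrite [RHS]addrC addrA subrK.
apply: le_trans (ler_normD _ _) _; apply: lerD => //.
apply: le_trans (orbit_bound Wz (leqnn _)) _.
by rewrite [M * _]mulrC ler_piMl ?mulr_ge0 // mesh_le.
Qed.

Lemma local_flow_box z : W z -> box a b (local_flow X z).
Proof.
move=> Wz; have hb m : Q (euler (timed X) m z) by exact: orbit_full_box.
by have /box_row_mx[] := flow_box sT timed_tame Wz hb.
Qed.

(** Along the flow, (c0 + c1 t) X is the solution of the variational equation that
    starts from c0 X when the initial data (x, s) vary in the direction (c0 X, c1).  Its
    values along a polygon follow the polygon of the tangent field up to O(h^2) in each
    step, by Taylor expansion of X. *)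
Lemma tangent_timed_flow z (c0 c1 : R) k : W z ->
  flow (tangent (timed X)) (row_mx z (row_mx (c0 *: X (lsubmx z)) (const_mx c1))) 0
      (rshift (n + 1) (lshift 1 k)) = (c0 + c1) * X (local_flow X z) 0 k.
Proof.
move=> Wz; set v := row_mx _ (const_mx c1).
have oW := @open_over R n 1 U oU.
have sTT := smooth_tangent oW sT.
have tTT := tame_tangent oW sT timed_tame.
have VT : @over R (n + 1) (n + 1) W (row_mx z v) by rewrite /over /= row_mxKl.
have [C1 C10 rate] := tame_flow_rate sTT tTT VT.
have [C2 C20 rateX] := flow_rate Wz.
have [L L0 hL] := box_lipschitz sU sX.
have [C3 C30 hT] := box_taylor sU sX.
have [|J J0 hJ] := @box_bounded_mx R (n + 1) _ _ _ _ (jac (timed X)) (_ : forall y, Q y -> _).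
  by move=> y /Q_over hy i j; exact: (@Ck_continuous _ _ 0 _ _ _ (smooth_jac sT i j 0%N) hy).
have orb m j : (j <= 2 ^ m)%N -> Q (orbit (timed X) m j z) by exact: orbit_full_box.
pose T := `|c0| + `|c1|.
have T0 : 0 <= T by rewrite addr_ge0.
pose t m (j : nat) : R := c0 + j%:R * mesh R m * c1.
have tT m j : (j <= 2 ^ m)%N -> `|t m j| <= T.
  move=> jm; apply: le_trans (ler_normD _ _) _; rewrite lerD2l normrM ler_piMl //.
  by rewrite ger0_norm ?mesh_le // mulr_ge0 // ltW // mesh_gt0.
(* the expected solution, evaluated along the polygon through z *)
pose w m j : 'rV[R]_(n + 1) := row_mx (t m j *: X (lsubmx (orbit (timed X) m j z))) (const_mx c1).
pose C := T * (C3 * (rho * M) ^+ 2) + T * (L * (rho * M)).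
have rM : 0 <= rho * M by rewrite mulr_ge0 // ltW // flow_radius_gt0.
have C0 : 0 <= C by apply: addr_ge0; apply: mulr_ge0 => //; apply: mulr_ge0 => //; exact: exprn_ge0.
pose LL := (n + 1)%:R * J.
have LL0 : 0 <= LL by rewrite mulr_ge0.
have close m : `|orbit (tangent (timed X)) m (2 ^ m) (row_mx z v) -
     row_mx (orbit (timed X) m (2 ^ m) z) (w m (2 ^ m)%N)| <= expR LL * C * mesh R m.
  apply: (@euler_perturb R _ (tangent (timed X)) LL C m (fun j => orbit (tangent (timed X)) m j (row_mx z v))
     (fun j => row_mx (orbit (timed X) m j z) (w m j))) => //.
  - by rewrite /orbit /= /w /t /= mul0r mul0r addr0.
  - move=> j jm.
    have e : lsubmx (orbit (tangent (timed X)) m j (row_mx z v)) = orbit (timed X) m j z.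
      by rewrite orbit_lsub row_mxKl.
    rewrite /tangent e row_mxKl row_mxKr opp_row_mx add_row_mx subrr -mulmxBl.
    set u := orbit (tangent _) m j _.
    have -> : u - row_mx (orbit (timed X) m j z) (w m j) = row_mx 0 (rsubmx u - w m j).
      by rewrite -{1}(hsubmxK u) opp_row_mx add_row_mx e subrr.
    apply: le_trans (_ : _ <= LL * `|rsubmx u - w m j|) _.
      apply: norm_row_mx; first by rewrite normr0 mulr_ge0.
      apply: norm_le_coord; first by rewrite mulr_ge0.
      move=> i l; rewrite mxE; apply: le_trans (ler_norm_sum _ _ _) _.
      have -> : LL * `|rsubmx u - w m j| = \sum_(j0 < n + 1) J * `|rsubmx u - w m j|.
        by rewrite sumr_const card_ord -[RHS]mulr_natl mulrA.
      apply: ler_sum => p _; rewrite normrM mulrC; apply: ler_pM => //.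
        by apply: hJ; apply: orb; exact: ltnW.
      exact: norm_coord_le.
    rewrite ler_wpM2l //.
    have {2}-> : rsubmx u - w m j = rsubmx (row_mx (0 : 'rV[R]_(n + 1)) (rsubmx u - w m j)).
      by rewrite row_mxKr.
    by rewrite row_mxKr -{1}(row_mxKr (0 : 'rV[R]_(n + 1)) (rsubmx u - w m j)); exact: norm_rsubmx.
  - move=> j jm.
    set x := lsubmx (orbit (timed X) m j z).
    have bx : box a b x by apply: orbit_box => //; exact: ltnW.
    set x' := lsubmx (orbit (timed X) m j.+1 z).
    have bx' : box a b x' by exact: orbit_box.
    have h0 := mesh_gt0 R m; set h := mesh R m in h0 *.
    have xx : x' - x = (h * s z) *: X x.
      by rewrite /x' orbit_timed_lsubS -/x addrAC subrr add0r.
    have nxx : `|x' - x| <= h * (rho * M).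
      rewrite xx normrZ normrM (gtr0_norm h0) -mulrA ler_wpM2l ?(ltW h0) //.
      by apply: ler_pM => //; [rewrite ltW // s_lt | exact: hM].
    have e1 : w m j.+1 - (w m j + h *: (w m j *m jac (timed X) (orbit (timed X) m j z))) =
      row_mx (t m j *: (X x' - X x - (x' - x) *m jac X x) + (h * c1) *: (X x' - X x)) 0.
      rewrite /w (@jac_timed R n U X _ _ _ oU sX (sU bx)) -/x -/x'.
      rewrite scale_row_mx scaler0 add_row_mx opp_row_mx add_row_mx addr0 subrr.
      congr row_mx; rewrite xx orbit_timed_rsub -/(s z).
      have -> : t m j.+1 = t m j + h * c1 by rewrite /t -natr1 -/h; ring.
      rewrite -!scalemxAl.
      apply/rowP => i; rewrite !mxE.
      move: (X x' 0 i) (X x 0 i) (\sum_j _) (t m j) (s z) => p q r' t' s'; ring.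
    have e2 : row_mx (orbit (timed X) m j.+1 z) (w m j.+1) -
        estep (tangent (timed X)) h (row_mx (orbit (timed X) m j z) (w m j)) =
      row_mx 0 (w m j.+1 - (w m j + h *: (w m j *m jac (timed X) (orbit (timed X) m j z)))).
      rewrite /estep /tangent row_mxKl row_mxKr scale_row_mx add_row_mx opp_row_mx add_row_mx.
      by congr row_mx; rewrite /orbit iterS /estep subrr.
    rewrite e2 e1; have Ch : 0 <= C * h ^+ 2 by rewrite mulr_ge0 // exprn_ge0 // ltW.
    apply: norm_row_mx; first by rewrite normr0.
    apply: norm_row_mx; last by rewrite normr0.
    apply: le_trans (ler_normD _ _) _; rewrite !normrZ /C mulrDl; apply: lerD.
      rewrite -mulrA; apply: ler_pM => //; first exact/tT/ltnW.
      apply: le_trans (hT _ _ bx bx') _; rewrite -mulrA ler_wpM2l //.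
      by rewrite -exprMn [_ * h]mulrC lerXn2r // nnegrE // mulr_ge0 // ltW.
    have -> : T * (L * (rho * M)) * h ^+ 2 = (h * T) * (L * (h * (rho * M))) by ring.
    apply: ler_pM => //.
      rewrite (gtr0_norm h0) ler_wpM2l ?(ltW h0) //.
      by rewrite /T lerDr.
    by apply: le_trans (hL _ _ bx' bx) _; rewrite ler_wpM2l.
have K0 : 0 <= C1 + expR LL * C + T * (L * C2) by rewrite !addr_ge0 // !mulr_ge0 ?expR_ge0.
apply/eqP; rewrite -subr_eq0 -normr_le0; apply: (le_mesh K0) => m; rewrite add0r.
have b1 := le_trans (norm_coord_le _ 0 (rshift (n + 1) (lshift 1 k))) (nbhs_singleton rate m).
have b2 := le_trans (norm_coord_le _ 0 (rshift (n + 1) (lshift 1 k))) (close m).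
rewrite entryB in b1.
rewrite entryB row_mxEr row_mxEl entryZ in b2.
have tE : t m (2 ^ m)%N = c0 + c1.
  by rewrite /t /mesh exprVn natrX divff ?mul1r // expf_neq0 // pnatr_eq0.
rewrite tE in b2.
have b3 : `|X (local_flow X z) - X (lsubmx (euler (timed X) m z))| <= L * (C2 * mesh R m).
  apply: le_trans (hL _ _ (local_flow_box Wz) (orbit_box Wz (leqnn _))) _.
  by apply: ler_wpM2l => //; exact: rateX.
have b4 := le_trans (norm_coord_le _ 0 k) b3.
rewrite entryB in b4.
rewrite /euler in b1 b4.
move: b1 b2 b4.
move: (flow _ _ _ _) (orbit (tangent _) _ _ _ _ _) (X (lsubmx _) 0 k) (X (local_flow _ _) 0 k).
move=> p q x y; move: (mesh R m) => h b1 b2 b4.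
have c01 : `|c0 + c1| <= T by exact: ler_normD.
have -> : p - (c0 + c1) * y = (p - q) + ((q - (c0 + c1) * x) - (c0 + c1) * (y - x)) by ring.
have -> : (C1 + expR LL * C + T * (L * C2)) * h =
    C1 * h + (expR LL * C * h + T * (L * (C2 * h))) by ring.
apply: le_trans (ler_normD _ _) _; apply: lerD => //.
apply: le_trans (ler_normB _ _) _; apply: lerD => //.
by rewrite normrM; apply: ler_pM.
Qed.

(** With c0 = 0 this says that the flow has velocity X; with c1 = 0 that the flow
    preserves X; and c0 = 1, c1 = -1 that moving the initial point along the flow while
    shortening the time leaves the end point fixed. *)
Lemma local_flow_derive z (c0 c1 : R) k : W z ->
  is_derive z (row_mx (c0 *: X (lsubmx z)) (const_mx c1)) (fun y => local_flow X y 0 k)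
    ((c0 + c1) * X (local_flow X z) 0 k).
Proof.
move=> Wz; rewrite -(tangent_timed_flow c0 c1 k Wz).
have -> : (fun z => local_flow X z 0 k) = (fun z => flow (timed X) z 0 (lshift 1 k)).
  by apply/funext => y; rewrite mxE.
apply: flow_derive timed_tame Wz => //; first exact: open_over.
exact: flow_domain_open.
Qed.

End LocalFlowTheorem.

(** * Projection along a flow onto a slice *)

Section Projection.
Variables (R : realType) (n : nat).
Variables (U : set 'rV[R]_n.+1) (X : 'rV[R]_n.+1 -> 'rV[R]_n.+1) (x0 : 'rV[R]_n.+1) (i0 : 'I_n.+1).
Hypothesis oU : open U.
Hypothesis sX : smooth_mx U X.
Hypothesis X1 : forall x, U x -> X x 0 i0 = 1.
Hypothesis Ux0 : U x0.

(** The hyperplane through x0 on which the coordinate i0 is constant, parametrized by the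
    other coordinates. *)
Definition slice (b : 'rV[R]_n) : 'rV[R]_n.+1 :=
  \row_j oapp (fun k => b 0 k) (x0 0 i0) (unlift i0 j).

Lemma slice_lift b k : slice b 0 (lift i0 k) = b 0 k.
Proof. by rewrite mxE liftK. Qed.

Lemma slice_i0 b : slice b 0 i0 = x0 0 i0.
Proof. by rewrite mxE unlift_none. Qed.

Lemma slice_col' (y : 'rV[R]_n.+1) : y 0 i0 = x0 0 i0 -> slice (col' i0 y) = y.
Proof.
move=> h; apply/rowP => j; have [j' ->|->] := unliftP i0 j; last by rewrite slice_i0 h.
by rewrite slice_lift mxE.
Qed.

Lemma col'_slice b : col' i0 (slice b) = b.
Proof. by apply/rowP => j; rewrite mxE slice_lift. Qed.

Lemma smooth_slice (W : set 'rV[R]_n) : open W -> smooth_mx W slice.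
Proof.
move=> oW i j; rewrite (ord1 i); have [j' ->|->] := unliftP i0 j.
  by apply: (smooth_eq oW) (smooth_mx_id W 0 j') => b _; rewrite slice_lift.
by apply: (smooth_eq oW) (smooth_cst W (x0 0 i0)) => b _; rewrite slice_i0.
Qed.

(** As X has speed 1 in the coordinate i0, the curve through y meets the slice after time
    x0_i0 - y_i0, and pi y gives the remaining coordinates of that point.  Functions
    annihilated by X are constant along the curves, hence determined by their values on
    the slice; the constant K keeps the curve from y to the slice within the ball where
    this is known. *)
Theorem flow_projection : exists (rho K : R) (pi : 'rV[R]_n.+1 -> 'rV[R]_n),
  [/\ 0 < rho, ball x0 rho `<=` U, smooth_mx (ball x0 rho) pi,
      forall y, ball x0 rho y -> X y *m jac pi y = 0
    & [/\ forall b, ball x0 rho (slice b) -> pi (slice b) = b, 1 <= K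
    & forall rho' y, 0 < rho' <= rho -> K * `|y - x0| < rho' ->
       ball x0 rho' (slice (pi y)) /\
       forall u, Ck 1 (ball x0 rho') u ->
         (forall z, ball x0 rho' z -> \sum_i X z 0 i * pderiv i u z = 0) ->
         u y = u (slice (pi y))]].
Proof.
have [d /= dp hd] : exists2 d : R, 0 < d & ball x0 d `<=` U.
  by have /nbhs_ballP[d /= dp hd] := open_near oU Ux0; exists d.
pose r := d / 2; have r0 : 0 < r by rewrite divr_gt0.
pose a := x0 - const_mx r; pose b := x0 + const_mx r.
have sU : box a b `<=` U.
  move=> y /(box_dist _ _ (ltW r0)) h; apply: hd; rewrite -ball_normE /= distrC.
  by apply: le_lt_trans h _; rewrite /r ltr_pdivrMr // ltr_pMr // ltr1n.
have [|M M0 hM'] := @box_bounded_mx R n.+1 a b _ _ X.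
  by move=> y by_ i j; exact: smooth_continuous (sX i j) (sU _ by_).
have hM y : box a b y -> `|X y| <= M.
  by move=> by_; apply: norm_le_coord => // i j; exact: hM'.
pose rho := flow_radius r M; have rho0 : 0 < rho := flow_radius_gt0 r0 M0.
pose W := flow_domain x0 r M; pose Phi := local_flow X.
have oW : open W by exact: flow_domain_open.
have sPhi : smooth_mx W Phi := local_flow_smooth oU sX r0 M0 sU hM.
have inW y s : `|y - x0| < rho -> `|s| < rho -> W (row_mx y (const_mx s)).
  move=> hy hs; apply/flow_domainP; rewrite row_mxKl row_mxKr; split=> //.
  by apply: le_lt_trans hs; apply: norm_le_coord => // i j; rewrite mxE.
have PU z : W z -> U (Phi z).
  by move=> Wz; exact: (sU _ (local_flow_box oU sX r0 M0 sU hM Wz)).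
have PD z c0 c1 k : W z -> is_derive z (row_mx (c0 *: X (lsubmx z)) (const_mx c1)) (fun y => Phi y 0 k)
    ((c0 + c1) * X (Phi z) 0 k).
  exact: (local_flow_derive oU sX r0 M0 sU hM).
have Pd y s : `|y - x0| < rho -> `|s| < rho -> `|Phi (row_mx y (const_mx s)) - y| <= M * `|s|.
  move=> hy hs; have := local_flow_dist oU sX r0 M0 sU hM (inW _ _ hy hs).
  by rewrite row_mxKl row_mxKr mxE.
have P0 y : `|y - x0| < rho -> Phi (row_mx y (const_mx 0)) = y.
  move=> hy; have := Pd y 0 hy; rewrite normr0 => /(_ rho0).
  by rewrite mulr0 normr_le0 subr_eq0 => /eqP.
(* functions along the flow: f o Phi has derivative s * (X f) in the direction (0, s) *)
have along y s (rho' : R) (f : 'rV[R]_n.+1 -> R) : `|y - x0| < rho -> `|s| < rho ->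
   (forall t, 0 <= t <= 1 -> `|Phi (row_mx y (const_mx (t * s))) - x0| < rho') ->
   Ck 1 (ball x0 rho') f -> exists2 t, 0 <= t <= 1 &
     f (Phi (row_mx y (const_mx s))) - f y =
      s * (\sum_i X (Phi (row_mx y (const_mx (t * s)))) 0 i * pderiv i f (Phi (row_mx y (const_mx (t * s))))).
  move=> hy hs hin Cf.
  pose v : 'rV[R]_(n.+1 + 1) := row_mx 0 (const_mx s).
  have lineE t : row_mx y (const_mx 0) + t *: v = row_mx y (const_mx (t * s)).
    rewrite /v scale_row_mx scaler0 add_row_mx addr0; congr row_mx.
    by apply/rowP => i; rewrite !mxE add0r.
  have ts t : 0 <= t <= 1 -> `|t * s| < rho.
    move=> /andP[t0 t1]; rewrite normrM (ger0_norm t0); apply: le_lt_trans hs.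
    by rewrite ler_piMl.
  have D t : 0 <= t <= 1 -> is_derive (row_mx y (const_mx 0) + t *: v) v (fun z => f (Phi z))
      (s * (\sum_i X (Phi (row_mx y (const_mx (t * s)))) 0 i * pderiv i f (Phi (row_mx y (const_mx (t * s)))))).
    move=> t01; rewrite lineE; have Wt := inW _ _ hy (ts t t01).
    have Di k := PD _ 0 s k Wt.
    have vE : row_mx (0 *: X (lsubmx (row_mx y (const_mx (t * s) : 'rV_1)))) (const_mx s) = v.
      by rewrite scale0r.
    rewrite vE in Di.
    have bt : ball x0 rho' (Phi (row_mx y (const_mx (t * s)))).
      by rewrite -ball_normE /= distrC; exact: hin.
    have dj j : derivable (fun z => Phi z 0 j) (row_mx y (const_mx (t * s))) v by have [] := Di j.
    have DD := is_derive_comp (@ball_open _ _ x0 rho') Cf bt dj.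
    apply: (@is_derive_eq _ _ _ (fun z => f (Phi z)) _ _ _ _ DD).
    rewrite mulr_sumr; apply: eq_bigr => i _.
    by rewrite (@derive_val _ _ _ _ _ _ _ (Di i)) add0r mulrA.
  have [|t t01 e] := @mvt_line _ _ (fun z => f (Phi z)) (row_mx y (const_mx 0)) v 1 ler01.
    by move=> t t01; have [] := D t t01.
  exists t => //; move: e; rewrite mul1r.
  have [_ ->] := D t t01.
  by rewrite lineE mul1r P0.
pose tau (y : 'rV[R]_n.+1) := x0 0 i0 - y 0 i0.
have tau_le y : `|tau y| <= `|y - x0|.
  by have := norm_coord_le (y - x0) 0 i0; rewrite !mxE distrC.
have flow_close y e : `|y - x0| < rho -> (M + 1) * `|y - x0| < e ->
    forall t, 0 <= t <= 1 -> `|Phi (row_mx y (const_mx (t * tau y))) - x0| < e.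
  move=> hy' hy t /andP[t0 t1].
  have l1 : `|t * tau y| <= `|y - x0|.
    by rewrite normrM (ger0_norm t0); apply: le_trans (tau_le y); rewrite ler_piMl.
  apply: le_lt_trans hy.
  rewrite -[Phi _](subrK y) -addrA.
  apply: le_trans (ler_normD _ _) _; rewrite mulrDl mul1r lerD2r.
  by apply: le_trans (Pd _ _ hy' (le_lt_trans l1 hy')) _; rewrite ler_wpM2l.
pose sigma y := Phi (row_mx y (const_mx (tau y))).
pose pi y := col' i0 (sigma y).
have ballE y e : ball x0 e y <-> `|y - x0| < e by rewrite -ball_normE /= distrC.
have tau_smooth V : open V -> smooth_mx V (fun y => row_mx y (const_mx (tau y)) : 'rV[R]_(n.+1 + 1)).
  move=> oV; apply: smooth_row_mx => //; first exact: smooth_mx_id.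
  move=> i j k.
  have h : Ck k V (fun y => x0 0 i0 + (-1) * y 0 i0).
    apply: CkD => //; first exact: Ck_cst.
    by apply: CkM => //; [exact: Ck_cst | exact: Ck_coord].
  by apply: Ck_eq h => // y _; rewrite mxE /tau mulN1r.
have inWt y : ball x0 rho y -> W (row_mx y (const_mx (tau y))).
  by move=> /ballE hy; apply: inW => //; exact: le_lt_trans (tau_le y) hy.
have ob e : open (ball x0 e) by exact: ball_open.
have spi : smooth_mx (ball x0 rho) pi.
  have s1 : smooth_mx (ball x0 rho) sigma.
    by apply: (@smooth_mx_comp _ _ _ (ob rho) _ _ _ W Phi _ oW inWt sPhi); exact: tau_smooth.
  by move=> i j; apply: (smooth_eq (ob rho)) (s1 i (lift i0 j)) => y _; rewrite /pi [RHS]mxE.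
(* along the flow the coordinate i0 has speed 1 *)
have sig0 y : (M + 1) * `|y - x0| < rho -> sigma y 0 i0 = x0 0 i0.
  move=> hy.
  have hy' : `|y - x0| < rho by apply: le_lt_trans hy; rewrite ler_peMl // lerDr.
  have ht := le_lt_trans (tau_le y) hy'.
  have tin := flow_close _ _ hy' hy.
  have [t t01] := along y (tau y) rho (fun z => z 0 i0) hy' ht tin (Ck_coord 1 _ i0).
  set z := Phi (row_mx y (const_mx (t * tau y))).
  have PUt : U z.
    by apply: PU; apply: inW => //; apply: le_lt_trans ht; rewrite normrM; case/andP: t01 => t0 t1; rewrite (ger0_norm t0) ler_piMl.
  rewrite (bigD1 i0) //= X1 // mul1r big1 ?addr0; last first.
    move=> i ii0; have [_ e] := is_derive_coord z (delta_mx 0 i : 'rV[R]_n.+1) i0.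
    by rewrite /pderiv e mxE eqxx /= eq_sym (negPf ii0) mulr0.
  have [_ e] := is_derive_coord z (delta_mx 0 i0 : 'rV[R]_n.+1) i0.
  have d1 : (delta_mx 0 i0 : 'rV[R]_n.+1) 0 i0 = 1 by rewrite mxE !eqxx.
  rewrite /pderiv e d1 mulr1 -/(sigma y) /tau => eq.
  by rewrite -[LHS](subrK (y 0 i0)) eq subrK.
exists rho, (M + 1), pi; split=> //.
- by move=> y /ballE h; apply: sU; apply/box_dist; [exact: ltW|apply: le_trans (ltW h) _; rewrite /rho /flow_radius ler_pdivrMr ?ltr_wpDl // ler_peMr ?lerDr // ltW].
- move=> y By; apply/rowP => k; rewrite mxE [RHS]mxE.
  have Uy : U y by rewrite -(P0 y); [apply: PU; apply: inW; [exact/ballE|rewrite normr0]|exact/ballE].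
  have Wy := inWt y By.
  have Ck1 := sPhi 0 (lift i0 k) 1%N.
  pose g y := row_mx y (const_mx (tau y)) : 'rV[R]_(n.+1 + 1).
  have dg j : derivable (fun z => g z 0 j) y (X y).
    apply: diff_derivable; exact: Ck_differentiable (ob rho) (tau_smooth _ (ob rho) 0 j 1%N) By.
  have dgE : 'D_(X y) g y = row_mx (1 *: X y) (const_mx (-1)).
    rewrite derive_mx; last by apply/derivable_mxP => i j; rewrite (ord1 i).
    apply/rowP => j; rewrite mxE; have [l ->|l ->] := split_ordP j.
      rewrite row_mxEl scale1r.
      have -> : (fun t : 'rV[R]_n.+1 => g t 0 (lshift 1 l)) = (fun t => t 0 l).
        by apply/funext => t; rewrite row_mxEl.
      by have [_] := is_derive_coord y (X y) l.
    rewrite row_mxEr mxE.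
    have -> : (fun t : 'rV[R]_n.+1 => g t 0 (rshift n.+1 l)) = (fun t => x0 0 i0 - t 0 i0).
      by apply/funext => t; rewrite row_mxEr mxE.
    have [_ ->] := is_deriveB (is_derive_cst (x0 0 i0) y (X y)) (is_derive_coord y (X y) i0).
    by rewrite X1 // sub0r.
  have DD := @is_derive_comp R n.+1 (n.+1 + 1) 0 W (fun z => Phi z 0 (lift i0 k)) g y (X y) oW Ck1 Wy dg.
  have DX := PD (g y) 1 (-1) (lift i0 k) Wy.
  rewrite row_mxKl subrr mul0r in DX.
  transitivity ('D_(X y) (fun z => Phi (g z) 0 (lift i0 k)) y).
    have Cp : Ck 1 (ball x0 rho) (fun z => Phi (g z) 0 (lift i0 k)).
      by apply: Ck_eq (spi 0 k 1%N) => // z _; rewrite /pi [LHS]mxE.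
    rewrite deriveE; last exact: (Ck_differentiable (ob rho) Cp By).
    rewrite (Ck_diffE _ (ob rho) Cp By).
    apply: eq_bigr => i _; rewrite [jac _ _ _ _]mxE; congr (_ * pderiv i _ y).
    by apply/funext => z; rewrite /pi [LHS]mxE.
  have [_ eD] := DD; have [_ eX] := DX; apply: etrans eD _; apply: etrans _ eX.
  rewrite [RHS]deriveE; last exact: Ck_differentiable oW Ck1 Wy.
  rewrite (Ck_diffE _ oW Ck1 Wy) -dgE; apply: eq_bigr => j _.
  by rewrite derive_mx ?mxE //; apply/derivable_mxP => i l; rewrite (ord1 i).
split.
- move=> b' /ballE h; rewrite /pi /sigma /tau slice_i0 subrr P0 //.
  exact: col'_slice.
- by rewrite lerDr.
move=> rho' y /andP[rho'0 rr] hy.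
have hyr : (M + 1) * `|y - x0| < rho by exact: lt_le_trans hy rr.
have hy' : `|y - x0| < rho by apply: le_lt_trans hyr; rewrite ler_peMl // lerDr.
have ht := le_lt_trans (tau_le y) hy'.
have sE : slice (pi y) = sigma y by apply: slice_col'; exact: sig0.
have tin := flow_close _ _ hy' hy.
rewrite sE; split.
  by apply/ballE; rewrite /sigma -[tau y]mul1r; apply: tin; rewrite ler01 lexx.
move=> u Cu Xu.
have [t t01 e] := along y (tau y) rho' u hy' ht tin Cu.
apply/eqP; rewrite eq_sym -subr_eq0 /sigma e Xu ?mulr0 //.
by apply/ballE; exact: tin.
Qed.

End Projection.

(** * Derivatives of matrix-valued functions *)

Section MatrixLeibniz.
Variables (R : realType) (n : nat) (U : set 'rV[R]_n).
Hypothesis oU : open U.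

Lemma pderiv_sum (I : finType) (f : I -> 'rV[R]_n -> R) i x : U x ->
  (forall k, smooth U (f k)) ->
  pderiv i (fun y => \sum_k f k y) x = \sum_k pderiv i (f k) x.
Proof.
move=> Ux sf; rewrite /index_enum; elim: (Finite.enum I) => [|a r IH].
  have -> : (fun y : 'rV[R]_n => \sum_(k <- [::]) f k y) = fun=> 0.
    by apply/funext => y; rewrite big_nil.
  by rewrite big_nil /pderiv derive_cst.
have -> : (fun y => \sum_(k <- a :: r) f k y) = fun y => f a y + \sum_(k <- r) f k y.
  by apply/funext => y; rewrite big_cons.
rewrite pderivD ?IH ?big_cons //; first exact: smooth_derivable (sf a) Ux.
apply: (@smooth_derivable _ _ U) Ux.
by apply: smooth_sum => // k _; exact: sf.
Qed.

Lemma pderiv_mxD (p q : nat) (F H : 'rV[R]_n -> 'M[R]_(p, q)) i x : U x ->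
  smooth_mx U F -> smooth_mx U H ->
  pderiv_mx i (fun y => F y + H y) x = pderiv_mx i F x + pderiv_mx i H x.
Proof.
move=> Ux sF sH; apply/matrixP => j k; rewrite !mxE.
have -> : (fun y => (F y + H y) j k) = fun y => F y j k + H y j k.
  by apply/funext => y; rewrite mxE.
by rewrite pderivD //; exact: smooth_derivable Ux.
Qed.

Lemma pderiv_mxM p q r (F : 'rV[R]_n -> 'M[R]_(p, q)) (G : 'rV[R]_n -> 'M[R]_(q, r)) i x :
  U x -> smooth_mx U F -> smooth_mx U G ->
  pderiv_mx i (fun y => F y *m G y) x = pderiv_mx i F x *m G x + F x *m pderiv_mx i G x.
Proof.
move=> Ux sF sG; apply/matrixP => a b; rewrite !mxE -big_split /=.
have -> : (fun y => (F y *m G y) a b) = fun y => \sum_k F y a k * G y k b.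
  by apply/funext => y; rewrite mxE.
rewrite pderiv_sum //; last by move=> k; apply: smoothM.
apply: eq_bigr => k _; rewrite !mxE pderivM //; exact: smooth_derivable Ux.
Qed.

Lemma pderiv_mxZ p q (a : 'rV[R]_n -> R) (F : 'rV[R]_n -> 'M[R]_(p, q)) i x :
  U x -> smooth U a -> smooth_mx U F ->
  pderiv_mx i (fun y => a y *: F y) x = pderiv i a x *: F x + a x *: pderiv_mx i F x.
Proof.
move=> Ux sa sF; apply/matrixP => j k; rewrite !mxE.
have -> : (fun y => (a y *: F y) j k) = fun y => a y * F y j k.
  by apply/funext => y; rewrite mxE.
rewrite pderivM //; exact: smooth_derivable Ux.
Qed.

Lemma pderiv_mx_tr p q (F : 'rV[R]_n -> 'M[R]_(p, q)) i x :
  pderiv_mx i (fun y => (F y)^T) x = (pderiv_mx i F x)^T.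
Proof.
apply/matrixP => j k; rewrite !mxE; congr (pderiv i _ x).
by apply/funext => y; rewrite mxE.
Qed.

Lemma pderiv_mx_eq p q (F G : 'rV[R]_n -> 'M[R]_(p, q)) i x : U x ->
  (forall y, U y -> F y = G y) -> pderiv_mx i F x = pderiv_mx i G x.
Proof.
move=> Ux FG; apply/matrixP => j k; rewrite !mxE.
by apply: (@pderiv_eq_on _ _ U) => // y Uy; rewrite FG.
Qed.

Lemma pderiv_mx_cst p q (A : 'M[R]_(p, q)) i x :
  pderiv_mx i (fun _ : 'rV[R]_n => A) x = 0.
Proof. by apply/matrixP => j k; rewrite !mxE /pderiv derive_cst. Qed.

Lemma pderiv_mx_inv p (F : 'rV[R]_n -> 'M[R]_p) i x : U x ->
  smooth_mx U F -> (forall y, U y -> F y \in unitmx) ->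
  pderiv_mx i (fun y => invmx (F y)) x = - (invmx (F x) *m pderiv_mx i F x *m invmx (F x)).
Proof.
move=> Ux sF uF; have sI := smooth_mx_inv oU uF sF.
have e : pderiv_mx i (fun y => F y *m invmx (F y)) x = 0.
  by rewrite -[RHS](@pderiv_mx_cst p p 1%:M i x); apply: pderiv_mx_eq => // y Uy; rewrite mulmxV ?uF.
move: e; rewrite pderiv_mxM // => e.
have := congr1 (mulmx (invmx (F x))) e.
rewrite mulmx0 mulmxDr !mulmxA mulVmx ?uF // mul1mx => /eqP.
by rewrite addrC addr_eq0 => /eqP.
Qed.

End MatrixLeibniz.

(** * Positive definite matrices *)

Section QuadraticForms.
Variables (R : realType).

Definition posdef n (A : 'M[R]_n) : Prop :=
  A^T = A /\ forall v : 'rV[R]_n, v != 0 -> 0 < bil A v v.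

Lemma posdef_unit n (A : 'M[R]_n) : posdef A -> A \in unitmx.
Proof.
move=> [_ pA]; rewrite -row_free_unit -kermx_eq0; apply/rowV0P => v /sub_kermxP vA.
apply/eqP/negPn/negP => /pA; rewrite /bil vA mul0mx mxE ltxx //.
Qed.

Lemma posdef_inv n (A : 'M[R]_n) : posdef A -> posdef (invmx A).
Proof.
move=> pA; have uA := posdef_unit pA; have [sA hA] := pA.
split; first by rewrite trmx_inv sA.
move=> v v0; have -> : bil (invmx A) v v = bil A (v *m invmx A) (v *m invmx A).
  by rewrite /bil mulmxKV // trmx_mul trmx_inv sA mulmxA.
by apply: hA; apply: contra_neq v0 => h; rewrite -(mulmxKV uA v) h mul0mx.
Qed.

Lemma posdef_congr n m (A : 'M[R]_n) (B : 'M[R]_(m, n)) : posdef A -> row_free B ->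
  posdef (B *m A *m B^T).
Proof.
move=> [sA hA] fB; split; first by rewrite !trmx_mul sA trmxK mulmxA.
move=> v v0; have -> : bil (B *m A *m B^T) v v = bil A (v *m B) (v *m B).
  by rewrite /bil trmx_mul !mulmxA.
apply: hA; apply: contra_neq v0 => h.
by apply: (row_free_inj fB); rewrite mul0mx.
Qed.

Lemma posdef_scale n (A : 'M[R]_n) (a : R) : 0 < a -> posdef A -> posdef (a *: A).
Proof.
move=> a0 [sA hA]; split; first by rewrite linearZ /= sA.
move=> v /hA h; rewrite /bil -scalemxAr -scalemxAl mxE.
by rewrite mulr_gt0.
Qed.

Lemma posdef_diag_gt0 n (A : 'M[R]_n) i : posdef A -> 0 < A i i.
Proof.
move=> [_ hA]; have := hA (delta_mx 0 i).
have -> : bil A (delta_mx 0 i) (delta_mx 0 i) = A i i.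
  by rewrite /bil -rowE trmx_delta -colE !mxE.
by apply; apply/eqP => /matrixP/(_ 0 i)/eqP; rewrite !mxE !eqxx oner_eq0.
Qed.

(** The determinant does not vanish on the segment from the identity to A,
    so it keeps its sign. *)
Lemma posdef_det_gt0 n (A : 'M[R]_n) : posdef A -> 0 < \det A.
Proof.
move=> pA; rewrite ltNge; apply/negP => dA.
pose P : 'M[{poly R}]_n := map_mx polyC 1%:M + 'X *: map_mx polyC (A - 1%:M).
have pE t : (\det P).[t] = \det ((1 - t) *: 1%:M + t *: A).
  have -> : (\det P).[t] = horner_eval t (\det P) by [].
  rewrite -det_map_mx; congr (\det _); apply/matrixP => i j.
  rewrite !mxE /= horner_evalE !hornerE; ring.
have [|t] := @poly_ivt R (- \det P) 0 1 ler01.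
  by rewrite !hornerE !pE subr0 subrr scale1r !scale0r addr0 add0r scale1r det1 lerN10 oppr_ge0.
move=> /andP[t0 t1]; rewrite rootN /root pE => /eqP d0.
have : (1 - t) *: 1%:M + t *: A \in unitmx; last by rewrite unitmxE d0 unitr0.
apply: posdef_unit; have [sA hA] := pA; split.
  by rewrite linearD !linearZ /= trmx1 sA.
move=> v v0; have -> : bil ((1 - t) *: 1%:M + t *: A) v v = (1 - t) * bil 1%:M v v + t * bil A v v.
  by rewrite /bil mulmxDr mulmxDl -!scalemxAr -!scalemxAl [LHS]mxE; congr (_ + _); rewrite mxE.
have b1 : 0 < bil 1%:M v v.
  rewrite /bil mulmx1 mxE lt_def; apply/andP; split; last first.
    by apply: sumr_ge0 => i _; rewrite mxE -expr2 sqr_ge0.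
  apply: contra v0 => /eqP h; apply/eqP/rowP => i; rewrite [RHS]mxE.
  have /(_ i) : forall i, v 0 i * v^T i 0 = 0.
    have h0 : forall j, true -> 0 <= v 0 j * v^T j 0 by move=> j _; rewrite mxE -expr2 sqr_ge0.
    by move=> j; have /(_ h)/(_ j) := psumr_eq0P h0; apply.
  by rewrite mxE => /eqP; rewrite mulf_eq0 orbb => /eqP.
have bA := hA v v0.
case: (ltrP t 1) => h.
  by rewrite ltr_pwDl ?mulr_gt0 ?subr_gt0 // mulr_ge0 // ltW.
have -> : t = 1 by apply/eqP; rewrite eq_le t1.
by rewrite subrr mul0r add0r mul1r.
Qed.

End QuadraticForms.

(** * Conformal projection along a vector field *)

Section ConformalFields.
Variables (R : realType) (n : nat).

Definition along (X : 'rV[R]_n -> 'rV[R]_n) k l (F : 'rV[R]_n -> 'M[R]_(k, l)) x : 'M[R]_(k, l) :=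
  \sum_m X x 0 m *: pderiv_mx m F x.

Definition lie_cometric (g : 'rV[R]_n -> 'M[R]_n) (X : 'rV[R]_n -> 'rV[R]_n) x : 'M[R]_n :=
  along X g x - g x *m jac X x - (g x *m jac X x)^T.

(** The infinitesimal form of the flow of X being conformal modulo X.  The columns of B
    are covectors that annihilate X. *)
Definition transversely_conformal (g : 'rV[R]_n -> 'M[R]_n) (X : 'rV[R]_n -> 'rV[R]_n) x : Prop :=
  exists kappa : R, forall k (B : 'M[R]_(n, k)), X x *m B = 0 ->
    B^T *m lie_cometric g X x *m B = kappa *: (B^T *m g x *m B).

Lemma jac_scale (U : set 'rV[R]_n) f (X : 'rV[R]_n -> 'rV[R]_n) x : U x ->
  smooth U f -> smooth_mx U X ->
  jac (fun y => f y *: X y) x = (grad f x)^T *m X x + f x *: jac X x.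
Proof.
move=> Ux sf sX; apply/matrixP => i j; rewrite !mxE big_ord1 !mxE.
have -> : (fun y => (f y *: X y) 0 j) = fun y => f y * X y 0 j.
  by apply/funext => y; rewrite mxE.
rewrite pderivM //; [exact: smooth_derivable sf Ux | exact: smooth_derivable (sX 0 j) Ux].
Qed.

(** Rescaling X adds to the Lie derivative only terms with a factor X, which vanish on the
    covectors that annihilate X.  The field may therefore be normalized to have speed 1
    in one coordinate. *)
Lemma transversely_conformal_scale (U : set 'rV[R]_n) g X f x : U x ->
  smooth U f -> smooth_mx U X -> f x != 0 ->
  transversely_conformal g X x -> transversely_conformal g (fun y => f y *: X y) x.
Proof.
move=> Ux sf sX f0 [kappa h]; exists (f x * kappa) => k B.
rewrite -scalemxAl => /eqP; rewrite scaler_eq0 (negPf f0) /= => /eqP XB.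
have XB' : B^T *m (X x)^T = 0 by rewrite -trmx_mul XB trmx0.
rewrite -scalerA -h // /lie_cometric (jac_scale Ux sf sX).
have -> : along (fun y => f y *: X y) g x = f x *: along X g x.
  by rewrite /along scaler_sumr; apply: eq_bigr => m _; rewrite mxE scalerA.
set N := g x *m (grad f x)^T *m X x.
have -> : g x *m ((grad f x)^T *m X x + f x *: jac X x) = N + f x *: (g x *m jac X x).
  by rewrite mulmxDr mulmxA scalemxAr.
have -> : f x *: along X g x - (N + f x *: (g x *m jac X x)) - (N + f x *: (g x *m jac X x))^T
    = f x *: (along X g x - g x *m jac X x - (g x *m jac X x)^T) - N - N^T.
  move: (along X g x) (g x *m jac X x) N (f x) => A1 A2 A3 a.
  by apply/matrixP => i j; rewrite !mxE; ring.
set K := along X g x - _ - _.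
rewrite !mulmxBr !mulmxBl -scalemxAr -scalemxAl.
have -> : B^T *m N *m B = 0 by rewrite /N -!mulmxA XB !mulmx0.
have -> : B^T *m N^T *m B = 0 by rewrite /N !trmx_mul !mulmxA XB' !mul0mx.
by rewrite !subr0 /K !mulmxBr !mulmxBl.
Qed.

End ConformalFields.

Section CometricAlongFlow.
Variables (R : realType) (n k : nat) (N : set 'rV[R]_n).
Variables (g : 'rV[R]_n -> 'M[R]_n) (X : 'rV[R]_n -> 'rV[R]_n) (pi : 'rV[R]_n -> 'rV[R]_k).
Hypothesis oN : open N.
Hypothesis sg : smooth_mx N g.
Hypothesis sX : smooth_mx N X.
Hypothesis spi : smooth_mx N pi.
Hypothesis g_sym : forall y, N y -> (g y)^T = g y.
Hypothesis XJ : forall y, N y -> X y *m jac pi y = 0.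

(** The flow of X carries fibres of pi to fibres, so d pi is invariant under it. *)
Lemma along_jac y : N y -> along X (jac pi) y = - (jac X y *m jac pi y).
Proof.
move=> Ny; apply/matrixP => i j.
have e0 : pderiv_mx i (fun z => X z *m jac pi z) y = 0.
  rewrite -[RHS](pderiv_mx_cst (0 : 'M[R]_(1, k)) i y).
  by apply: (pderiv_mx_eq oN).
rewrite (pderiv_mxM oN) // in e0; last exact: (smooth_jac spi).
have := congr1 (fun A : 'M[R]_(1, k) => A 0 j) e0; rewrite [RHS]mxE [LHS]mxE.
rewrite addrC => /eqP; rewrite addr_eq0 => /eqP e.
rewrite summxE [RHS]mxE.
have -> : (jac X y *m jac pi y) i j = (pderiv_mx i X y *m jac pi y) 0 j.
  by rewrite !mxE; apply: eq_bigr => l _; rewrite !mxE.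
rewrite -e mxE; apply: eq_bigr => m _; rewrite mxE; congr (_ * _).
have jE a b : pderiv_mx a (jac pi) y b j = pderiv a (pderiv b (fun z => pi z 0 j)) y.
  rewrite mxE; congr (pderiv a _ y).
  by apply/funext => z; rewrite mxE.
apply: etrans (jE m i) _; apply: etrans _ (esym (jE i m)).
exact: (schwarz m i oN (spi 0 j 2%N) Ny).
Qed.

(** The image of the cometric under d pi; it depends on the point of the fibre. *)
Definition pushed_cometric y : 'M[R]_k := (jac pi y)^T *m g y *m jac pi y.

Lemma smooth_pushed_cometric : smooth_mx N pushed_cometric.
Proof.
have sJ := smooth_jac spi.
by apply: smooth_mxM => //; apply: smooth_mxM => //; exact: smooth_mx_tr.
Qed.

(** The Lie derivative commutes with pushing forward along the invariant map pi. *)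
Lemma along_pushed_cometric y : N y ->
  along X pushed_cometric y = (jac pi y)^T *m lie_cometric g X y *m jac pi y.
Proof.
move=> Ny; have sJ := smooth_jac spi.
have e m : pderiv_mx m pushed_cometric y = (pderiv_mx m (jac pi) y)^T *m g y *m jac pi y
   + (jac pi y)^T *m pderiv_mx m g y *m jac pi y + (jac pi y)^T *m g y *m pderiv_mx m (jac pi) y.
  rewrite (pderiv_mxM oN) //; last by apply: smooth_mxM => //; exact: smooth_mx_tr.
  rewrite (pderiv_mxM oN) //; last exact: smooth_mx_tr.
  by rewrite pderiv_mx_tr mulmxDl.
have E : along X pushed_cometric y = (along X (jac pi) y)^T *m g y *m jac pi y
   + (jac pi y)^T *m along X g y *m jac pi y + (jac pi y)^T *m g y *m along X (jac pi) y.
  rewrite {1}/along; under eq_bigr do rewrite e !scalerDr.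
  rewrite !big_split /=; congr (_ + _ + _).
  - rewrite /along linear_sum /= !mulmx_suml; apply: eq_bigr => m _.
    by rewrite linearZ /= -!scalemxAl.
  - rewrite /along mulmx_sumr mulmx_suml; apply: eq_bigr => m _.
    by rewrite -scalemxAr -scalemxAl.
  - rewrite /along mulmx_sumr; apply: eq_bigr => m _.
    by rewrite -scalemxAr.
rewrite E along_jac // /lie_cometric !mulmxBr !mulmxBl !trmx_mul g_sym //.
rewrite linearN /= trmx_mul !mulNmx mulmxN !mulmxA.
by rewrite [- _ + _]addrC addrAC.
Qed.

End CometricAlongFlow.

Section ConformalProjection.
Variables (R : realType) (p : nat).

Lemma full_rank_of_minor m (A : 'M[R]_(m.+1, m)) i : \det (row' i A) != 0 -> \rank A = m.
Proof.
move=> d0; apply/eqP; rewrite eqn_leq rank_leq_col /=.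
have sub : (row' i A <= A)%MS.
  apply/row_subP => k; have -> : row k (row' i A) = row (lift i k) A.
    by apply/rowP => j; rewrite !mxE.
  exact: row_sub.
apply: leq_trans (mxrankS sub).
by rewrite mxrank_unit // unitmxE unitfE.
Qed.

(** The covectors pulled back along J annihilate X, so c^-1 maps them into the
    orthogonal complement of X, and by their rank onto it. *)
Lemma horizontal_lift n (c : 'M[R]_n.+1) (J : 'M[R]_(n.+1, n)) (X v : 'rV[R]_n.+1) :
  posdef c -> \rank J = n -> X != 0 -> X *m J = 0 -> bil c X v = 0 ->
  exists q : 'rV[R]_n, v = q *m (J^T *m invmx c).
Proof.
move=> pc rJ X0 XJ Xv; have uc := posdef_unit pc.
have rN : \rank (J^T *m invmx c) = n.
  by rewrite mxrankMfree ?mxrank_tr // row_free_unit unitmx_inv.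
have NX : (J^T *m invmx c <= kermx (c *m X^T))%MS.
  apply/sub_kermxP; rewrite mulmxA -[_ *m c]mulmxA mulVmx // mulmx1.
  by rewrite -trmx_mul XJ trmx0.
have rc : \rank (c *m X^T) = 1%N.
  apply/eqP; rewrite eqn_leq rank_leq_col /= lt0n mxrank_eq0.
  apply: contra_neq X0 => h; apply: trmx_inj; rewrite trmx0.
  by rewrite -(mulKmx uc X^T) h mulmx0.
have eqN : (J^T *m invmx c == kermx (c *m X^T))%MS.
  by rewrite -mxrank_leqif_eq // rN mxrank_ker rc subn1.
have /submxP[q ->] : (v <= J^T *m invmx c)%MS.
  rewrite (eqmxP eqN); apply/sub_kermxP.
  have [sc _] := pc.
  apply: trmx_inj; rewrite trmx0 !trmx_mul trmxK sc.
  by apply/matrixP => a b; rewrite (ord1 a) (ord1 b) [RHS]mxE -Xv.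
by exists q.
Qed.

Local Notation n := (p.+2).

(** The columns of J annihilate T, so transverse conformality makes the pushed cometric P
    satisfy X P = kappa P.  Hence the ratios of its entries are functions on the base, and P
    is a multiple mu of its value S at the point of the slice on the same fibre.  The
    conformal metric on the base is the inverse of S, rescaled to have determinant 1. *)
Theorem conformal_projection (U : set 'rV[R]_n) (c : 'rV[R]_n -> 'M[R]_n)
    (T : 'rV[R]_n -> 'rV[R]_n) (x0 : 'rV[R]_n) :
  open U -> conformal_metric U c -> smooth_mx U T -> (forall x, U x -> T x != 0) ->
  (forall x, U x -> transversely_conformal (fun y => invmx (c y)) T x) -> U x0 ->
  exists (V : set 'rV[R]_n) (B : set 'rV[R]_p.+1) (pi : 'rV[R]_n -> 'rV[R]_p.+1)
         (h : 'rV[R]_p.+1 -> 'M[R]_p.+1),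
    [/\ [/\ open V, V x0 & V `<=` U],
        [/\ open B, pi @` V = B & conformal_metric B h],
        smooth_mx V pi
      & forall y, V y ->
        [/\ \rank (jac pi y) = p.+1,
            T y *m jac pi y = 0
          & exists2 lam : R, 0 < lam & forall v w : 'rV[R]_n,
              bil (c y) (T y) v = 0 -> bil (c y) (T y) w = 0 ->
              bil (h (pi y)) (v *m jac pi y) (w *m jac pi y) = lam * bil (c y) v w]].
Proof.
move=> oU [sc cm] sT T0 conf Ux0.
have pc y : U y -> posdef (c y) by move=> /cm[].
have uc y : U y -> c y \in unitmx by move=> /pc; exact: posdef_unit.
pose g y := invmx (c y).
have sg : smooth_mx U g by exact: smooth_mx_inv.
have pg y : U y -> posdef (g y) by move=> /pc; exact: posdef_inv.
have [i0 Ti0] : exists i0, T x0 0 i0 != 0.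
  apply/existsP; rewrite -negb_forall; apply: contra (T0 _ Ux0) => /forallP h.
  by apply/eqP/rowP => i; rewrite [RHS]mxE; apply/eqP; exact: h.
pose U' := [set y | U y /\ T y 0 i0 != 0].
have U'U : U' `<=` U by move=> y [].
have oU' : open U'.
  rewrite openE => y [Uy Ty].
  have cT := smooth_continuous (sT 0 i0) Uy.
  have nz : \forall z \near y, T z 0 i0 != 0 by exact: (cvgr_neq0 (T y 0 i0) cT Ty).
  by apply: filterS2 (open_near oU Uy) nz.
have U'x0 : U' x0 by [].
pose f y := (T y 0 i0)^-1.
have sf : smooth U' f.
  by apply: smooth_inv => //; [move=> y [] | exact: smooth_sub U'U (sT 0 i0)].
pose X y := f y *: T y.
have sT' : smooth_mx U' T by exact: smooth_mx_sub U'U sT.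
have sX : smooth_mx U' X by exact: smooth_mxZ.
have X1 y : U' y -> X y 0 i0 = 1 by move=> [_ Ty]; rewrite mxE /f mulVf.
have f0 y : U' y -> f y != 0 by move=> [_ Ty]; rewrite invr_eq0.
have confX y : U' y -> transversely_conformal g X y.
  by move=> U'y; apply: (transversely_conformal_scale U'y sf sT' (f0 y U'y)); apply: conf; exact: U'U.
have [rho [K [pi [rho0 bU spi XJ [piS K1 inv]]]]] := flow_projection oU' sX X1 U'x0.
pose sl := slice x0 i0.
have ballE k (z : 'rV[R]_k) e y : ball z e y <-> `|y - z| < e by rewrite -ball_normE /= distrC.
have K0 : 0 < K by apply: lt_le_trans K1.
pose b0 := col' i0 x0.
have slb0 : sl b0 = x0 by exact: slice_col'.
have ob k (z : 'rV[R]_k) e : open (ball z e) by exact: ball_open.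
have oB := ob _ x0 rho.
(* the minor of the Jacobian transverse to the i0-axis is 1 at x0 *)
have minor0 : row' i0 (jac pi x0) = 1%:M.
  apply/matrixP => a b; rewrite !mxE.
  have ossl : smooth_mx setT sl by apply: smooth_slice; exact: openT.
  pose W := [set b | setT b /\ ball x0 rho (sl b)].
  have oW : open W by exact: (open_preimage openT oB ossl).
  have Wb0 : W b0 by split=> //; rewrite slb0; exact: ballxx.
  have e1 : pderiv a (fun z : 'rV[R]_p.+1 => z 0 b) b0 = (a == b)%:R.
    by have [_ e] := is_derive_coord b0 (delta_mx 0 a) b; rewrite /pderiv e mxE eqxx /= eq_sym.
  rewrite -[RHS]e1.
  have -> : pderiv a (fun z : 'rV[R]_p.+1 => z 0 b) b0 = pderiv a ((fun y => pi y 0 b) \o sl) b0.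
    by apply: (@pderiv_eq_on _ _ W _ _ _ _ oW Wb0) => z [_ Wz]; rewrite /= piS.
  have Bx : ball x0 rho (sl b0) by rewrite slb0; exact: ballxx.
  have dj j : derivable (fun z => sl z 0 j) b0 (delta_mx 0 a).
    exact: (@smooth_derivable _ _ setT (fun z => sl z 0 j) b0 a (ossl 0 j) I).
  have [_ e2] := @is_derive_comp R p.+1 n 0 (ball x0 rho) (fun y => pi y 0 b) sl b0 _ oB (spi 0 b 1%N) Bx dj.
  rewrite [RHS]e2 (bigD1 (lift i0 a)) //= big1 => [|j ja].
    rewrite addr0 slb0.
    have -> : (fun y => sl y 0 (lift i0 a)) = (fun y => y 0 a) by apply/funext => y; rewrite /sl slice_lift.
    have [_ ->] := is_derive_coord b0 (delta_mx 0 a) a.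
    by rewrite mxE !eqxx mul1r.
  have [j' jE|jE] := unliftP i0 j; last first.
    have -> : (fun y => sl y 0 j) = fun=> x0 0 i0 by apply/funext => y; rewrite /sl jE slice_i0.
    by rewrite derive_cst mul0r.
  have -> : (fun y => sl y 0 j) = (fun y => y 0 j') by apply/funext => y; rewrite /sl jE slice_lift.
  have [_ ->] := is_derive_coord b0 (delta_mx 0 a) j'.
  rewrite mxE eqxx /=; have -> : (j' == a) = false.
    by apply: contraNF ja => /eqP <-; rewrite jE.
  by rewrite mul0r.
pose dm y := \det (row' i0 (jac pi y)).
have sJ : smooth_mx (ball x0 rho) (jac pi) by exact: (smooth_jac spi).
have sdm : smooth (ball x0 rho) dm.
  apply: (smooth_det oB) => i j; apply: (smooth_eq oB) (sJ (lift i0 i) j) => y _.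
  by rewrite [RHS]mxE.
have dm0 : dm x0 != 0 by rewrite /dm minor0 det1 oner_eq0.
have [rho' /andP[rho'0 rr] hdm] : exists2 rho', 0 < rho' <= rho & forall y, ball x0 rho' y -> dm y != 0.
  have cd := smooth_continuous sdm (ballxx x0 rho0).
  have /nbhs_ballP[d /= dp hd] : \forall y \near x0, dm y != 0 by exact: (cvgr_neq0 (dm x0) cd dm0).
  exists (Num.min d rho); first by rewrite lt_min dp rho0 ge_min lexx orbT.
  by move=> y; rewrite ballE lt_min => /andP[h _]; apply: hd; apply/ballE.
have oN := ob _ x0 rho'.
have Nrr : ball x0 rho' `<=` ball x0 rho.
  by move=> y; rewrite !ballE => h; exact: lt_le_trans h rr.
have NU : ball x0 rho' `<=` U by move=> y /Nrr/bU[].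
have rankJ y : ball x0 rho' y -> \rank (jac pi y) = p.+1.
  by move=> /hdm; exact: full_rank_of_minor.
have TJ y : ball x0 rho y -> T y *m jac pi y = 0.
  move=> By; have /eqP := XJ y By; rewrite -scalemxAl scaler_eq0 (negPf (f0 _ (bU _ By))) /=.
  by move/eqP.
pose P := pushed_cometric g pi.
have sgN : smooth_mx (ball x0 rho') g by exact: smooth_mx_sub NU sg.
have spiN : smooth_mx (ball x0 rho') pi by exact: smooth_mx_sub Nrr spi.
have sXN : smooth_mx (ball x0 rho') X by apply: smooth_mx_sub sX => y /Nrr/bU.
have symN y : ball x0 rho' y -> (g y)^T = g y by move=> /NU/pg[].
have XJN y : ball x0 rho' y -> X y *m jac pi y = 0 by move=> /Nrr; exact: XJ.
have sP : smooth_mx (ball x0 rho') P by exact: (smooth_pushed_cometric oN sgN spiN).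
have pP y : ball x0 rho' y -> posdef (P y).
  move=> By; rewrite /P /pushed_cometric -{2}(trmxK (jac pi y)); apply: posdef_congr.
    by apply: pg; exact: NU.
  by rewrite /row_free mxrank_tr rankJ.
have XP y : ball x0 rho' y -> exists kappa, forall i j, \sum_m X y 0 m * pderiv m (fun z => P z i j) y = kappa * P y i j.
  move=> By; have [kappa hk] := confX y (bU _ (Nrr _ By)).
  exists kappa => i j.
  have e := along_pushed_cometric oN sgN sXN spiN symN XJN By.
  have e' := hk _ (jac pi y) (XJN y By).
  have := congr1 (fun A : 'M[R]_p.+1 => A i j) (etrans e e').
  rewrite [RHS]mxE => <-; rewrite /along summxE; apply: eq_bigr => m _.
  by rewrite [RHS]mxE [X in _ = _ * X]mxE.
(* the flow rescales P, so that the ratios of its entries are constant along the fibres *)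
have ratio y : K * `|y - x0| < rho' -> ball x0 rho' y -> forall i j,
    P y i j / P y 0 0 = P (sl (pi y)) i j / P (sl (pi y)) 0 0.
  move=> hy By i j.
  have [||Bs iv] := inv rho' y; rewrite ?rho'0 ?rr //.
  have P00 z : ball x0 rho' z -> P z 0 0 != 0 by move=> /pP/posdef_diag_gt0 h; rewrite gt_eqF.
  pose u z := P z i j / P z 0 0.
  have su : smooth (ball x0 rho') u.
    apply: (smoothM oN (sP i j)); exact: (smooth_inv oN P00 (sP 0 0)).
  apply: (iv u (su 1%N)) => z Bz.
  have [kappa hk] := XP z Bz.
  have e m : pderiv m (fun w => P w i j) z = pderiv m u z * P z 0 0 + u z * pderiv m (fun w => P w 0 0) z.
    rewrite -pderivM; [|exact: smooth_derivable su Bz|exact: smooth_derivable (sP 0 0) Bz].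
    by apply: (@pderiv_eq_on _ _ (ball x0 rho') _ _ _ _ oN Bz) => w Bw; rewrite /u divfK ?P00.
  have := hk i j; under eq_bigr do rewrite e mulrDr mulrA.
  rewrite big_split /= -mulr_suml.
  have -> : \sum_m X z 0 m * (u z * pderiv m (fun w => P w 0 0) z) = u z * (kappa * P z 0 0).
    by rewrite -(hk 0 0) mulr_sumr; apply: eq_bigr => m _; rewrite mulrCA.
  rewrite mulrCA [u z * _]divfK ?P00 // => /eqP; rewrite -subr_eq0 addrK mulf_eq0 (negPf (P00 z Bz)) orbF.
  by move/eqP.
pose eps := rho' / K.
have eps0 : 0 < eps by rewrite divr_gt0.
have epsr : eps <= rho' by rewrite ler_pdivrMr // ler_peMr // ltW.
have sldist b : `|sl b - x0| <= `|b - b0|.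
  apply: norm_le_coord => // i j; rewrite (ord1 i) mxE [(- x0) 0 j]mxE.
  have [j' ->|->] := unliftP i0 j; last by rewrite /sl slice_i0 subrr normr0.
  rewrite /sl slice_lift; have -> : x0 0 (lift i0 j') = b0 0 j' by rewrite mxE.
  by have := norm_coord_le (b - b0) 0 j'; rewrite [(b - b0) 0 j']mxE [(- b0) 0 j']mxE.
pose B := ball b0 eps.
have slB b : B b -> ball x0 eps (sl b).
  by move=> /ballE h; apply/ballE; exact: le_lt_trans (sldist b) h.
have er : ball x0 eps `<=` ball x0 rho' by move=> y; rewrite !ballE => h; exact: lt_le_trans h epsr.
pose V := [set y | ball x0 eps y /\ B (pi y)].
have oV : open V.
  by apply: open_preimage; [exact: ob | exact: ob | exact: smooth_mx_sub er spiN].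
have VN y : V y -> ball x0 rho' y by move=> [/er].
have pix0 : pi x0 = b0 by have := piS b0; rewrite -[slice _ _ _]/(sl b0) slb0; apply; exact: ballxx.
pose S b := P (sl b).
have sS : smooth_mx B S.
  apply: (@smooth_mx_comp _ _ _ (ob _ b0 eps) _ _ _ (ball x0 rho') P sl oN _ sP).
    by move=> b /slB/er.
  by apply: smooth_slice; exact: ob.
have pS b : B b -> posdef (S b) by move=> /slB/er/pP.
have dS b : B b -> 0 < \det (S b) by move=> /pS/posdef_det_gt0.
pose h b := (\det (S b) `^ (p.+1%:R^-1)) *: invmx (S b).
exists V, B, pi, h; split.
- split=> //; last by move=> y /VN/NU.
  by split; [exact: ballxx | rewrite pix0; exact: ballxx].
- split; first exact: ob.
    apply/seteqP; split=> [b [y [_ By] <-] //|b Bb].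
    exists (sl b); last by apply: piS; apply: Nrr; apply: er; exact: slB.
    by split; [exact: slB | rewrite piS //; apply: Nrr; apply: er; exact: slB].
  split.
    apply: (smooth_mxZ (ob _ b0 eps)).
      by apply: (smooth_powR (ob _ b0 eps)) => //; exact: (smooth_det (ob _ b0 eps) sS).
    by apply: (smooth_mx_inv (ob _ b0 eps)) => // b /pS; exact: posdef_unit.
  move=> b Bb; have [s1 s2] : posdef (h b).
    by apply: posdef_scale; [apply: powR_gt0; exact: dS | apply: posdef_inv; exact: pS].
  split=> //; rewrite detZ det_inv -powR_mulrn ?powR_ge0 // -powRrM mulVf ?pnatr_eq0 //.
  by rewrite powRr1 ?divff ?gt_eqF ?dS // ltW // dS.
- by apply: smooth_mx_sub spiN => y /VN.
move=> y Vy; have By := VN y Vy.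
have [By' Bpy] := Vy.
split; [exact: rankJ | by apply: TJ; exact: Nrr |].
have hK : K * `|y - x0| < rho'.
  by move: By'; rewrite ballE /eps ltr_pdivlMr // mulrC.
pose mu := P y 0 0 / S (pi y) 0 0.
have P00 : 0 < P y 0 0 by exact: posdef_diag_gt0 (pP y By).
have S00 : 0 < S (pi y) 0 0 by exact: posdef_diag_gt0 (pS _ Bpy).
have mu0 : 0 < mu by rewrite divr_gt0.
have PS : P y = mu *: S (pi y).
  apply/matrixP => i j; rewrite [RHS]mxE; have := ratio y hK By i j.
  rewrite -/(S (pi y)) /mu => e.
  rewrite -[LHS](divfK (lt0r_neq0 P00)) e; move: (S (pi y) i j) (S (pi y) 0 0) (P y 0 0) => s t q.
  by rewrite mulrAC [RHS]mulrAC [s * q]mulrC.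
exists (\det (S (pi y)) `^ (p.+1%:R^-1) * mu); first by rewrite mulr_gt0 // powR_gt0 // dS.
move=> v w hv hw.
have pcy := pc y (NU _ By).
have [q ->] := horizontal_lift pcy (rankJ y By) (T0 _ (NU _ By)) (TJ _ (Nrr _ By)) hv.
have [q' ->] := horizontal_lift pcy (rankJ y By) (T0 _ (NU _ By)) (TJ _ (Nrr _ By)) hw.
have JP (r : 'rV[R]_p.+1) : r *m ((jac pi y)^T *m invmx (c y)) *m jac pi y = r *m P y.
  by rewrite /P /pushed_cometric !mulmxA.
have cE : bil (c y) (q *m ((jac pi y)^T *m invmx (c y))) (q' *m ((jac pi y)^T *m invmx (c y)))
   = (q *m P y *m q'^T) 0 0.
  have [scy _] := pcy; rewrite /bil /P /pushed_cometric /g.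
  rewrite !trmx_mul trmxK trmx_inv scy !mulmxA mulmxKV //.
  exact: posdef_unit.
rewrite cE !JP /bil /h PS.
move: (posdef_unit (pS _ Bpy)) (pS _ Bpy).1; move: (S (pi y)) (mu) => S0 m uS sS'.
have -> : (q' *m (m *: S0))^T = m *: (S0 *m q'^T).
  by rewrite -scalemxAr linearZ /= trmx_mul sS'.
do 4 rewrite -?scalemxAr -?scalemxAl; rewrite !mulmxA mulmxK //.
rewrite !scalerA.
by rewrite !entryZ; ring.
Qed.

End ConformalProjection.

(** * Weyl connections in a chart *)

Section WeylShift.
Variables (R : realType) (n : nat).
Implicit Types (c : 'M[R]_n) (b v : 'rV[R]_n).

(** The change of the torsion-free connection on the tangent bundle when b is added
    to the connection form of the Weyl derivative. *)
Definition weyl_shift c b (i : 'I_n) : 'M[R]_n :=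
  \matrix_(j, k) (b 0 i * (j == k)%:R + b 0 j * (i == k)%:R - c i j * (b *m invmx c) 0 k).

Lemma weyl_shiftE c b i : weyl_shift c b i =
  b 0 i *: 1%:M + b^T *m delta_mx 0 i - (row i c)^T *m (b *m invmx c).
Proof.
apply/matrixP => j k; rewrite !mxE !big_ord1 !mxE eqxx /=.
by rewrite [k == i]eq_sym.
Qed.

Lemma mul_weyl_shift c b v i : c^T = c ->
  v *m weyl_shift c b i =
    b 0 i *: v + (v *m b^T) 0 0 *: delta_mx 0 i - (v *m c) 0 i *: (b *m invmx c).
Proof.
move=> sc; rewrite weyl_shiftE mulmxBr mulmxDr -scalemxAr mulmx1 !mulmxA.
congr (_ + _ - _).
  by rewrite {1}[v *m b^T]mx11_scalar mul_scalar_mx.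
rewrite -!mulmxA [v *m (_ *m _)]mulmxA.
have -> : v *m (row i c)^T = ((v *m c) 0 i)%:M.
  rewrite [LHS]mx11_scalar; congr (_%:M); rewrite !mxE; apply: eq_bigr => j _.
  by rewrite !mxE -{1}sc mxE.
by rewrite mul_scalar_mx.
Qed.

Lemma weyl_shiftN c b i : weyl_shift c (- b) i = - weyl_shift c b i.
Proof.
by rewrite /weyl_shift mulNmx; apply/matrixP => j k; rewrite !mxE; move: (\sum_j _) => s; ring.
Qed.

Lemma weyl_shift_sym c b i j k : c^T = c -> weyl_shift c b i j k = weyl_shift c b j i k.
Proof.
move=> sc; have e : c i j = c j i by rewrite -{1}sc mxE.
by rewrite !mxE e [b 0 i * _ + _]addrC.
Qed.

Lemma weyl_shift_metric c b i : c^T = c -> c \in unitmx ->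
  weyl_shift c b i *m c + c *m (weyl_shift c b i)^T = (2 * b 0 i) *: c.
Proof.
move=> sc uc.
have e : weyl_shift c b i *m c = b 0 i *: c + b^T *m row i c - (row i c)^T *m b.
  rewrite weyl_shiftE mulmxBl mulmxDl -scalemxAl mul1mx -!mulmxA mulVmx // mulmx1.
  by rewrite -rowE.
have -> : c *m (weyl_shift c b i)^T = (weyl_shift c b i *m c)^T by rewrite trmx_mul sc.
rewrite e !linearB !linearD linearZ /= sc !trmx_mul !trmxK.
move: (b^T *m row i c) ((row i c)^T *m b) => p q.
by apply/matrixP => k l; rewrite !mxE; ring.
Qed.

(** The Koszul argument: a tensor that is symmetric in one pair of its indices and skew
    in an overlapping pair vanishes. *)
Lemma koszul_zero c (E : 'I_n -> 'M[R]_n) : c \in unitmx -> c^T = c ->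
  (forall i j k, E i j k = E j i k) -> (forall i, E i *m c + c *m (E i)^T = 0) ->
  forall i, E i = 0.
Proof.
move=> uc sc sE mE.
pose t i j l := (E i *m c) j l.
have t1 i j l : t i j l = - t i l j.
  have := congr1 (fun A : 'M[R]_n => A j l) (mE i); rewrite mxE [RHS]mxE => /eqP.
  rewrite addr_eq0 => /eqP h; rewrite /t h; congr (- _).
  by have -> : c *m (E i)^T = (E i *m c)^T; [rewrite trmx_mul sc | rewrite mxE].
have t2 i j l : t i j l = t j i l.
  by rewrite /t !mxE; apply: eq_bigr => k _; rewrite sE.
have t0 i j l : t i j l = 0.
  have : t i j l = - t i j l 
    by rewrite {1}(t1 i j l) (t2 i l j) (t1 l i j) opprK (t2 l j i) (t1 j l i) (t2 j i l).
  by move: (t i j l) => a; lra.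
move=> i; rewrite -[E i](mulmxK uc).
have -> : E i *m c = 0 by apply/matrixP => j l; rewrite [RHS]mxE; exact: t0.
by rewrite mul0mx.
Qed.

Lemma weyl_shift_unique c b (T : 'I_n -> 'M[R]_n) : c \in unitmx -> c^T = c ->
  (forall i j k, T i j k = T j i k) ->
  (forall i, T i *m c + c *m (T i)^T = (2 * b 0 i) *: c) ->
  forall i, T i = weyl_shift c b i.
Proof.
move=> uc sc sT mT i; apply/eqP; rewrite -subr_eq0; apply/eqP.
apply: (@koszul_zero c (fun i => T i - weyl_shift c b i)) => // [i' j k|i'].
  by rewrite !entryB sT (weyl_shift_sym _ _ _ _ sc).
rewrite linearB /= mulmxBl mulmxBr addrACA mT -opprD weyl_shift_metric //.
by rewrite subrr.
Qed.

Lemma weyl_shift_trace c b l : c^T = c -> c \in unitmx ->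
  \sum_k weyl_shift c b k l k = n%:R * b 0 l.
Proof.
move=> sc uc; under eq_bigr do rewrite mxE.
rewrite sumrB big_split /=.
have -> : \sum_k b 0 k * (l == k)%:R = b 0 l.
  rewrite (bigD1 l) //= eqxx mulr1 big1 ?addr0 // => k kl.
  by rewrite eq_sym (negPf kl) mulr0.
have -> : \sum_(k < n) b 0 l * (k == k)%:R = n%:R * b 0 l.
  under eq_bigr do rewrite eqxx mulr1.
  by rewrite sumr_const card_ord -[LHS]mulr_natl.
have -> : \sum_k c k l * (b *m invmx c) 0 k = b 0 l.
  rewrite -[b in RHS](mulmxKV uc) [RHS]mxE; apply: eq_bigr => k _.
  by rewrite mulrC.
by rewrite addrAC subrr add0r.
Qed.

End WeylShift.

Section WeylConnections.
Variables (R : realType) (n : nat) (U : set 'rV[R]_n) (c : 'rV[R]_n -> 'M[R]_n).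
Hypothesis oU : open U.
Hypothesis mc : conformal_metric U c.

Let sc : smooth_mx U c. Proof. by case: mc. Qed.
Let pc x : U x -> posdef (c x). Proof. by case: mc => _ h /h[]. Qed.
Let symc x : U x -> (c x)^T = c x. Proof. by move=> /pc[]. Qed.
Let uc x : U x -> c x \in unitmx. Proof. by move=> /pc; exact: posdef_unit. Qed.
Let sg : smooth_mx U (fun x => invmx (c x)). Proof. exact: smooth_mx_inv. Qed.

Lemma smooth_weyl_shift (b : 'rV[R]_n -> 'rV[R]_n) i : smooth_mx U b ->
  smooth_mx U (fun x => weyl_shift (c x) (b x) i).
Proof.
move=> sb.
have h : smooth_mx U (fun x => b x 0 i *: 1%:M + (b x)^T *m delta_mx 0 i
    - (row i (c x))^T *m (b x *m invmx (c x)) : 'M[R]_n).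
  apply: smooth_mxB => //; last first.
    apply: smooth_mxM => //; last exact: smooth_mxM.
    apply: smooth_mx_tr => // j k; apply: (smooth_eq oU) (sc i k) => x _.
    by rewrite mxE.
  apply: smooth_mxD => //; first by apply: smooth_mxZ => //; exact: smooth_mx_cst.
  by apply: smooth_mxM => //; [exact: smooth_mx_tr | exact: smooth_mx_cst].
by apply: (smooth_mx_eq oU) h => x _; rewrite weyl_shiftE.
Qed.

Lemma weyl_connection_shift al G b : weyl_connection U c al G -> smooth_mx U b ->
  weyl_connection U c (fun x => al x + b x) (fun i x => G i x + weyl_shift (c x) (b x) i).
Proof.
move=> [sG tG mG] sb; split.
- by move=> i; apply: smooth_mxD => //; exact: smooth_weyl_shift.
- by move=> x Ux i j k; rewrite !entryD tG // (weyl_shift_sym _ _ _ _ (symc Ux)).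
move=> x Ux i; rewrite linearD /= mulmxDl mulmxDr.
have h := mG x Ux i; have h2 := weyl_shift_metric (b x) i (symc Ux) (uc Ux).
rewrite entryD mulrDr scalerDl -h2 -[RHS]h.
move: (pderiv_mx i c x) (_ *: c x) (G i x *m c x) (c x *m (G i x)^T) (weyl_shift _ _ _ *m _) (c x *m _).
by move=> p q r s t u; apply/matrixP => j k; rewrite !mxE; ring.
Qed.

Lemma weyl_connection_unique al al' G G' x i :
  weyl_connection U c al G -> weyl_connection U c al' G' -> U x ->
  G' i x = G i x + weyl_shift (c x) (al' x - al x) i.
Proof.
move=> [sG tG mG] [sG' tG' mG'] Ux.
apply/eqP; rewrite addrC -subr_eq; apply/eqP.
apply: (@weyl_shift_unique _ _ (c x) (al' x - al x) (fun i => G' i x - G i x)).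
- exact: uc.
- exact: symc.
- by move=> a j k; rewrite !entryB tG // tG'.
move=> a; have h := mG x Ux a; have h' := mG' x Ux a.
rewrite linearB /= mulmxBl mulmxBr entryB mulrBr scalerBl.
have e : pderiv_mx a c x + (2 * al' x 0 a) *: c x - G' a x *m c x - c x *m (G' a x)^T =
   pderiv_mx a c x + (2 * al x 0 a) *: c x - G a x *m c x - c x *m (G a x)^T by rewrite h h'.
move: e.
move: (pderiv_mx a c x) (_ *: c x) (_ *: c x) (G' a x *m c x) (G a x *m c x) (c x *m (G' a x)^T) (c x *m (G a x)^T).
move=> p q r s t u v /matrixP e; apply/matrixP => j k.
by have := e j k; rewrite !mxE; lra.
Qed.

End WeylConnections.

(** * The difference of two Ricci tensors *)

Lemma sum_delta (R : pzRingType) n (F : 'I_n -> R) l : \sum_k F k * (l == k)%:R = F l.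
Proof.
rewrite (bigD1 l) //= eqxx mulr1 big1 ?addr0 // => k kl.
by rewrite eq_sym (negPf kl) mulr0.
Qed.

Section RicciDifference.
Variables (R : realType) (n : nat) (U : set 'rV[R]_n) (c : 'rV[R]_n -> 'M[R]_n).
Variables (al th : 'rV[R]_n -> 'rV[R]_n) (G Gp Gm : 'I_n -> 'rV[R]_n -> 'M[R]_n).
Hypothesis oU : open U.
Hypothesis mc : conformal_metric U c.
Hypothesis sth : smooth_mx U th.
Hypothesis wG : weyl_connection U c al G.
Hypothesis wGp : weyl_connection U c (fun x => al x + th x) Gp.
Hypothesis wGm : weyl_connection U c (fun x => al x - th x) Gm.

Let sc : smooth_mx U c. Proof. by case: mc. Qed.
Let pc x : U x -> posdef (c x). Proof. by case: mc => _ h /h[]. Qed.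
Let symc x : U x -> (c x)^T = c x. Proof. by move=> /pc[]. Qed.
Let uc x : U x -> c x \in unitmx. Proof. by move=> /pc; exact: posdef_unit. Qed.
Let sg : smooth_mx U (fun x => invmx (c x)). Proof. exact: smooth_mx_inv. Qed.
Let sG i : smooth_mx U (G i). Proof. by case: wG. Qed.

Let S i x := weyl_shift (c x) (th x) i.
Let sS i : smooth_mx U (S i). Proof. exact: smooth_weyl_shift. Qed.

Let GpE i y : U y -> Gp i y = G i y + S i y.
Proof.
by move=> Uy; rewrite (weyl_connection_unique mc i wG wGp Uy) [al y + _]addrC addrK.
Qed.

Let GmE i y : U y -> Gm i y = G i y + (-1) *: S i y.
Proof.
move=> Uy; rewrite (weyl_connection_unique mc i wG wGm Uy).
by rewrite [al y - _]addrC addrK weyl_shiftN scaleN1r.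
Qed.

(** The terms quadratic in S have the same sign in both curvatures and cancel. *)
Lemma curvature_diff i j x : U x ->
  curvature Gp i j x - curvature Gm i j x =
  2 *: (pderiv_mx i (S j) x - pderiv_mx j (S i) x + S j x *m G i x + G j x *m S i x
        - S i x *m G j x - G i x *m S j x).
Proof.
move=> Ux; rewrite /curvature.
have dp a b : pderiv_mx a (Gp b) x = pderiv_mx a (G b) x + pderiv_mx a (S b) x.
  by rewrite -(pderiv_mxD (U := U)) //; apply: (pderiv_mx_eq oU) => // y; exact: GpE.
have dm a b : pderiv_mx a (Gm b) x = pderiv_mx a (G b) x - pderiv_mx a (S b) x.
  rewrite -[- pderiv_mx a (S b) x]scaleN1r.
  have -> : -1 *: pderiv_mx a (S b) x = pderiv_mx a (fun y => (-1) *: S b y) x.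
    rewrite (pderiv_mxZ a Ux (smooth_cst U (-1)) (sS b)) /pderiv derive_cst scale0r add0r.
    by [].
  rewrite -(pderiv_mxD (U := U)) //; last by apply: smooth_mxZ => //; exact: smooth_cst.
  by apply: (pderiv_mx_eq oU) => // y; exact: GmE.
rewrite !dp !dm !GpE // !GmE // !scaleN1r.
rewrite !mulmxDl !mulmxDr !mulmxN !mulNmx opprK.
move: (pderiv_mx i (G j) x) (pderiv_mx j (G i) x) (pderiv_mx i (S j) x) (pderiv_mx j (S i) x)
  (G j x *m G i x) (G j x *m S i x) (S j x *m G i x) (S j x *m S i x)
  (G i x *m G j x) (G i x *m S j x) (S i x *m G j x) (S i x *m S j x).
move=> m1 m2 m3 m4 m5 m6 m7 m8 m9 m10 m11 m12.
by apply/matrixP => a b; rewrite !mxE; ring.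
Qed.

Variable x : 'rV[R]_n.
Hypothesis Ux : U x.

Let ths y : 'rV[R]_n := th y *m invmx (c y).
Let sths : smooth_mx U ths. Proof. exact: smooth_mxM. Qed.
Let dth i j : R := pderiv i (fun y => th y 0 j) x.
Let tG m := \sum_k G k x m k.

Let Gsym i j k : G i x j k = G j x i k. Proof. by case: wG => _ h _; exact: h. Qed.

Let R1 j l : \sum_k pderiv_mx k (S j) x l k = dth l j + dth j l
  - \sum_k ths x 0 k * pderiv_mx k c x j l - c x j l * \sum_k pderiv k (fun y => ths y 0 k) x.
Proof.
have e k : pderiv_mx k (S j) x l k = dth k j * (l == k)%:R + dth k l * (j == k)%:R
    - ths x 0 k * pderiv_mx k c x j l - c x j l * pderiv k (fun y => ths y 0 k) x.
  rewrite mxE [pderiv_mx k c x j l]mxE.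
  have d f : smooth U f -> is_derive x (delta_mx 0 k) f (pderiv k f x).
    by move=> sf; apply: derivableP; exact: smooth_derivable sf Ux.
  have d1 := is_deriveM (d _ (sth 0 j)) (is_derive_cst ((l == k)%:R : R) x (delta_mx 0 k)).
  have d2 := is_deriveM (d _ (sth 0 l)) (is_derive_cst ((j == k)%:R : R) x (delta_mx 0 k)).
  have d3 := is_deriveM (d _ (sc j l)) (d _ (sths 0 k)).
  have [_ E] := is_deriveB (is_deriveD d1 d2) d3.
  rewrite /pderiv; have -> : (fun y => S j y l k) = ((fun y => th y 0 j) * cst ((l == k)%:R : R) +
     (fun y => th y 0 l) * cst ((j == k)%:R : R)) - (fun y => c y j l) * (fun y => ths y 0 k).
    by apply/funext => y; rewrite /S /weyl_shift mxE.
  rewrite E /dth /pderiv /GRing.scale /=; ring.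
under eq_bigr do rewrite e.
by rewrite !sumrB big_split /= !sum_delta mulr_sumr.
Qed.

Let R2 j l : \sum_k pderiv_mx j (S k) x l k = n%:R * dth j l.
Proof.
under eq_bigr do rewrite mxE.
rewrite -(pderiv_sum oU (f := fun k y => S k y l k)) //; last by move=> k; exact: sS.
have -> : pderiv j (fun y => \sum_k S k y l k) x = pderiv j (fun y => n%:R * th y 0 l) x.
  apply: (@pderiv_eq_on _ _ U) => // y Uy; apply: weyl_shift_trace; [exact: symc|exact: uc].
rewrite pderivM; [|exact: derivable_cst|exact: smooth_derivable (sth 0 l) Ux].
by rewrite {1}/pderiv derive_cst mul0r add0r.
Qed.

Let SE j l k : S j x l k = th x 0 j * (l == k)%:R + th x 0 l * (j == k)%:R - c x j l * ths x 0 k.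
Proof. by rewrite /S /weyl_shift mxE. Qed.

Let R3 j l : \sum_k (S j x *m G k x) l k =
  th x 0 j * tG l + th x 0 l * tG j - c x j l * \sum_m ths x 0 m * tG m.
Proof.
under eq_bigr do rewrite mxE.
rewrite exchange_big /=.
have -> : \sum_m \sum_k S j x l m * G k x m k = \sum_m S j x l m * tG m.
  by apply: eq_bigr => m _; rewrite mulr_sumr.
have -> : \sum_m S j x l m * tG m = \sum_m ((th x 0 j * tG m) * (l == m)%:R
     + (th x 0 l * tG m) * (j == m)%:R - c x j l * (ths x 0 m * tG m)).
  by apply: eq_bigr => m _; rewrite SE; ring.
by rewrite sumrB big_split /= !sum_delta -mulr_sumr.
Qed.

Let tr_S l : \sum_k S k x l k = n%:R * th x 0 l.
Proof. by apply: weyl_shift_trace; [exact: symc|exact: uc]. Qed.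

Let R4 j l : \sum_k (G j x *m S k x) l k = n%:R * (th x *m (G j x)^T) 0 l.
Proof.
under eq_bigr do rewrite mxE.
rewrite exchange_big mxE mulr_sumr; apply: eq_bigr => m _.
by rewrite -mulr_sumr tr_S mxE; ring.
Qed.

Let R5 j l : \sum_k (S k x *m G j x) l k =
  (th x *m (G j x)^T) 0 l + th x 0 l * tG j - \sum_m ths x 0 m * (G m x *m c x) j l.
Proof.
have e k : (S k x *m G j x) l k = th x 0 k * G j x l k + th x 0 l * G j x k k
    - \sum_m c x k l * (ths x 0 m * G j x m k).
  rewrite mxE.
  have -> : \sum_m S k x l m * G j x m k = \sum_m ((th x 0 k * G j x m k) * (l == m)%:R
      + (th x 0 l * G j x m k) * (k == m)%:R - c x k l * (ths x 0 m * G j x m k)).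
    by apply: eq_bigr => m _; rewrite SE; ring.
  by rewrite sumrB big_split /= !sum_delta.
under eq_bigr do rewrite e.
rewrite sumrB big_split /=; congr (_ + _ - _).
- by rewrite mxE; apply: eq_bigr => k _; rewrite [(G j x)^T _ _]mxE.
- by rewrite -mulr_sumr; congr (_ * _); apply: eq_bigr => k _; exact: Gsym.
rewrite exchange_big /=; apply: eq_bigr => m _; rewrite [(_ *m c x) j l]mxE mulr_sumr.
by apply: eq_bigr => k _; rewrite (Gsym m j k); ring.
Qed.

Let R6 j l : \sum_k (G k x *m S j x) l k =
  th x 0 j * tG l + (th x *m (G j x)^T) 0 l - \sum_k ths x 0 k * (c x *m (G k x)^T) j l.
Proof.
have e k : (G k x *m S j x) l k = th x 0 j * G k x l k
    + (\sum_m G k x l m * th x 0 m) * (j == k)%:R - ths x 0 k * (c x *m (G k x)^T) j l.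
  rewrite mxE.
  have -> : \sum_m G k x l m * S j x m k = \sum_m ((th x 0 j * G k x l m) * (k == m)%:R
      + (G k x l m * th x 0 m) * (j == k)%:R - ths x 0 k * (c x j m * G k x l m)).
    by apply: eq_bigr => m _; rewrite SE [k == m]eq_sym; ring.
  rewrite sumrB big_split /= sum_delta -mulr_suml -mulr_sumr; congr (_ - _ * _).
  by rewrite mxE; apply: eq_bigr => m _; rewrite mxE.
under eq_bigr do rewrite e.
rewrite sumrB big_split /= sum_delta -mulr_sumr; congr (_ + _ - _).
by rewrite mxE; apply: eq_bigr => m _; rewrite mulrC [(G j x)^T _ _]mxE.
Qed.

(** D th as a bilinear form; the direction of differentiation comes first. *)
Definition cov_form i j : R := dth i j - (th x *m (G i x)^T) 0 j.

(** The six sums come from the six terms of the difference of the curvatures.  Besides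
    D th and its transpose they only contain multiples of the metric, since the
    derivatives of the metric combine with the Christoffel symbols by D c = 0. *)
Lemma ricci_diff : exists lam : R, forall j l,
  ricci Gp x j l - ricci Gm x j l =
    2 * (cov_form l j + (1 - n%:R) * cov_form j l + lam * c x j l).
Proof.
exists (2 * (\sum_k ths x 0 k * al x 0 k) - \sum_k pderiv k (fun y => ths y 0 k) x
   - \sum_m ths x 0 m * tG m) => j l.
rewrite !mxE -sumrB.
have -> : \sum_k (curvature Gp k j x l k - curvature Gm k j x l k) =
   2 * (\sum_k pderiv_mx k (S j) x l k - \sum_k pderiv_mx j (S k) x l k
        + \sum_k (S j x *m G k x) l k + \sum_k (G j x *m S k x) l k
        - \sum_k (S k x *m G j x) l k - \sum_k (G k x *m S j x) l k).
  rewrite -!sumrB -!big_split /= -!sumrB mulr_sumr; apply: eq_bigr => k _.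
  by rewrite -entryB curvature_diff // mxE !(entryB, entryD).
rewrite R1 R2 R3 R4 R5 R6; congr (2 * _).
have metric : \sum_k ths x 0 k * pderiv_mx k c x j l =
   \sum_k ths x 0 k * (G k x *m c x) j l + \sum_k ths x 0 k * (c x *m (G k x)^T) j l
   - 2 * (\sum_k ths x 0 k * al x 0 k) * c x j l.
  rewrite -big_split /= -mulrA mulr_suml mulr_sumr -sumrB; apply: eq_bigr => k _.
  have [_ _ m] := wG; have := congr1 (fun A : 'M[R]_n => A j l) (m x Ux k).
  rewrite !entryB entryD entryZ [RHS]mxE.
  move: (pderiv_mx k c x j l) ((G k x *m c x) j l) ((c x *m (G k x)^T) j l) (c x j l) => p q r s h.
  have -> : p = q + r - 2 * al x 0 k * s by move: h; lra.
  by ring.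
rewrite metric /cov_form.
have symT : (th x *m (G l x)^T) 0 j = (th x *m (G j x)^T) 0 l.
  by rewrite !mxE; apply: eq_bigr => m _; rewrite !mxE Gsym.
by rewrite symT; ring.
Qed.

End RicciDifference.

(** * The conformal equation for the difference form *)

Section EinsteinWeyl.
Variables (R : realType) (n : nat).

Lemma sym_tracefree0 (g A : 'M[R]_n) : sym_tracefree g A = 0 ->
  exists mu : R, forall j l, A j l + A l j = mu * g j l.
Proof.
rewrite /sym_tracefree; set t := _ * \tr _ => /eqP; rewrite subr_eq0 => /eqP e.
exists (2 * t) => j l; have := congr1 (fun B : 'M[R]_n => B j l) e.
rewrite !entryZ entryD [A^T j l]mxE => h.
by rewrite -[2 * t * _]mulrA -h mulrA mulfV ?mul1r // pnatr_eq0.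
Qed.

(** Symmetrizing the difference of the two Ricci tensors leaves 2 - n times the symmetric
    part of D th, up to multiples of the metric. *)
Lemma einstein_weyl_conformal_form (U : set 'rV[R]_n) c al th G Gp Gm x :
  (2 < n)%N -> open U -> conformal_metric U c -> smooth_mx U th ->
  weyl_connection U c al G ->
  weyl_connection U c (fun x => al x + th x) Gp ->
  weyl_connection U c (fun x => al x - th x) Gm -> U x ->
  sym_tracefree (c x) (ricci Gp x) = 0 -> sym_tracefree (c x) (ricci Gm x) = 0 ->
  exists kappa : R, forall i j,
    cov_form th G x i j + cov_form th G x j i = kappa * c x i j.
Proof.
move=> n2 oU mc sth wG wGp wGm Ux /sym_tracefree0[mp hp] /sym_tracefree0[mm hm].
have [lam hl] := ricci_diff oU mc sth wG wGp wGm Ux.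
have cs i j : c x i j = c x j i.
  by have [_ h] := mc; have [s _ _] := h x Ux; rewrite -{1}s mxE.
have n2' : n%:R - 2 != 0 :> R by rewrite subr_eq0 eqr_nat gtn_eqF.
exists ((4 * lam - mp + mm) / (2 * (n%:R - 2))) => i j.
have h1 := hl i j; have h2 := hl j i; rewrite (cs j i) in h2.
have h3 := hp i j; have h4 := hm i j.
move: h1 h2 h3 h4.
move: (ricci Gp x i j) (ricci Gp x j i) (ricci Gm x i j) (ricci Gm x j i) (c x i j)
  (cov_form th G x i j) (cov_form th G x j i) => p q r s t a b h1 h2 h3 h4.
apply: (mulfI n2').
have -> : (n%:R - 2) * ((4 * lam - mp + mm) / (2 * (n%:R - 2)) * t) = (4 * lam - mp + mm) * t / 2.
  by field; rewrite n2'.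
have e : (mp - mm) * t = 2 * ((2 - n%:R) * (a + b) + 2 * lam * t).
  rewrite mulrBl -h3 -h4; have -> : p + q - (r + s) = (p - r) + (q - s) by ring.
  by rewrite h1 h2; ring.
have -> : (n%:R - 2) * (a + b) = 2 * lam * t - (mp - mm) * t / 2 by rewrite e; field.
by field.
Qed.

End EinsteinWeyl.

(** * The unit field dual to a 1-form and its Weyl derivative *)

Section Direction.
Variables (R : realType) (n : nat) (U : set 'rV[R]_n) (c : 'rV[R]_n -> 'M[R]_n).
Variables (al th : 'rV[R]_n -> 'rV[R]_n) (G : 'I_n -> 'rV[R]_n -> 'M[R]_n).
Hypothesis oU : open U.
Hypothesis mc : conformal_metric U c.
Hypothesis sal : smooth_mx U al.
Hypothesis sth : smooth_mx U th.
Hypothesis wG : weyl_connection U c al G.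
Hypothesis th0 : forall x, U x -> th x != 0.

Let sc : smooth_mx U c. Proof. by case: mc. Qed.
Let pc x : U x -> posdef (c x). Proof. by case: mc => _ h /h[]. Qed.
Let symc x : U x -> (c x)^T = c x. Proof. by move=> /pc[]. Qed.
Let uc x : U x -> c x \in unitmx. Proof. by move=> /pc; exact: posdef_unit. Qed.
Let g x := invmx (c x).
Let sg : smooth_mx U g. Proof. exact: smooth_mx_inv. Qed.
Let symg x : U x -> (g x)^T = g x. Proof. by move=> Ux; rewrite /g trmx_inv symc. Qed.
Let ths y : 'rV[R]_n := th y *m g y.
Let sths : smooth_mx U ths. Proof. exact: smooth_mxM. Qed.
Let M x : 'M[R]_n := \matrix_(i, j) cov_form th G x i j.

(** The metric condition D c = 0 for the inverse of c. *)
Lemma pderiv_cometric i x : U x ->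
  pderiv_mx i g x = (2 * al x 0 i) *: g x - g x *m G i x - (G i x)^T *m g x.
Proof.
move=> Ux; have [_ _ m] := wG; have := m x Ux i.
rewrite (pderiv_mx_inv oU i Ux sc uc) -/(g x).
have vc := mulVmx (uc Ux); have cv := mulmxV (uc Ux).
move=> /eqP; rewrite subr_eq0 => /eqP; rewrite -addrA => e.
have -> : pderiv_mx i c x = G i x *m c x + c x *m (G i x)^T - (2 * al x 0 i) *: c x.
  move: e; move: (pderiv_mx i c x) (_ *: c x) (G i x *m c x) (c x *m (G i x)^T) => p q r s.
  by move=> <-; apply/matrixP => a b; rewrite !mxE; ring.
rewrite mulmxBr mulmxDr mulmxBl mulmxDl -scalemxAr -scalemxAl /g vc mul1mx !mulmxA vc mul1mx.
rewrite -[invmx (c x) *m G i x *m c x *m invmx (c x)]mulmxA cv mulmx1.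
by rewrite opprB opprD addrA.
Qed.

Lemma row_pderiv_th i x : pderiv_mx i th x - th x *m (G i x)^T = row i (M x).
Proof. by apply/rowP => j; rewrite entryB !mxE /cov_form; congr (_ - _); rewrite mxE. Qed.

Lemma row_jac_sharp i x : U x ->
  row i (jac ths x) = row i (M x) *m g x + (2 * al x 0 i) *: ths x - ths x *m G i x.
Proof.
move=> Ux; have -> : row i (jac ths x) = pderiv_mx i ths x.
  by apply/rowP => j; rewrite !mxE.
rewrite (pderiv_mxM oU) // pderiv_cometric // -row_pderiv_th mulmxBl !mulmxBr -scalemxAr !mulmxA.
rewrite -/(ths x).
move: (pderiv_mx i th x *m g x) (_ *: ths x) (ths x *m G i x) (th x *m (G i x)^T *m g x) => p q r s.
by apply/rowP => a; rewrite !mxE; ring.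
Qed.

(** Up to terms with a factor X, the Lie derivative of the cometric along the field X dual
    to th is minus twice the symmetric part of D th, with indices raised, plus a multiple
    of the cometric that comes from the density weight of c. *)
Lemma sharp_transversely_conformal x kappa : U x ->
  (forall i j, cov_form th G x i j + cov_form th G x j i = kappa * c x i j) ->
  transversely_conformal g ths x.
Proof.
move=> Ux hk.
pose GX := \sum_j ths x 0 j *: G j x.
pose a := \sum_j ths x 0 j * al x 0 j.
have aE : along ths g x = (2 * a) *: g x - g x *m GX - GX^T *m g x.
  have -> : g x *m GX = \sum_j ths x 0 j *: (g x *m G j x).
    by rewrite mulmx_sumr; apply: eq_bigr => j _; rewrite -scalemxAr.
  have -> : GX^T *m g x = \sum_j ths x 0 j *: ((G j x)^T *m g x).
    rewrite /GX raddf_sum /= mulmx_suml; apply: eq_bigr => j _.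
    by rewrite linearZ /= -scalemxAl.
  rewrite /a mulr_sumr scaler_suml -!sumrB; apply: eq_bigr => j _.
  rewrite pderiv_cometric // !scalerBr scalerA.
  by congr (_ *: _ - _ - _); ring.
have jE : jac ths x = M x *m g x + (2 *: (al x)^T) *m ths x - GX.
  apply/row_matrixP => i; rewrite row_jac_sharp // linearB linearD /= !row_mul.
  congr (_ + _ - _).
    have -> : row i (2 *: (al x)^T) = (2 * al x 0 i)%:M.
      by rewrite [LHS]mx11_scalar; congr (_%:M); rewrite !mxE.
    by rewrite mul_scalar_mx.
  apply/rowP => k; rewrite [RHS]mxE /GX summxE mxE; apply: eq_bigr => j _.
  by have [_ tG _] := wG; rewrite tG // entryZ.
exists (2 * a - kappa) => k B XB.
have MM : M x + (M x)^T = kappa *: c x.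
  by apply/matrixP => i j; rewrite !mxE hk.
rewrite /lie_cometric aE jE.
have XB' : B^T *m (ths x)^T = 0 by rewrite -trmx_mul XB trmx0.
have -> : (2 * a) *: g x - g x *m GX - GX^T *m g x
    - g x *m (M x *m g x + 2 *: (al x)^T *m ths x - GX)
    - (g x *m (M x *m g x + 2 *: (al x)^T *m ths x - GX))^T
  = (2 * a - kappa) *: g x - (g x *m (2 *: (al x)^T)) *m ths x
     - (ths x)^T *m (g x *m (2 *: (al x)^T))^T.
  have e1 : g x *m M x *m g x + g x *m (M x)^T *m g x = kappa *: g x.
    rewrite -mulmxDl -mulmxDr MM -scalemxAr -scalemxAl /g mulVmx ?uc // mul1mx //.
  have -> : (g x *m (M x *m g x + 2 *: (al x)^T *m ths x - GX))^T =
     g x *m (M x)^T *m g x + (ths x)^T *m (g x *m (2 *: (al x)^T))^T - GX^T *m g x.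
    rewrite trmx_mul linearB linearD /= !trmx_mul symg // mulmxBl mulmxDl.
    by rewrite !mulmxA.
  rewrite scalerBl -e1 mulmxBr mulmxDr !mulmxA.
  move: (_ *: g x) (g x *m GX) (GX^T *m g x) (g x *m M x *m g x) (g x *m (M x)^T *m g x).
  move: (g x *m (2 *: (al x)^T) *m ths x) ((ths x)^T *m _) => q1 q2 q3 q4 q5 q6 q7.
  by apply/matrixP => i j; rewrite !mxE; ring.
have z1 (Q : 'M[R]_(n, 1)) : B^T *m (Q *m ths x) *m B = 0 by rewrite -mulmxA -mulmxA XB !mulmx0.
have z2 (Q : 'M[R]_(1, n)) : B^T *m ((ths x)^T *m Q) *m B = 0 by rewrite mulmxA XB' !mul0mx.
by rewrite !mulmxBr !mulmxBl z1 z2 !subr0 -scalemxAr -scalemxAl.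
Qed.

Let N := form_norm c th.
Let N2 x := bil (g x) (th x) (th x).

Let N2gt0 x : U x -> 0 < N2 x.
Proof. by move=> Ux; have [_ h] := posdef_inv (pc Ux); apply: h; exact: th0. Qed.

Let NN x : U x -> N x * N x = N2 x.
Proof. by move=> Ux; rewrite -expr2 sqr_sqrtr // ltW // N2gt0. Qed.

Lemma form_norm_gt0 x : U x -> 0 < N x.
Proof. by move=> Ux; rewrite sqrtr_gt0 N2gt0. Qed.

Let sN2 : smooth U N2.
Proof.
have h : smooth_mx U (fun x => th x *m g x *m (th x)^T).
  by apply: smooth_mxM => //; exact: smooth_mx_tr.
exact: h 0 0.
Qed.

Lemma smooth_form_norm : smooth U N.
Proof.
have h := smooth_powR oU 2^-1 N2gt0 sN2.
by apply: (smooth_eq oU) h => x Ux; rewrite powR12_sqrt // ltW // N2gt0.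
Qed.

Lemma sharp_sharp x : U x -> (ths x *m (th x)^T) = (N2 x)%:M.
Proof. by move=> Ux; rewrite [LHS]mx11_scalar. Qed.

Lemma smooth_direction : smooth_mx U (direction c th).
Proof.
apply: smooth_mxZ => //; apply: smooth_inv => //; last exact: smooth_form_norm.
by move=> x /form_norm_gt0 h; rewrite gt_eqF.
Qed.

Lemma direction_unit x : U x -> bil (c x) (direction c th x) (direction c th x) = 1.
Proof.
move=> Ux; rewrite /bil /direction -/(N x) -/(ths x) linearZ /= -!scalemxAl -scalemxAr.
rewrite {1}/ths mulmxKV ?uc //.
have -> : th x *m (ths x)^T = (N2 x)%:M.
  by rewrite -sharp_sharp // /ths trmx_mul symg // mulmxA.
have n0 := lt0r_neq0 (form_norm_gt0 Ux).
by rewrite !mxE eqxx mulr1n -NN //; move: (N x) n0 => q q0; field.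
Qed.

Let eta x i : R := (N x)^-1 * pderiv i N x.

Let etaE x i : U x -> eta x i * N2 x = (row i (M x) *m (ths x)^T) 0 0 + al x 0 i * N2 x.
Proof.
move=> Ux; have sN := smooth_form_norm.
have e1 : pderiv i N2 x = 2 * (N x * pderiv i N x).
  have -> : pderiv i N2 x = pderiv i (fun y => N y * N y) x.
    by apply: (@pderiv_eq_on _ _ U) => // y Uy; rewrite NN.
  by rewrite pderivM; [ring | exact: smooth_derivable sN Ux | exact: smooth_derivable sN Ux].
have e2 : pderiv i N2 x = 2 * ((row i (M x) *m (ths x)^T) 0 0 + al x 0 i * N2 x).
  have -> : pderiv i N2 x = (pderiv_mx i (fun y => ths y *m (th y)^T) x) 0 0 by rewrite [RHS]mxE.
  have thsT : (ths x)^T = g x *m (th x)^T by rewrite trmx_mul symg.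
  rewrite (pderiv_mxM oU) //; last exact: smooth_mx_tr.
  rewrite pderiv_mx_tr.
  have -> : pderiv_mx i ths x = row i (M x) *m g x + (2 * al x 0 i) *: ths x - ths x *m G i x.
    by rewrite -row_jac_sharp //; apply/rowP => j; rewrite !mxE.
  have dthE : pderiv_mx i th x = row i (M x) + th x *m (G i x)^T by rewrite -row_pderiv_th subrK.
  have e3 : ths x *m (pderiv_mx i th x)^T = (row i (M x) *m (ths x)^T)^T + ths x *m G i x *m (th x)^T.
    by rewrite dthE linearD /= mulmxDr !trmx_mul !trmxK mulmxA.
  rewrite e3 mulmxBl mulmxDl -scalemxAl sharp_sharp // -[row i (M x) *m g x *m (th x)^T]mulmxA -thsT.
  move: (row i (M x) *m (ths x)^T) (ths x *m G i x *m (th x)^T) => p q.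
  by rewrite !mxE eqxx mulr1n; ring.
have two0 : 2 != 0 :> R by rewrite pnatr_eq0.
rewrite -(mulfI two0 (etrans (esym e1) e2)) /eta -NN //.
by have := lt0r_neq0 (form_norm_gt0 Ux); move: (N x) => q q0; field.
Qed.

Let smooth_eta i : smooth U (fun x => eta x i).
Proof.
have sN := smooth_form_norm.
apply: (smoothM oU); last exact: smooth_pderiv.
by apply: smooth_inv => // x /form_norm_gt0 h; rewrite gt_eqF.
Qed.

Lemma row_direction_deriv (a b x : 'rV[R]_n) (Gam : 'I_n -> 'rV[R]_n -> 'M[R]_n) (al' : 'rV[R]_n -> 'rV[R]_n) i :
  U x -> Gam i x = G i x + weyl_shift (c x) b i -> al' x = a ->
  row i (weighted_vector_deriv (-1) al' Gam (direction c th) x) =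
  (N x)^-1 *: (row i (M x) *m g x + (2 * al x 0 i - eta x i - a 0 i + b 0 i) *: ths x
     + (ths x *m b^T) 0 0 *: delta_mx 0 i - th x 0 i *: (b *m g x)).
Proof.
move=> Ux GE aE.
have -> : row i (weighted_vector_deriv (-1) al' Gam (direction c th) x) =
    pderiv_mx i (direction c th) x - a 0 i *: direction c th x + direction c th x *m Gam i x.
  by rewrite -aE; apply/rowP => k; rewrite !mxE; congr (_ + _ + _); ring.
have dE : direction c th x = (N x)^-1 *: ths x by [].
have sNi : smooth U (fun y => (N y)^-1).
  by apply: smooth_inv => //; [move=> y /form_norm_gt0 h; rewrite gt_eqF | exact: smooth_form_norm].
have dinv : pderiv i (fun y => (N y)^-1) x = - ((N x)^-1 * eta x i).
  have h : pderiv i (fun y => N y * (N y)^-1) x = 0.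
    have -> : pderiv i (fun y => N y * (N y)^-1) x = pderiv i (fun=> 1) x.
      by apply: (@pderiv_eq_on _ _ U) => // y /form_norm_gt0 h; rewrite mulfV // gt_eqF.
    by rewrite /pderiv derive_cst.
  rewrite pderivM in h; [|exact: smooth_derivable smooth_form_norm Ux|exact: smooth_derivable sNi Ux].
  have n0 := lt0r_neq0 (form_norm_gt0 Ux).
  apply: (mulfI n0); rewrite mulrN mulrA mulfV // mul1r /eta.
  by move/eqP: h; rewrite addrC addr_eq0 => /eqP ->; rewrite mulrC.
have -> : pderiv_mx i (direction c th) x = - ((N x)^-1 * eta x i) *: ths x
    + (N x)^-1 *: (row i (M x) *m g x + (2 * al x 0 i) *: ths x - ths x *m G i x).
  rewrite -row_jac_sharp // -dinv; have -> : row i (jac ths x) = pderiv_mx i ths x.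
    by apply/rowP => j; rewrite !mxE.
  exact: (pderiv_mxZ i Ux sNi sths).
rewrite dE GE mulmxDr -!scalemxAl mul_weyl_shift ?symc // {3}/ths mulmxKV ?uc // -/(g x).
move: (row i (M x) *m g x) (ths x *m G i x) (delta_mx 0 i) (b *m g x) ((ths x *m b^T) 0 0) => p q r s t.
by apply/rowP => k; rewrite !(entryB, entryD, entryN, entryZ); ring.
Qed.

(** With B the exact Weyl derivative for which the density |th| is parallel, this is the
    reflection 2 D - B of B in D. *)
Definition adapted_weyl_form y : 'rV[R]_n :=
  al y - (N y)^-1 *: density_deriv (-1) al N y.
Let D0 := adapted_weyl_form.

Let D0E x i : U x -> D0 x 0 i = 2 * al x 0 i - eta x i.
Proof.
move=> Ux; have n0 := lt0r_neq0 (form_norm_gt0 Ux).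
rewrite /D0 /adapted_weyl_form /density_deriv entryB entryZ entryD entryZ [grad N x 0 i]mxE /eta.
by move: (N x) n0 => q q0; field.
Qed.

(** The logarithmic derivative exhibits D0 as twice D plus an exact form. *)
Lemma adapted_weyl_formE x : U x ->
  adapted_weyl_form x = 2 *: al x - grad (fun y => ln (N y)) x.
Proof.
move=> Ux; apply/rowP => i; rewrite D0E // entryB entryZ [grad _ x 0 i]mxE /eta.
have [_ e] := @pderiv_ln _ _ U N x i (fun z Uz => form_norm_gt0 Uz) (smooth_form_norm 1%N) Ux.
by rewrite [in RHS]/pderiv e.
Qed.

Lemma smooth_adapted_weyl_form : smooth_mx U D0.
Proof.
move=> i j; rewrite (ord1 i).
have h : smooth U (fun x => 2 * al x 0 j + (-1) * eta x j).
  apply: (smoothD oU); apply: (smoothM oU); try exact: smooth_cst; first exact: sal.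
  exact: smooth_eta.
by apply: (smooth_eq oU) h => x Ux; rewrite D0E // mulN1r.
Qed.

Definition adapted_connection i x : 'M[R]_n := G i x + weyl_shift (c x) (D0 x - al x) i.

Lemma adapted_weyl_connection : weyl_connection U c D0 adapted_connection.
Proof.
have sb : smooth_mx U (fun x => D0 x - al x).
  by apply: smooth_mxB => //; exact: smooth_adapted_weyl_form.
have := weyl_connection_shift oU mc wG sb.
by have -> : (fun x => al x + (D0 x - al x)) = D0 by apply/funext => x; rewrite addrC subrK.
Qed.

(** The choice of D0 cancels the derivative of the norm of th. *)
Lemma direction_deriv x (b : 'rV[R]_n) Gam : U x ->
  (forall i, Gam i x = G i x + weyl_shift (c x) b i) ->
  weighted_vector_deriv (-1) D0 Gam (direction c th) x =
    (N x)^-1 *: (M x *m g x + b^T *m ths x + ((ths x *m b^T) 0 0)%:M - (th x)^T *m (b *m g x)).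
Proof.
move=> Ux GE; apply/row_matrixP => i.
rewrite (row_direction_deriv Ux (GE i) (erefl (D0 x))) D0E // [RHS]linearZ /=; congr (_ *: _).
have rs (t : R) : row i (t%:M : 'M[R]_n) = t *: delta_mx 0 i.
  by apply/rowP => k; rewrite !mxE eqxx /= eq_sym mulr_natr.
have rowD (A B : 'M[R]_n) : row i (A + B) = row i A + row i B by apply/rowP => k; rewrite !mxE.
have rowB (A B : 'M[R]_n) : row i (A - B) = row i A - row i B by apply/rowP => k; rewrite !mxE.
rewrite rowB !rowD !row_mul rs.
have rT (v : 'rV[R]_n) : row i v^T = (v 0 i)%:M.
  by rewrite [LHS]mx11_scalar; congr (_%:M); rewrite !mxE.
have -> : 2 * al x 0 i - eta x i - (2 * al x 0 i - eta x i) + b 0 i = b 0 i by ring.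
by rewrite (rT b) (rT (th x)) !mul_scalar_mx.
Qed.

(** Put b = al0 - al and let X be dual to th.  Then |th|^2 b = - (D th)(., X), which
    together with the conformal equation reduces both conditions to algebra. *)
Lemma adapted_weyl_form_minimal x kappa : U x ->
  (forall i j, cov_form th G x i j + cov_form th G x j i = kappa * c x i j) ->
  let Dxi := weighted_vector_deriv (-1) D0 adapted_connection (direction c th) x in
  direction c th x *m Dxi = 0 /\ \tr Dxi = 0.
Proof.
move=> Ux hk; pose b := D0 x - al x.
have MM : (M x)^T = kappa *: c x - M x.
  by apply/matrixP => i j; rewrite !mxE -hk addrC addKr.
have n0 := lt0r_neq0 (form_norm_gt0 Ux); have N20 := lt0r_neq0 (N2gt0 Ux).
have bE : N2 x *: b = - (ths x *m (M x)^T).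
  apply/rowP => i; rewrite entryZ entryB D0E // entryN.
  have e := etaE i Ux.
  have -> : (ths x *m (M x)^T) 0 i = (row i (M x) *m (ths x)^T) 0 0.
    by rewrite !mxE; apply: eq_bigr => j _; rewrite !mxE mulrC.
  have -> : N2 x * (2 * al x 0 i - eta x i - al x 0 i) = al x 0 i * N2 x - eta x i * N2 x by ring.
  by rewrite e; ring.
have tt : ths x *m (th x)^T = (N2 x)%:M := sharp_sharp Ux.
have tt' : th x *m (ths x)^T = (N2 x)%:M by rewrite -tt /ths trmx_mul symg // mulmxA.
have thc : ths x *m c x = th x by rewrite /ths mulmxKV // uc.
pose s := (ths x *m M x *m (ths x)^T) 0 0.
have sE : ths x *m M x *m (ths x)^T = s%:M by rewrite [LHS]mx11_scalar.
have s2 : 2 * s = kappa * N2 x.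
  have h : ths x *m (M x)^T *m (ths x)^T = s%:M.
    rewrite -(tr_scalar_mx _ s) -sE (trmx_mul (ths x *m M x)) (trmx_mul (ths x) (M x)) trmxK.
    by rewrite mulmxA.
  move: h; rewrite MM mulmxBr mulmxBl sE -scalemxAr thc -scalemxAl tt'.
  move=> /matrixP/(_ 0 0); rewrite !mxE eqxx !mulr1n => h.
  by rewrite mulr_natl mulr2n -{1}h subrK.
have tbE : N2 x * (ths x *m b^T) 0 0 = - s.
  have trN (A : 'M[R]_(1, n)) : (- A)^T = - A^T by apply/matrixP => i j; rewrite !mxE.
  have bT : N2 x *: b^T = - (M x *m (ths x)^T).
    by rewrite -linearZ /= bE trN (trmx_mul (ths x)) trmxK.
  by rewrite -entryZ scalemxAr bT mulmxN entryN mulmxA sE mxE eqxx mulr1n.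
have be2 : 2 * (ths x *m b^T) 0 0 + kappa = 0.
  apply: (mulfI N20); rewrite mulr0 mulrDr mulrCA tbE [N2 x * _]mulrC -s2.
  by ring.
have GE i : adapted_connection i x = G i x + weyl_shift (c x) b i by [].
rewrite /= (direction_deriv Ux GE); split.
  rewrite /direction -/(N x) -/(ths x) -scalemxAl -scalemxAr.
  suff -> : ths x *m (M x *m g x + b^T *m ths x + ((ths x *m b^T) 0 0)%:M - (th x)^T *m (b *m g x)) = 0.
    by rewrite !scaler0.
  have bg : N2 x *: (b *m g x) = ths x *m M x *m g x - kappa *: ths x.
    rewrite scalemxAl bE MM mulmxBr mulNmx -scalemxAr thc mulmxBl -scalemxAl -/(ths x).
    by rewrite opprB.
  rewrite mulmxBr !mulmxDr [_ *m (b^T *m _)]mulmxA [_ *m ((th x)^T *m _)]mulmxA tt.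
  rewrite {1}[ths x *m b^T]mx11_scalar mul_mx_scalar !mul_scalar_mx bg mulmxA.
  have -> : kappa = - (2 * (ths x *m b^T) 0 0) by apply/eqP; rewrite -addr_eq0 addrC be2.
  move: (ths x *m M x *m g x) ((ths x *m b^T) 0 0) (ths x) => p q r.
  by apply/rowP => i; rewrite !(entryB, entryD, entryN, entryZ) [RHS]mxE; ring.
have trB (A B : 'M[R]_n) : \tr (A - B) = \tr A - \tr B by rewrite linearB.
rewrite mxtraceZ trB !mxtraceD mxtrace_scalar.
have t1 : \tr (b^T *m ths x) = (ths x *m b^T) 0 0 by rewrite mxtrace_mulC trace_mx11.
have t2 : \tr ((th x)^T *m (b *m g x)) = (ths x *m b^T) 0 0.
  rewrite mxtrace_mulC trace_mx11 -mulmxA.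
  have -> : ths x *m b^T = (b *m (g x *m (th x)^T))^T by rewrite !trmx_mul trmxK symg.
  by rewrite [RHS]mxE.
have t3 : 2 * \tr (M x *m g x) = kappa * n%:R.
  have h : \tr ((M x)^T *m g x) = \tr (M x *m g x).
    by rewrite -mxtrace_tr trmx_mul trmxK symg // mxtrace_mulC.
  move: h; rewrite MM mulmxBl linearB /= -scalemxAl linearZ /= /g mulmxV ?uc // mxtrace1 => h.
  by rewrite mulr_natl mulr2n -{1}h subrK.
rewrite t1 t2; apply/eqP; rewrite mulf_eq0 invr_eq0 (negPf n0) /=; apply/eqP.
have two0 : 2 != 0 :> R by rewrite pnatr_eq0.
apply: (mulfI two0); rewrite mulr0.
have -> : 2 * (\tr (M x *m g x) + (ths x *m b^T) 0 0 + (ths x *m b^T) 0 0 *+ n - (ths x *m b^T) 0 0)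
   = 2 * \tr (M x *m g x) + n%:R * (2 * (ths x *m b^T) 0 0).
  by rewrite -[_ *+ n]mulr_natl; ring.
rewrite t3; have -> : 2 * (ths x *m b^T) 0 0 = - kappa by apply/eqP; rewrite -addr_eq0 be2.
by ring.
Qed.

(** The terms that depend on s form a multiple of the identity, which has no skew part. *)
Lemma adapted_deriv_alt x (s : R) Gam : U x ->
  (forall i, Gam i x = G i x + weyl_shift (c x) (s *: th x) i) ->
  alt (c x) (weighted_vector_deriv (-1) D0 Gam (direction c th) x) =
    (2^-1 * (N x)^-1) *: faraday th x.
Proof.
move=> Ux GE; rewrite (direction_deriv Ux GE) /alt.
have -> : M x *m g x + (s *: th x)^T *m ths x + ((ths x *m (s *: th x)^T) 0 0)%:M
    - (th x)^T *m ((s *: th x) *m g x) = M x *m g x + (s * N2 x)%:M.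
  have -> : (s *: th x)^T *m ths x = (th x)^T *m ((s *: th x) *m g x).
    by rewrite linearZ /= -!scalemxAl -scalemxAr.
  have -> : ths x *m (s *: th x)^T = (s * N2 x)%:M.
    by rewrite linearZ /= -scalemxAr sharp_sharp // scale_scalar_mx.
  by rewrite addrAC addrK mxE eqxx mulr1n.
rewrite -scalemxAl mulmxDl -mulmxA /g mulVmx ?uc // mulmx1 mul_scalar_mx.
have [_ tG _] := wG.
have cf i j : cov_form th G x i j - cov_form th G x j i =
    pderiv i (fun y => th y 0 j) x - pderiv j (fun y => th y 0 i) x.
  rewrite /cov_form; have -> : (th x *m (G i x)^T) 0 j = (th x *m (G j x)^T) 0 i.
    by rewrite !mxE; apply: eq_bigr => m _; rewrite !mxE tG.
  by ring.
apply/matrixP => i j; rewrite !mxE -cf.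
have -> : c x j i = c x i j by rewrite -{1}(symc Ux) mxE.
move: (cov_form th G x i j) (cov_form th G x j i) (c x i j) (N x)^-1 (N2 x) => p q r t u.
by ring.
Qed.

(** The exact term of the connection form has no curvature, by the symmetry of second
    derivatives. *)
Lemma faraday_adapted x : U x -> faraday D0 x = 2 *: faraday al x.
Proof.
move=> Ux; have sN := smooth_form_norm.
have sl : smooth U (fun y => ln (N y)).
  by apply: smooth_ln => // y; exact: form_norm_gt0.
have comp i j : pderiv i (fun y => D0 y 0 j) x =
    2 * pderiv i (fun y => al y 0 j) x - pderiv i (pderiv j (fun y => ln (N y))) x.
  have -> : pderiv i (fun y => D0 y 0 j) x =
      pderiv i ((2 \*: (fun y => al y 0 j)) - pderiv j (fun y => ln (N y))) x.
    apply: (@pderiv_eq_on _ _ U) => // y Uy; rewrite D0E // /eta.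
    by have [_ e] := @pderiv_ln _ _ U N y j (fun z Uz => form_norm_gt0 Uz) (sN 1%N) Uy; rewrite -e.
  have sd : smooth U (pderiv j (fun y => ln (N y))) by exact: smooth_pderiv.
  have d1 := smooth_derivable (i := i) (sal 0 j) Ux.
  have d2 := smooth_derivable (i := i) sd Ux.
  have D := is_deriveB (is_deriveZ 2 (derivableP d1)) (derivableP d2).
  by have [_ e] := D; exact: e.
apply/matrixP => i j; rewrite entryZ !mxE !comp.
rewrite (schwarz i j oU (sl 2%N) Ux).
move: (pderiv i (fun y => al y 0 j) x) (pderiv j (fun y => al y 0 i) x) (pderiv j _ x) => p q r.
by ring.
Qed.

End Direction.

(** * Transformation laws between charts *)

Section Restriction.
Variables (R : realType) (n : nat) (U V : set 'rV[R]_n).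
Hypothesis VU : V `<=` U.

Lemma conformal_metric_sub c : conformal_metric U c -> conformal_metric V c.
Proof.
by move=> [sc h]; split; [exact: smooth_mx_sub VU sc | move=> x /VU; exact: h].
Qed.

Lemma weyl_connection_sub c al G : weyl_connection U c al G -> weyl_connection V c al G.
Proof.
move=> [sG tG mG]; split; [|by move=> x /VU; exact: tG|by move=> x /VU; exact: mG].
by move=> i; exact: smooth_mx_sub VU (sG i).
Qed.

End Restriction.

Section ChartTransitions.
Variables (R : realType) (n : nat) (M : oriented_manifold R n.+1).
Variable c : chart M -> 'rV[R]_n.+1 -> 'M[R]_n.+1.
Variable th : chart M -> 'rV[R]_n.+1 -> 'rV[R]_n.+1.
Hypothesis hc : conformal_structure [set: M] c.
Hypothesis sth : forall a, smooth_mx (chart_img [set: M] a) (th a).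
Hypothesis tth : forall a b x, chart_img (chart_dom b `&` [set: M]) a x ->
  th a x = th b (transition a b x) *m (jac (transition a b) x)^T.

Let Om : set M := nonvanishing th.
Implicit Types (a b : chart M) (p : M).

Lemma transition_chart_map a b p : chart_dom a p ->
  transition a b (chart_map a p) = chart_map b p.
Proof. by move=> ap; rewrite /transition chart_mapK. Qed.

Lemma jac_transition_det a b x : chart_img (chart_dom b `&` [set: M]) a x ->
  0 < \det (jac (transition a b) x).
Proof. by move=> [p [ap [bp _]] <-]; exact: transition_oriented. Qed.

Lemma nonvanishingP a p : chart_dom a p -> Om p <-> th a (chart_map a p) != 0.
Proof.
move=> ap; split; first by apply.
move=> h b bp; apply: contra_neq h => h.
have ov : chart_img (chart_dom b `&` [set: M]) a (chart_map a p) by exists p.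
by rewrite (tth ov) (transition_chart_map b ap) h mul0mx.
Qed.

Lemma chart_img_nonvanishing a x :
  chart_img Om a x <-> chart_img [set: M] a x /\ th a x != 0.
Proof.
split=> [[p [ap Op] <-]|[[p [ap _] <-] h]].
  by split; [exists p | exact/(nonvanishingP ap)].
by exists p => //; split=> //; exact/(nonvanishingP ap).
Qed.

Lemma chart_range_open a : open (chart_img [set: M] a).
Proof. by rewrite /chart_img setIT; exact: chart_img_open. Qed.

Lemma open_nonzero (U : set 'rV[R]_n.+1) (f : 'rV[R]_n.+1 -> 'rV[R]_n.+1) :
  open U -> smooth_mx U f -> open [set x | U x /\ f x != 0].
Proof.
move=> oU sf; rewrite openE => x [Ux fx].
have cf := smooth_mx_continuous sf Ux.
have nz : \forall z \near x, f z != 0 by exact: (cvgr_neq0 (f x) cf fx).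
by apply: filterS2 (open_near oU Ux) nz.
Qed.

Lemma chart_img_nonvanishing_open a : open (chart_img Om a).
Proof.
have -> : chart_img Om a = [set x | chart_img [set: M] a x /\ th a x != 0].
  by apply/seteqP; split=> x /chart_img_nonvanishing.
by apply: open_nonzero; [exact: chart_range_open | exact: sth].
Qed.

Lemma overlap_open a b : open (chart_img (chart_dom b `&` Om) a).
Proof.
rewrite openE => x [p [ap [bp Op]] <-].
have xa : chart_img Om a (chart_map a p) by exists p.
have near_img := open_near (chart_img_nonvanishing_open (a := a)) xa.
have ci := chart_inv_continuous ap.
have near_b : \forall y \near chart_map a p, chart_dom b (chart_inv a y).
  by apply: ci; rewrite chart_mapK //; apply: open_nbhs_nbhs; split=> //; exact: chart_dom_open.
apply: filterS2 near_img near_b => y [q [aq Oq] <-].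
by rewrite chart_mapK // => bq; exists q.
Qed.

Lemma overlap_sub a b x : chart_img (chart_dom b `&` Om) a x ->
  [/\ chart_img Om a x, chart_img Om b (transition a b x),
      chart_img (chart_dom b `&` [set: M]) a x
    & (chart_map a @` (chart_dom a `&` chart_dom b)) x].
Proof.
move=> [p [ap [bp Op]] <-]; split; try by exists p.
by rewrite transition_chart_map //; exists p.
Qed.

Lemma overlap_smooth a b : smooth_mx (chart_img (chart_dom b `&` Om) a) (transition a b).
Proof. by apply: smooth_mx_sub (@transition_smooth _ _ M a b) => x /overlap_sub[]. Qed.

Lemma cometric_transition a b x : chart_img (chart_dom b `&` Om) a x ->
  (jac (transition a b) x)^T *m invmx (c a x) *m jac (transition a b) x
    = jac_weight 2 a b x *: invmx (c b (transition a b x)).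
Proof.
move=> ov; have [oa ob oo _] := overlap_sub ov.
have [h1 h2] := hc; have e := h2 a b x oo.
have dJ := jac_transition_det oo.
set J := jac (transition a b) x in e dJ *.
have uJ : J \in unitmx by rewrite unitmxE unitfE gt_eqF.
have /chart_img_nonvanishing[oa' _] := oa; have /chart_img_nonvanishing[ob' _] := ob.
have [_ pa] := h1 a; have [_ pb] := h1 b.
have [sa qa _] := pa x oa'; have [sb qb _] := pb _ ob'.
have ua : c a x \in unitmx by apply: posdef_unit.
have ub : c b (transition a b x) \in unitmx by apply: posdef_unit.
have uJT : J^T \in unitmx by rewrite unitmx_tr.
set w := jac_weight _ _ _ _ in e *; set cb := c b _ in e ub *.
have X : J^T *m invmx (c a x) *m J *m cb = w%:M.
  rewrite -[LHS](mulmxK uJT).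
  have -> : J^T *m invmx (c a x) *m J *m cb *m J^T = J^T *m invmx (c a x) *m (J *m cb *m J^T).
    by rewrite !mulmxA.
  by rewrite e -scalemxAr mulmxKV // -scalemxAl mulmxV // scalemx1.
by rewrite -[LHS](mulmxK ub) X mul_scalar_mx.
Qed.

Lemma jac_weight_gt0 w a b x : chart_img (chart_dom b `&` [set: M]) a x -> 0 < jac_weight w a b x.
Proof.
by move=> /jac_transition_det h; apply: powR_gt0; rewrite normr_gt0 gt_eqF.
Qed.

Lemma jac_weight2 a b x : jac_weight 2 a b x = jac_weight 1 a b x ^+ 2.
Proof.
rewrite /jac_weight -powR_mulrn ?powR_ge0 // -powRrM; congr (_ `^ _).
by rewrite mulrAC mul1r.
Qed.

Lemma jac_weightN1 a b x : jac_weight (-1) a b x = (jac_weight 1 a b x)^-1.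
Proof. by rewrite /jac_weight mulNr powRN. Qed.

Let sharp a y : 'rV[R]_n.+1 := th a y *m invmx (c a y).

Lemma sharp_transition a b x : chart_img (chart_dom b `&` Om) a x ->
  sharp a x *m jac (transition a b) x = jac_weight 2 a b x *: sharp b (transition a b x).
Proof.
move=> ov; have [_ _ oo _] := overlap_sub ov.
by rewrite /sharp (tth oo) -!mulmxA [_^T *m _]mulmxA cometric_transition // -scalemxAr.
Qed.

Lemma form_norm_transition a b x : chart_img (chart_dom b `&` Om) a x ->
  form_norm (c a) (th a) x =
    jac_weight 1 a b x * form_norm (c b) (th b) (transition a b x).
Proof.
move=> ov; have [oa ob oo _] := overlap_sub ov.
have e : bil (invmx (c a x)) (th a x) (th a x) = jac_weight 2 a b x *
    bil (invmx (c b (transition a b x))) (th b (transition a b x)) (th b (transition a b x)).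
  have h : th a x *m invmx (c a x) *m (th a x)^T = jac_weight 2 a b x *:
      (th b (transition a b x) *m invmx (c b (transition a b x)) *m (th b (transition a b x))^T).
    rewrite {2}(tth oo) trmx_mul trmxK mulmxA -/(sharp a x) sharp_transition //.
    by rewrite -scalemxAl.
  by rewrite /bil h entryZ.
rewrite /form_norm e jac_weight2 sqrtrM ?sqr_ge0 // sqrtr_sqr ger0_norm //.
exact: ltW (jac_weight_gt0 1 oo).
Qed.

Lemma direction_transition a b x : chart_img (chart_dom b `&` Om) a x ->
  direction (c b) (th b) (transition a b x)
    = jac_weight (-1) a b x *: (direction (c a) (th a) x *m jac (transition a b) x).
Proof.
move=> ov; have [oa ob oo _] := overlap_sub ov.
have w0 := lt0r_neq0 (jac_weight_gt0 1 oo).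
rewrite /direction -/(sharp a x) -/(sharp b (transition a b x)) -scalemxAl sharp_transition //.
rewrite (form_norm_transition ov) !scalerA jac_weight2 jac_weightN1; congr (_ *: _).
have [->|N0] := eqVneq (form_norm (c b) (th b) (transition a b x)) 0.
  by rewrite mulr0 !invr0 mulr0 mul0r.
by field; rewrite w0 N0.
Qed.

Variable D : chart M -> 'rV[R]_n.+1 -> 'rV[R]_n.+1.
Hypothesis hD : weyl_derivative [set: M] D.

Lemma chart_img_sub a x : chart_img Om a x -> chart_img [set: M] a x.
Proof. by move=> /chart_img_nonvanishing[]. Qed.

Lemma form_nonzero a x : chart_img Om a x -> th a x != 0.
Proof. by move=> /chart_img_nonvanishing[]. Qed.

Let cM a : conformal_metric (chart_img Om a) (c a).
Proof. by apply: conformal_metric_sub (proj1 hc a); exact: chart_img_sub. Qed.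

Let sth' a : smooth_mx (chart_img Om a) (th a).
Proof. by apply: smooth_mx_sub (sth a); exact: chart_img_sub. Qed.

(** Twice the inhomogeneous term d ln w of the law for D, minus the one that the norm of th
    contributes as a density, is d ln w again. *)
Lemma adapted_form_transition :
  weyl_derivative Om (fun a => adapted_weyl_form (c a) (D a) (th a)).
Proof.
split=> [a|a b x ov].
  apply: smooth_adapted_weyl_form => //; [exact: chart_img_nonvanishing_open | | exact: form_nonzero].
  by apply: smooth_mx_sub (proj1 hD a); exact: chart_img_sub.
have [oa ob oo _] := overlap_sub ov.
have oO := @overlap_open a b; set O := chart_img _ a in oO ov.
rewrite (adapted_weyl_formE (D a) (chart_img_nonvanishing_open (a := a)) (cM a) (sth' a) (@form_nonzero a) oa).
rewrite (adapted_weyl_formE (D b) (chart_img_nonvanishing_open (a := b)) (cM b) (sth' b) (@form_nonzero b) ob).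
rewrite (proj2 hD a b x oo) mulmxBl -scalemxAl scalerDr.
pose Nb y := form_norm (c b) (th b) y.
have Nb0 y : chart_img Om b y -> 0 < Nb y by exact: (form_norm_gt0 (cM b) (@form_nonzero b)).
have sw : smooth O (fun y => ln (jac_weight 1 a b y)).
  have sJ : smooth_mx O (jac (transition a b)) by exact: smooth_jac (@overlap_smooth a b).
  have w0 y : O y -> 0 < jac_weight 1 a b y by move=> /overlap_sub[_ _ h _]; exact: jac_weight_gt0.
  apply: smooth_ln => //.
  have h : smooth O (fun y => \det (jac (transition a b) y) `^ (1 / n.+1%:R)).
    apply: smooth_powR => //; last exact: smooth_det.
    by move=> y /overlap_sub[_ _ h _]; exact: jac_transition_det.
  apply: (smooth_eq oO) h => y /overlap_sub[_ _ h _].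
  by rewrite /jac_weight gtr0_norm // jac_transition_det.
have sl : smooth (chart_img Om b) (fun y => ln (Nb y)).
  apply: smooth_ln => //; first exact: chart_img_nonvanishing_open.
  by apply: smooth_form_norm => //; [exact: chart_img_nonvanishing_open | exact: form_nonzero].
have oB := chart_img_nonvanishing_open (a := b).
have tau_in y : O y -> chart_img Om b (transition a b y) by move=> /overlap_sub[].
have sc : smooth O (fun y => ln (Nb (transition a b y))).
  move=> k; apply: (@Ck_comp _ _ _ k O _ (fun y => ln (Nb y)) (transition a b) oO oB tau_in (sl k)) => j.
  exact: overlap_smooth.
suff -> : grad (fun y => ln (form_norm (c a) (th a) y)) x =
    grad (fun y => ln (jac_weight 1 a b y)) x
    + grad (fun y => ln (Nb y)) (transition a b x) *m (jac (transition a b) x)^T.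
  move: (grad (fun y => ln (jac_weight 1 a b y)) x) (grad _ (transition a b x) *m _).
  move: (D b (transition a b x) *m _) => p q r.
  by apply/rowP => i; rewrite !(entryB, entryD, entryN, entryZ); ring.
apply/rowP => i; rewrite entryD ![grad _ x 0 i]mxE.
have -> : pderiv i (fun y => ln (form_norm (c a) (th a) y)) x =
    pderiv i (fun y => ln (jac_weight 1 a b y) + ln (Nb (transition a b y))) x.
  apply: (@pderiv_eq_on _ _ O) => // y Oy; have [_ h1 h2 _] := overlap_sub Oy.
  by rewrite (form_norm_transition Oy) lnM // posrE; [exact: jac_weight_gt0 | exact: Nb0].
rewrite pderivD; [|exact: smooth_derivable sw ov|exact: smooth_derivable sc ov].
congr (_ + _).
have dt j : derivable (fun y => transition a b y 0 j) x (delta_mx 0 i).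
  by apply: (smooth_derivable _ ov); exact: overlap_smooth.
have [_ e] := @is_derive_comp R _ _ 0 _ (fun y => ln (Nb y)) (transition a b) x _ oB (sl 1%N) ob dt.
rewrite [LHS]e mxE; apply: eq_bigr => j _.
by rewrite [grad _ _ 0 j]mxE [(_^T) j i]mxE [jac _ _ i j]mxE mulrC.
Qed.

End ChartTransitions.

(** * Selfdual 2-forms *)

Section SelfDual.
Variable R : realType.

Lemma is_selfdual_comb (g A B : 'M[R]_4) (a b : R) :
  is_selfdual g A -> is_selfdual g B -> is_selfdual g (a *: A + b *: B).
Proof.
rewrite /is_selfdual => hA hB.
suff -> : hodge g (a *: A + b *: B) = a *: hodge g A + b *: hodge g B by rewrite hA hB.
apply/matrixP => i j; rewrite entryD !entryZ /hodge !mxE.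
rewrite mulrCA [b * _]mulrCA -mulrDr; congr (_ * _).
rewrite !mulr_sumr -big_split; apply: eq_bigr => k _ /=.
rewrite !mulr_sumr -big_split; apply: eq_bigr => l _ /=.
rewrite mulmxDr mulmxDl -!scalemxAr -!scalemxAl entryD !entryZ mulrDr.
by rewrite [_ * (a * _)]mulrCA [_ * (b * _)]mulrCA.
Qed.

Lemma is_selfdualZ (g A : 'M[R]_4) (a : R) : is_selfdual g A -> is_selfdual g (a *: A).
Proof. by move=> h; have := is_selfdual_comb a 0 h h; rewrite scale0r addr0. Qed.

Lemma faraday_comb n (U : set 'rV[R]_n) (al be : 'rV[R]_n -> 'rV[R]_n) (a b : R) x :
  U x -> smooth_mx U al -> smooth_mx U be ->
  faraday (fun y => a *: (al y + b *: be y)) x = a *: (faraday al x + b *: faraday be x).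
Proof.
move=> Ux sal sbe.
have comp i j : pderiv i (fun y => (a *: (al y + b *: be y)) 0 j) x =
    a * (pderiv i (fun y => al y 0 j) x + b * pderiv i (fun y => be y 0 j) x).
  have -> : (fun y => (a *: (al y + b *: be y)) 0 j) = (a \*: ((fun y => al y 0 j) + (b \*: (fun y => be y 0 j)))).
    by apply/funext => y; rewrite !mxE.
  have d1 := smooth_derivable (i := i) (sal 0 j) Ux.
  have d2 := smooth_derivable (i := i) (sbe 0 j) Ux.
  have D := is_deriveZ a (is_deriveD (derivableP d1) (is_deriveZ b (derivableP d2))).
  by have [_ e] := D; exact: e.
apply/matrixP => i j; rewrite !mxE !comp.
move: (pderiv i _ x) (pderiv i _ x) (pderiv j _ x) (pderiv j _ x) => p q r s.
by ring.
Qed.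

End SelfDual.

(** * The theorem *)

Section ConformalSubmersion.
Variables (R : realType) (p : nat) (M : oriented_manifold R p.+2).

(** The direction of th is a positive multiple of the dual vector field, and both have
    the same fibres and the same orthogonal complement. *)
Lemma conformal_submersion_of_sharp (Om : set M)
    (c : chart M -> 'rV[R]_p.+2 -> 'M[R]_p.+2) (th : chart M -> 'rV[R]_p.+2 -> 'rV[R]_p.+2) :
  weightless_unit_field Om c (fun a x => direction (c a) (th a) x) ->
  (forall a, open (chart_img Om a)) -> (forall a, conformal_metric (chart_img Om a) (c a)) ->
  (forall a, smooth_mx (chart_img Om a) (th a)) ->
  (forall a x, chart_img Om a x -> th a x != 0) ->
  (forall a x, chart_img Om a x ->
     transversely_conformal (fun y => invmx (c a y)) (fun y => th a y *m invmx (c a y)) x) ->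
  conformal_submersion Om c (fun a x => direction (c a) (th a) x).
Proof.
move=> wu oO cm st t0 conf; split=> // a x ax.
have uc y : chart_img Om a y -> c a y \in unitmx.
  by have [_ h] := cm a; move=> /h[s q _]; exact: posdef_unit (conj s q).
have sT : smooth_mx (chart_img Om a) (fun y => th a y *m invmx (c a y)).
  apply: smooth_mxM => //; apply: smooth_mx_inv => //.
  by case: (cm a).
have T0 y : chart_img Om a y -> th a y *m invmx (c a y) != 0.
  by move=> ay; apply: contra_neq (t0 a y ay) => h; rewrite -(mulmxKV (uc y ay) (th a y)) h mul0mx.
have [V [B [pi [h [[oV Vx VO] hB sp hy]]]]] := conformal_projection (oO a) (cm a) sT T0 (conf a) ax.
exists V, B, pi, h; split=> // y Vy.
have [rk XJ [lam l0 hl]] := hy y Vy; split=> //.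
  by rewrite /direction -scalemxAl XJ scaler0.
have n0 : (form_norm (c a) (th a) y)^-1 != 0.
  by rewrite invr_eq0 gt_eqF // (form_norm_gt0 (cm a) (t0 a)) //; exact: VO.
have perp v : bil (c a y) (direction (c a) (th a) y) v = 0 ->
    bil (c a y) (th a y *m invmx (c a y)) v = 0.
  rewrite /bil /direction -!scalemxAl entryZ => /eqP.
  by rewrite mulf_eq0 (negPf n0) => /eqP.
by exists lam => // v w /perp hv /perp hw; exact: hl.
Qed.

End ConformalSubmersion.

Unset Implicit Arguments.

Theorem mainTheorem8 (R : realType) (M : oriented_manifold R 4)
    (c : chart M -> 'rV[R]_4 -> 'M[R]_4)
    (Dp Dm : chart M -> 'rV[R]_4 -> 'rV[R]_4)
    (Gp Gm : chart M -> 'I_4 -> 'rV[R]_4 -> 'M[R]_4)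
    (hc : conformal_structure [set: M] c)
    (hDp : einstein_weyl [set: M] c Dp Gp)
    (hDm : einstein_weyl [set: M] c Dm Gm)
    (hFp : forall a x, chart_img [set: M] a x ->
       is_selfdual (c a x) (faraday (Dp a) x))
    (hFm : forall a x, chart_img [set: M] a x ->
       is_selfdual (c a x) (faraday (Dm a) x)) :
  let th a x := 2^-1 *: (Dp a x - Dm a x) in
  let D a x := 2^-1 *: (Dp a x + Dm a x) in
  let Om : set M := nonvanishing th in
  let xi a x := direction (c a) (th a) x in
  let D0 a x := D a x - (form_norm (c a) (th a) x)^-1 *:
      density_deriv (-1) (D a) (form_norm (c a) (th a)) x in
  [/\ selfdual_conformal_submersion Om c xi,
      minimal_weyl_derivative Om c xi D0,
      forall a x, chart_img Om a x ->
        is_selfdual (c a x) (alt (c a x)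
          (weighted_vector_deriv (-1) (D0 a) (Gp a) (xi a) x))
    & forall a x, chart_img Om a x ->
        is_selfdual (c a x) (alt (c a x)
          (weighted_vector_deriv (-1) (D0 a) (Gm a) (xi a) x))].
Proof.
move=> th D Om xi D0.
have [[[sDp tDp] wGp] ewp] := hDp; have [[[sDm tDm] wGm] ewm] := hDm.
have oR a : open (chart_img [set: M] a) by exact: chart_range_open.
have two0 : 2 != 0 :> R by rewrite pnatr_eq0.
have sth a : smooth_mx (chart_img [set: M] a) (th a).
  by apply: smooth_mxZ => //; [exact: smooth_cst | exact: smooth_mxB].
have sD a : smooth_mx (chart_img [set: M] a) (D a).
  by apply: smooth_mxZ => //; [exact: smooth_cst | exact: smooth_mxD].
have tth a b x : chart_img (chart_dom b `&` [set: M]) a x ->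
    th a x = th b (transition a b x) *m (jac (transition a b) x)^T.
  move=> ov; rewrite /th (tDp a b x ov) (tDm a b x ov) -scalemxAl mulmxBl.
  by rewrite opprD addrACA subrr addr0.
have hD : weyl_derivative [set: M] D.
  split=> // a b x ov; rewrite /D (tDp a b x ov) (tDm a b x ov) -scalemxAl mulmxDl.
  move: (Dp b _ *m _) (Dm b _ *m _) (grad _ x) => p q r.
  by apply/rowP => i; rewrite !(entryD, entryZ); field.
have DpE a x : Dp a x = D a x + th a x.
  by apply/rowP => i; rewrite /D /th !(entryB, entryD, entryN, entryZ); field.
have DmE a x : Dm a x = D a x - th a x.
  by apply/rowP => i; rewrite /D /th !(entryB, entryD, entryN, entryZ); field.
pose G a i x := Gm a i x + weyl_shift (c a x) (th a x) i.
have cR a : conformal_metric (chart_img [set: M] a) (c a) by exact: (proj1 hc a).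
have wG a : weyl_connection (chart_img [set: M] a) (c a) (D a) (G a).
  have := weyl_connection_shift (oR a) (cR a) (wGm a) (sth a).
  by have -> : (fun x => Dm a x + th a x) = D a by apply/funext => x; rewrite DmE subrK.
have wGp' a : weyl_connection (chart_img [set: M] a) (c a) (fun x => D a x + th a x) (Gp a).
  by have -> : (fun x => D a x + th a x) = Dp a by apply/funext => x; rewrite DpE.
have wGm' a : weyl_connection (chart_img [set: M] a) (c a) (fun x => D a x - th a x) (Gm a).
  by have -> : (fun x => D a x - th a x) = Dm a by apply/funext => x; rewrite DmE.
have kill a x : chart_img [set: M] a x -> exists kappa : R, forall i j,
    cov_form (th a) (G a) x i j + cov_form (th a) (G a) x j i = kappa * c a x i j.
  move=> ax; apply: (einstein_weyl_conformal_form _ (oR a) (cR a) (sth a) (wG a) (wGp' a) (wGm' a) ax) => //.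
    exact: ewp.
  exact: ewm.
(* restriction to the open set where th does not vanish *)
have sub a : chart_img Om a `<=` chart_img [set: M] a.
  exact: (chart_img_sub tth).
have nz a x : chart_img Om a x -> th a x != 0.
  exact: (form_nonzero tth).
have oO a : open (chart_img Om a) by exact: (chart_img_nonvanishing_open sth tth).
have cO a := conformal_metric_sub (sub a) (cR a).
have sthO a := smooth_mx_sub (sub a) (sth a).
have sDO a := smooth_mx_sub (sub a) (sD a).
have wGO a := weyl_connection_sub (sub a) (wG a).
have wu : weightless_unit_field Om c xi.
  split.
  - by move=> a; exact: (smooth_direction (oO a) (cO a) (sthO a) (@nz a)).
  - by move=> a x ax; exact: (direction_unit (cO a) (@nz a) ax).
  - by move=> a b x ov; exact: (direction_transition hc tth ov).
have minimal : minimal_weyl_derivative Om c xi D0.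
  exists (fun a => adapted_connection (c a) (D a) (th a) (G a)).
    split; first exact: (adapted_form_transition hc sth tth hD).
    by move=> a; exact: (adapted_weyl_connection (oO a) (cO a) (sDO a) (sthO a) (wGO a) (@nz a)).
  move=> a x ax; have [kappa hk] := kill a x (sub a x ax).
  exact: (adapted_weyl_form_minimal (oO a) (cO a) (sthO a) (wGO a) (@nz a) ax hk).
have fth a x : chart_img Om a x -> is_selfdual (c a x) (faraday (th a) x).
  move=> /sub ax; have -> : faraday (th a) x = 2^-1 *: (faraday (Dp a) x + (-1) *: faraday (Dm a) x).
    rewrite -(faraday_comb _ _ ax (sDp a) (sDm a)); congr (faraday _ x).
    by apply/funext => y; rewrite scaleN1r.
  apply: is_selfdualZ; rewrite -[faraday (Dp a) x]scale1r.
  by apply: is_selfdual_comb; [exact: hFp | exact: hFm].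
have altE s Gam a x : chart_img Om a x ->
    (forall i, Gam i x = G a i x + weyl_shift (c a x) (s *: th a x) i) ->
    is_selfdual (c a x) (alt (c a x) (weighted_vector_deriv (-1) (D0 a) Gam (xi a) x)).
  move=> ax hG.
  have -> := adapted_deriv_alt (oO a) (cO a) (sthO a) (wGO a) (@nz a) ax hG.
  by apply: is_selfdualZ; exact: fth.
split=> //.
- split.
    apply: conformal_submersion_of_sharp => // a x ax.
    have [kappa hk] := kill a x (sub a x ax).
    exact: (sharp_transversely_conformal (oO a) (cO a) (sthO a) (wGO a) ax hk).
  exists D0 => // a x ax.
  have -> : faraday (D0 a) x = 2 *: faraday (D a) x.
    exact: (faraday_adapted (oO a) (cO a) (sDO a) (sthO a) (@nz a) ax).
  apply: is_selfdualZ; have /sub ax' := ax.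
  have -> : faraday (D a) x = 2^-1 *: (faraday (Dp a) x + 1 *: faraday (Dm a) x).
    rewrite -(faraday_comb _ _ ax' (sDp a) (sDm a)); congr (faraday _ x).
    by apply/funext => y; rewrite scale1r.
  apply: is_selfdualZ; rewrite -[faraday (Dp a) x]scale1r.
  by apply: is_selfdual_comb; [exact: hFp | exact: hFm].
- move=> a x ax; apply: (altE 1) => // i.
  rewrite (weyl_connection_unique (cR a) i (wG a) (wGp' a) (sub a x ax)).
  by rewrite [D a x + _]addrC addrK scale1r.
move=> a x ax; apply: (altE (-1)) => // i.
rewrite (weyl_connection_unique (cR a) i (wG a) (wGm' a) (sub a x ax)).
by rewrite [D a x - _]addrC addrK scaleN1r.
Qed.
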